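(* Let $k \geq 3$ be a fixed integer. The decision problem $k$-DIOMEGA-ORDERING — given a tournament $T$, decide whether $\vec{\omega}(T) \leq k$ — is NP-complete.
   Context: A tournament is an orientation of a complete graph. Given a tournament $T$ and a total order $\prec$ on $V(T)$, the backedge graph $T^{\prec}$ is the undirected graph with vertex set $V(T)$ in which $u,v$ with $u \prec v$ are adjacent if and only if $vu \in A(T)$. The clique number of the tournament is $\vec{\omega}(T) = \min_{\prec} \omega(T^{\prec})$ over all total orders $\prec$ of $V(T)$. *)

(* Defs.v *)
From HB Require Import structures.
From mathcomp Require Import all_boot all_order all_algebra.

Set Implicit Arguments.
Unset Strict Implicit.
Unset Printing Implicit Defensive.

Section Tournaments.
Variable V : finType.

Record tournament := Tournament {
  arc :> rel V;
  arc_irrefl : irreflexive arc;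
  arc_orient : forall u v, u != v -> arc u v = ~~ arc v u
}.

(* A binary relation on V is given as its set of pairs, so that the total     *)
(* orders on V form a finite collection over which a minimum can be taken.    *)
Definition strict_total_order (r : {set V * V}) : bool :=
  [&& [forall u, (u, u) \notin r],
      [forall u, forall v, forall w,
         ((u, v) \in r) && ((v, w) \in r) ==> ((u, w) \in r)]
    & [forall u, forall v, (u != v) ==> ((u, v) \in r) || ((v, u) \in r)]].

Definition backedge (T : tournament) (r : {set V * V}) : rel V :=
  fun u v => ((u, v) \in r) && T v u || ((v, u) \in r) && T u v.

Definition clique (e : rel V) (K : {set V}) : bool :=
  [forall u in K, forall v in K, (u != v) ==> e u v].

Definition clique_number (e : rel V) : nat :=
  \max_(K : {set V} | clique e K) #|K|.

(* The default value #|V| bounds every clique number from above and there is  *)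
(* at least one total order on V, so this is the minimum over all orders.     *)
Definition diclique_number (T : tournament) : nat :=
  \big[minn/#|V|]_(r : {set V * V} | strict_total_order r)
    clique_number (backedge T r).

End Tournaments.

(* Deterministic multi-tape Turing machines. The tape alphabet consists of    *)
(* the blank None, the bits Some (inl b) and auxiliary symbols Some (inr a).  *)
Inductive direction := Left | Stay | Right.

Record TM := MkTM {
  tapes_pred : nat;
  aux : finType;
  state : finType;
  start : state;
  halting : pred state;
  trans : state -> {ffun 'I_tapes_pred.+1 -> option (bool + aux)} ->
          state * {ffun 'I_tapes_pred.+1 -> option (bool + aux) * direction}
}.

Section Semantics.
Variable M : TM.

Definition symbol : Type := option (bool + aux M).

(* A two-way infinite tape (l, r): r is the content from the scanned cell     *)
(* rightwards, l the content left of the scanned cell, nearest cell first;    *)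
(* all cells beyond the two lists are blank.                                  *)
Definition tape : Type := (seq symbol * seq symbol)%type.

Definition scanned (t : tape) : symbol := head None t.2.

Definition update (t : tape) (a : symbol * direction) : tape :=
  let r := a.1 :: behead t.2 in
  match a.2 with
  | Left => (behead t.1, head None t.1 :: r)
  | Stay => (t.1, r)
  | Right => (a.1 :: t.1, behead r)
  end.

Definition config : Type :=
  (state M * {ffun 'I_(tapes_pred M).+1 -> tape})%type.

Definition step (c : config) : config :=
  if halting c.1 then c else
  let a := trans c.1 [ffun i => scanned (c.2 i)] in
  (a.1, [ffun i => update (c.2 i) (a.2 i)]).

(* The i-th input word is written on the i-th tape, with the head on its      *)
(* first bit.                                                                 *)
Definition init (ws : seq (seq bool)) : config :=
  (start M,
   [ffun i : 'I_(tapes_pred M).+1 =>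
      ([::], [seq Some (inl b) | b <- nth [::] ws i])]).

Fixpoint read_bits (s : seq symbol) : seq bool :=
  if s is Some (inl b) :: s' then b :: read_bits s' else [::].

Definition output (c : config) : seq bool := read_bits (c.2 ord0).2.

Definition outputs_within (ws : seq (seq bool)) (t : nat) (y : seq bool) :=
  let c := iter t step (init ws) in halting c.1 /\ output c = y.

End Semantics.

Definition polytime_function (f : seq bool -> seq bool) : Prop :=
  exists (M : TM) (p : {poly nat}),
    forall x, outputs_within M [:: x] p.[size x]%R (f x).

Definition polytime_verifier (R : seq bool -> seq bool -> bool) : Prop :=
  exists (M : TM) (p : {poly nat}),
    forall x u, outputs_within M [:: x; u] p.[(size x + size u)%N]%R [:: R x u].

Definition language : Type := seq bool -> Prop.

Definition in_NP (L : language) : Prop :=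
  exists (R : seq bool -> seq bool -> bool) (q : {poly nat}),
    polytime_verifier R /\
    forall x, L x <-> exists u, size u <= q.[size x]%R /\ R x u.

Definition polytime_reducible (L1 L2 : language) : Prop :=
  exists f : seq bool -> seq bool,
    polytime_function f /\ forall x, L1 x <-> L2 (f x).

Definition NP_hard (L : language) : Prop :=
  forall L' : language, in_NP L' -> polytime_reducible L' L.

Definition NP_complete (L : language) : Prop := in_NP L /\ NP_hard L.

(* The n * n adjacency matrix in row-major order; its length determines n.    *)
Definition encode_tournament (n : nat) (T : tournament 'I_n) : seq bool :=
  [seq T i j | i <- enum 'I_n, j <- enum 'I_n].

(* Words that encode no tournament are no-instances.                          *)
Definition diomega_ordering (k : nat) : language := fun w =>
  exists (n : nat) (T : tournament 'I_n),
    w = encode_tournament T /\ diclique_number T <= k.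

(* Main.v *)
(** Membership: the certificate is the matrix of an ordering, and all that has
    to be verified is a first-order statement with quantifiers bounded by the
    input size; such statements are decided in polynomial time by loops over
    unary counters, each counter being a head position on a marked tape.

    Hardness: the computation of a verifier, written relative to its heads, is
    described by clauses with three literals that only relate neighbouring
    cells of a grid.  They are expressed by a tournament Y which splits into
    two transitive parts exactly when they are satisfiable: a backward arc over
    a cyclic triangle forces different parts for its ends, and a cyclic
    triangle forbids three equal parts.  The adjacency matrix of Y is again
    bounded first-order definable.

    To turn splitting into the bound k on clique numbers, Y is glued to a fixed
    frame S1 + S2 with Y => S1 and S2 => Y, in which every ordering of clique
    number at most k has a (k-1)-clique in S1 lying before a (k-1)-clique in
    S2: the vertices of Y after the former and those before the latter are then
    transitive.  The frame is a sequence of vertices x_0, x_1, ... separated by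
    copies of a tournament U of clique number k.  In an ordering of clique
    number at most k, the number of elements before x_i in a k-clique of the
    copy preceding x_i is a colour of x_i, and equal colours force the natural
    order.  So a vertex Folkman graph on the x_i contains naturally ordered
    (k-1)-cliques, and 2(k-1) > k, i.e. k >= 3, prevents the cliques in S1 and
    S2 from being interchanged. *)

Require Import Defs.
From mathcomp Require Import all_boot.
From mathcomp Require Import all_order all_algebra.
From mathcomp Require Import zify.

Set Implicit Arguments.
Unset Strict Implicit.
Unset Printing Implicit Defensive.

(** * Stack-and-counter programs on Turing machines *)


(** The frame depends on [k] alone. It comes out of existence proofs without a useful size bound,
    and none is required: its arcs enter the reduction formula as a finite table. The lemmas on
    frames and gluing carry [k - 1] in place of the [k] of the theorem. The bound leaves no slack:
    the frame itself must be orderable with clique number at most [k], yet with cliques of at most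
    [k - 1] vertices inside S1 and inside S2, so that a vertex of Y can join them. Hence U is taken
    vertex-critical, and each copy is divided between S1 and S2 as one vertex against the rest.
    Exchanging the two parts of a splitting is harmless, so a cyclic triangle expresses
    not-all-equal rather than a disjunction. A reference vertex fixes which part means true, and a
    clause becomes two such triangles joined by an auxiliary value. Drawing every head in one fixed
    column makes a head move shift a whole row. The scanned symbols therefore have to be known in
    every column, and, as a clause has three literals only, they are matched against a transition
    one tape at a time. *)

Definition sym := option (bool + unit).
Definition mark : sym := Some (inr tt).
(** This and the next functions copy [tape], [scanned], [update] and [read_bits] for a fixed
    alphabet with one auxiliary symbol, so that programs are studied before they are wrapped into a
    machine. *)
Definition stape := (seq sym * seq sym)%type.
Definition scn (t : stape) : sym := head None t.2.
Definition upd (t : stape) (a : sym * direction) : stape :=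
  let r := a.1 :: behead t.2 in
  match a.2 with
  | Left => (behead t.1, head None t.1 :: r)
  | Stay => (t.1, r)
  | Right => (a.1 :: t.1, behead r)
  end.
Fixpoint rbits (s : seq sym) : seq bool :=
  if s is Some (inl b) :: s' then b :: rbits s' else [::].

Definition bits (w : seq bool) : seq sym := [seq Some (inl b) | b <- w].

(** The mark sits in cell 0 and the word starts in cell 1: a head on cell [p] stores the number [p],
    and reading the mark is the test for zero. *)
Definition cell (w : seq bool) (j : nat) : sym :=
  if j is j'.+1 then nth None (bits w) j' else mark.

(** Stated through [nth], since the two lists of a tape may carry any number of trailing blanks. *)
Definition tape_at (w : seq bool) (p : nat) (t : stape) :=
  (forall j, nth None t.2 j = cell w (p + j)) /\
  (forall j, nth None t.1 j = if j < p then cell w (p - j.+1) else None).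

Lemma tape_at_scn w p t : tape_at w p t -> scn t = cell w p.
Proof. by case=> h _; rewrite /scn -nth0 h addn0. Qed.

Lemma tape_at_right w p t :
  tape_at w p t -> tape_at w p.+1 (upd t (scn t, Right)).
Proof.
move=> h; have hs := tape_at_scn h; case: h => h1 h2.
split=> [j|[|j]] /=; first by rewrite nth_behead h1 addnS.
  by rewrite hs subn1.
by rewrite h2 ltnS subSS.
Qed.

Lemma tape_at_stay w p t : tape_at w p t -> tape_at w p (upd t (scn t, Stay)).
Proof.
move=> h; have hs := tape_at_scn h; case: h => h1 h2.
split=> //= -[|j] /=; first by rewrite hs addn0.
by rewrite nth_behead h1.
Qed.

Lemma tape_at_left w p t :
  tape_at w p.+1 t -> tape_at w p (upd t (scn t, Left)).
Proof.
move=> h; have hs := tape_at_scn h; case: h => h1 h2.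
split=> [[|[|j]]|j] /=.
- by rewrite -nth0 h2 /= subn1 addn0.
- by rewrite hs addn1.
- by rewrite nth_behead h1 !addnS.
by rewrite nth_behead h2 ltnS subSS.
Qed.

Lemma tape_at_write w b t :
  tape_at w (size w).+1 t ->
  tape_at (rcons w b) (size w).+2 (upd t (Some (inl b), Right)).
Proof.
case=> h1 h2.
have hc q : q <= size w -> cell w q = cell (rcons w b) q.
  case: q => //= q hq; rewrite /bits map_rcons nth_rcons size_map hq //.
split=> [j|[|j]] /=.
- by rewrite nth_behead h1 !addSn /= /bits !nth_default // ?size_map ?size_rcons; lia.
- by rewrite ?subSS ?subn0 /= /bits map_rcons nth_rcons size_map ltnn eqxx.
rewrite h2 [in RHS]ltnS !subSS; case: ltnP => // hj.
by rewrite hc // leq_subr.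
Qed.

Definition setp (p : nat -> nat) i v : nat -> nat := fun j => if j == i then v else p j.

Section Programs.
Variable m : nat.
Notation I := 'I_m.+1.
Notation sv := {ffun I -> sym}.
Notation av := {ffun I -> sym * direction}.
Notation tps := {ffun I -> stape}.

(* A program is a finite control with exits labelled in E, so that programs   *)
(* compose without any cost in time.                                          *)
Record prog (E : Type) := Prog {
  pts : finType;
  entry : pts;
  stp : pts -> sv -> (pts + E) * av
}.

Definition pstep E (P : prog E) q (ts : tps) : (pts P + E) * tps :=
  let a := stp q [ffun i => scn (ts i)] in (a.1, [ffun i => upd (ts i) (a.2 i)]).

Inductive runs E (P : prog E) : pts P -> tps -> nat -> E -> tps -> Prop :=
| runs_exit q ts e ts' : pstep q ts = (inr e, ts') -> runs q ts 1 e ts'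
| runs_step q ts q' ts1 n e ts' : pstep q ts = (inl q', ts1) ->
    runs q' ts1 n e ts' -> runs q ts n.+1 e ts'.

Definition bind (E : finType) E' (P : prog E) (F : E -> prog E') : prog E' :=
  @Prog E' (pts P + {e : E & pts (F e)})%type (inl (entry P))
    (fun q s => match q with
     | inl q => let a := stp q s in
         (inl (match a.1 with inl q' => inl q'
               | inr e => inr (existT (fun e => pts (F e)) e (entry (F e))) end), a.2)
     | inr (existT e q) => let a := stp q s in
         (match a.1 with inl q' => inl (inr (existT (fun e => pts (F e)) e q'))
          | inr e' => inr e' end, a.2)
     end).

Definition loop E (P : prog (option E)) : prog E :=
  @Prog E (pts P) (entry P)
    (fun q s => let a := stp q s in
       (match a.1 with inl q' => inl q' | inr None => inl (entry P)
        | inr (Some e) => inr e end, a.2)).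

Definition atom E (g : sv -> E * av) : prog E :=
  @Prog E unit tt (fun _ s => let a := g s in (inr a.1, a.2)).

Lemma runs_bind (E : finType) E' (P : prog E) (F : E -> prog E') q ts n e ts1 n2 e' ts2 :
  runs (P := P) q ts n e ts1 -> runs (entry (F e)) ts1 n2 e' ts2 ->
  runs (P := bind P F) (inl q) ts (n + n2) e' ts2.
Proof.
have hr e0 q0 t0 k t1 : runs (P := F e0) q0 t0 k e' t1 ->
    runs (P := bind P F) (inr (existT (fun e => pts (F e)) e0 q0)) t0 k e' t1.
  elim=> {q0 t0 k t1} [q0 t0 e1 t1|q0 t0 q1 t1 k e1 t2] h.
    by apply: runs_exit; move: h; rewrite /pstep /= => -[-> <-].
  by move=> _ ih; apply: runs_step ih; move: h; rewrite /pstep /= => -[-> <-].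
move=> h h2; elim: h h2 => {q ts n e ts1} [q ts e ts1|q ts q' ts1 n e ts3] h.
  move=> /hr h2; apply: runs_step h2; move: h; rewrite /pstep /= => -[-> <-] //.
move=> _ ih /ih {}ih; rewrite addSn; apply: runs_step ih.
by move: h; rewrite /pstep /= => -[-> <-].
Qed.

Lemma runs_loop_exit E (P : prog (option E)) q ts n e ts1 :
  runs (P := P) q ts n (Some e) ts1 -> runs (P := loop P) q ts n e ts1.
Proof.
move eqe: (Some e) => e' h.
elim: h eqe => {q ts n e' ts1} [q ts e1 t1|q ts q1 t1 k e1 t2] h.
  by move=> he; apply: runs_exit; move: h; rewrite -he /pstep /= => -[-> <-].
move=> _ ih /ih {}ih; apply: runs_step ih; move: h; rewrite /pstep /= => -[-> <-] //.
Qed.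

Lemma runs_loop_continue E (P : prog (option E)) q ts n e ts1 n2 ts2 :
  runs (P := P) q ts n None ts1 -> runs (P := loop P) (entry P) ts1 n2 e ts2 ->
  runs (P := loop P) q ts (n + n2) e ts2.
Proof.
move eqe: None => e' h.
elim: h eqe => {q ts n e' ts1} [q ts e1 t1|q ts q1 t1 k e1 t2] h.
  move=> he; rewrite -{}he in h => h2; rewrite add1n.
  by apply: runs_step h2; move: h; rewrite /pstep /= => -[-> <-].
move=> _ ih /ih {}ih h2; rewrite addSn; apply: runs_step (ih h2).
by move: h; rewrite /pstep /= => -[-> <-].
Qed.

Section Words.
Variables x u : seq bool.

Definition word (i : nat) := if i == 2 then x else if i == 3 then u else [::].

(* Tape 0 is an output stack, tape 1 is ignored; tapes 2 and 3 carry x and u  *)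
(* behind a mark; tapes 4, 5, ... are registers holding their head position.  *)
Definition rep (p : nat -> nat) (o : seq bool) (ts : tps) :=
  [/\ all (pred1 None) (ts ord0).1, rbits (ts ord0).2 = o &
      forall i : I, 2 <= i -> tape_at (word i) (p i) (ts i)].

(** A total-correctness Hoare triple. [T] is only an upper bound on the steps, so that estimates can
    be rounded up. *)
Definition does E (P : prog E) p o T e p' o' :=
  forall ts, rep p o ts -> exists t ts',
    [/\ t <= T, runs (entry P) ts t e ts' & rep p' o' ts'].

Lemma rep_ext p p' o ts : p =1 p' -> rep p o ts -> rep p' o ts.
Proof. by move=> hp [h1 h2 h3]; split=> // i; rewrite -hp; apply: h3. Qed.

Lemma does_ext E (P : prog E) p1 p o T1 T e p1' p' o' :
  does P p1 o T1 e p1' o' -> p1 =1 p -> p1' =1 p' -> T1 <= T ->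
  does P p o T e p' o'.
Proof.
move=> h hp hp' hT ts hts.
have [t [ts' [h1 h2 h3]]] := h ts (rep_ext (fsym hp) hts).
by exists t, ts'; split=> //; [apply: leq_trans hT | apply: rep_ext h3].
Qed.

Lemma does_bind (E : finType) E' (P : prog E) (F : E -> prog E')
  p o T1 e p1 o1 T2 e' p2 o2 :
  does P p o T1 e p1 o1 -> does (F e) p1 o1 T2 e' p2 o2 ->
  does (bind P F) p o (T1 + T2) e' p2 o2.
Proof.
move=> hP hF ts /hP [t [ts1 [h1 h2 /hF [t' [ts2 [h3 h4 h5]]]]]].
exists (t + t'), ts2; split=> //; first exact: leq_add.
exact: runs_bind h2 h4.
Qed.

Lemma does_loop_exit E (P : prog (option E)) p o T e p1 o1 :
  does P p o T (Some e) p1 o1 -> does (loop P) p o T e p1 o1.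
Proof.
move=> hP ts /hP [t [ts1 [h1 h2 h3]]]; exists t, ts1; split=> //.
exact: runs_loop_exit.
Qed.

Lemma does_loop_continue E (P : prog (option E)) p o T p1 o1 T2 e p2 o2 :
  does P p o T None p1 o1 -> does (loop P) p1 o1 T2 e p2 o2 ->
  does (loop P) p o (T + T2) e p2 o2.
Proof.
move=> hP hF ts /hP [t [ts1 [h1 h2 /hF [t' [ts2 [h3 h4 h5]]]]]].
exists (t + t'), ts2; split=> //; first exact: leq_add.
exact: runs_loop_continue h2 h4.
Qed.

Definition ret E (e : E) : prog E := atom (fun s => (e, [ffun i => (s i, Stay)])).
Definition move1 (i0 : nat) d : prog unit :=
  atom (fun s => (tt, [ffun i : I => (s i, if i == i0 :> nat then d else Stay)])).
Definition is0 (i0 : nat) : prog bool :=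
  atom (fun s => (s (inord i0) == mark, [ffun i => (s i, Stay)])).
Definition rd (i0 : nat) : prog bool :=
  atom (fun s => (s (inord i0) == Some (inl true), [ffun i => (s i, Stay)])).
(** The stack grows to the left, so words are emitted from their last bit to their first, and the
    head ends on the first bit, where [output] starts to read. *)
Definition emit (b : bool) : prog unit :=
  @Prog unit bool false (fun q s =>
    if q then (inr tt, [ffun i : I => (if i == 0 :> nat then Some (inl b) else s i, Stay)])
    else (inl true, [ffun i : I => (s i, if i == 0 :> nat then Left else Stay)])).
Definition andthen E (P : prog unit) (Q : prog E) := bind P (fun=> Q).
Notation "P ;; Q" := (andthen P Q) (at level 60, right associativity).
Definition ite E (P : prog bool) (A B : prog E) := bind P (fun b => if b then A else B).

Lemma out_stay (t : stape) o : all (pred1 None) t.1 -> rbits t.2 = o ->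
  all (pred1 None) (upd t (scn t, Stay)).1 /\ rbits (upd t (scn t, Stay)).2 = o.
Proof. by case: t => l [|a r]. Qed.

Lemma does_ret E (e : E) p o : does (ret e) p o 1 e p o.
Proof.
move=> ts [h1 h2 h3]; exists 1, [ffun i => upd (ts i) (scn (ts i), Stay)].
split=> //; first by apply: runs_exit; rewrite /pstep /=; congr pair;
  apply/ffunP=> i; rewrite !ffunE.
have [h4 h5] := out_stay h1 h2.
by split=> [||i hi]; rewrite ffunE //; apply: tape_at_stay (h3 i hi).
Qed.

Lemma does_atomb (g : sv -> bool) p o b : (forall ts, rep p o ts ->
    g [ffun i => scn (ts i)] = b) ->
  does (atom (fun s => (g s, [ffun i => (s i, Stay)]))) p o 1 b p o.
Proof.
move=> hg ts hts; have [h1 h2 h3] := hts.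
exists 1, [ffun i => upd (ts i) (scn (ts i), Stay)].
split=> //; first by apply: runs_exit; rewrite /pstep /= hg //; congr pair;
  apply/ffunP=> i; rewrite !ffunE.
have [h4 h5] := out_stay h1 h2.
by split=> [||i hi]; rewrite ffunE //; apply: tape_at_stay (h3 i hi).
Qed.

Lemma does_is0 i p o : 2 <= i <= m -> does (is0 i) p o 1 (p i == 0) p o.
Proof.
move=> /andP[hi him]; apply: (does_atomb (g := fun s => s _ == mark)) => ts [_ _ h].
have hi' : 2 <= (inord i : I) by rewrite inordK.
rewrite ffunE (tape_at_scn (h _ hi')) inordK //.
case: (p i) => //= j; apply/eqP; rewrite /bits => hj.
have [hj'|hj'] := ltnP j (size (word i)); last by rewrite nth_default ?size_map in hj.
by rewrite (nth_map false) in hj.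
Qed.

Lemma does_rd i p o : 2 <= i <= m ->
  does (rd i) p o 1 ((0 < p i) && nth false (word i) (p i).-1) p o.
Proof.
move=> /andP[hi him]; apply: (does_atomb (g := fun s => s _ == Some (inl true))) => ts [_ _ h].
have hi' : 2 <= (inord i : I) by rewrite inordK.
rewrite ffunE (tape_at_scn (h _ hi')) inordK //.
case: (p i) => //= j; rewrite /bits.
have [hj'|hj'] := ltnP j (size (word i)); last by rewrite !nth_default ?size_map.
by rewrite (nth_map false) //; case: nth.
Qed.

Lemma does_move i d p o v : 2 <= i ->
  (forall w t, tape_at w (p i) t -> tape_at w v (upd t (scn t, d))) ->
  does (move1 i d) p o 1 tt (setp p i v) o.
Proof.
move=> hi hd ts [h1 h2 h3].
exists 1, [ffun j : I => upd (ts j) (scn (ts j), if j == i :> nat then d else Stay)].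
split=> //; first by apply: runs_exit; rewrite /pstep /=; congr pair;
  apply/ffunP=> j; rewrite !ffunE.
have [h4 h5] := out_stay h1 h2.
split=> [||j hj]; rewrite ffunE /=; [by case: i hi hd|by case: i hi hd|].
rewrite /setp; case: eqP => [e|_]; last by apply: tape_at_stay (h3 j hj).
by apply: hd; rewrite -e; apply: h3.
Qed.

Lemma does_incr i p o : 2 <= i ->
  does (move1 i Right) p o 1 tt (setp p i (p i).+1) o.
Proof. by move=> hi; apply: does_move => // w t; apply: tape_at_right. Qed.

Lemma does_decr i p o : 2 <= i -> 0 < p i ->
  does (move1 i Left) p o 1 tt (setp p i (p i).-1) o.
Proof.
move=> hi hp; apply: does_move => // w t; rewrite -{1}(prednK hp).
exact: tape_at_left.
Qed.

Lemma does_emit b p o : does (emit b) p o 2 tt p (b :: o).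
Proof.
move=> ts [h1 h2 h3].
pose ts1 : tps := [ffun i : I => upd (ts i) (scn (ts i), if i == 0 :> nat then Left else Stay)].
pose ts2 : tps := [ffun i : I => upd (ts1 i) (if i == 0 :> nat then Some (inl b) else scn (ts1 i), Stay)].
exists 2, ts2; split=> //.
  apply: (@runs_step unit (emit b) false ts true ts1); rewrite /pstep /=.
    by congr pair; apply/ffunP=> i; rewrite !ffunE.
  by apply: runs_exit; rewrite /pstep /=; congr pair; apply/ffunP=> i; rewrite !ffunE.
split=> [||i hi].
- by rewrite !ffunE /=; case: (ts ord0) h1 => [] [//|a s] r /= /andP[].
- by rewrite !ffunE /= -h2; case: (ts ord0) => [l []].
rewrite !ffunE; have -> : (i == 0 :> nat) = false by apply/eqP=> h; rewrite h in hi.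
by apply: tape_at_stay; apply: tape_at_stay; apply: h3.
Qed.

Definition down a (body : prog unit) : prog unit :=
  loop (ite (is0 a) (ret (Some tt)) (move1 a Left ;; body ;; ret None)).

(** The invariants [st] and [os] are indexed by the value left in the counter. Besides the body, a
    round spends one step each on the zero test, the decrement and the return. *)
Lemma does_down a body T n (st : nat -> nat -> nat) (os : nat -> seq bool) :
  2 <= a <= m -> (forall k, k <= n -> st k a = k) ->
  (forall k, k < n -> does body (setp (st k.+1) a k) (os k.+1) T tt (st k) (os k)) ->
  does (down a body) (st n) (os n) (n * (T + 3) + 2) tt (st 0) (os 0).
Proof.
move=> ha; elim: n => [|n ih] hst hb.
  rewrite mul0n; apply: does_loop_exit; rewrite -[0 + 2]/(1 + 1).
  apply: (does_bind (does_is0 ha)); rewrite hst // eqxx; apply: does_ret.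
have -> : n.+1 * (T + 3) + 2 = (1 + (1 + (T + 1))) + (n * (T + 3) + 2) by lia.
apply: (does_loop_continue (p1 := st n) (o1 := os n)); last first.
  by apply: ih => [k hk|k hk]; [apply: hst; lia | apply: hb; lia].
apply: (does_bind (does_is0 ha)); rewrite hst //=.
apply: (does_bind (e := tt) (does_decr _ _)); [by case/andP: ha | by rewrite hst |].
rewrite hst //=; apply: (does_bind (e := tt) (hb n _)) => //; exact: does_ret.
Qed.

Definition clear a := down a (ret tt).

Lemma does_clear a p o : 2 <= a <= m ->
  does (clear a) p o (p a * 4 + 2) tt (setp p a 0) o.
Proof.
move=> ha.
have := @does_down a (ret tt) 1 (p a) (fun k => setp p a k) (fun=> o) ha.
rewrite /clear => h; apply: (does_ext (h _ _)) => //.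
- by move=> k _; rewrite /setp eqxx.
- by move=> k _; apply: (does_ext (@does_ret _ tt _ _)) => // j; rewrite /setp; case: eqP.
- by move=> j; rewrite /setp; case: eqP => // ->.
Qed.

(** A hit clears the counter, so that both outcomes leave it at 0. *)
Definition search a (body : prog bool) : prog bool :=
  loop (ite (is0 a) (ret (Some false))
    (move1 a Left ;; ite body (clear a ;; ret (Some true)) (ret None))).

(** A round costs [T + 3], as in [does_down]; the further 4 per unit pay for clearing what is left
    of the counter after a hit. *)
Lemma does_search a body T n p o (f : nat -> bool) :
  2 <= a <= m ->
  (forall k, k < n -> does body (setp p a k) o T (f k) (setp p a k) o) ->
  does (search a body) (setp p a n) o (n * (T + 7) + 2) (has f (iota 0 n)) (setp p a 0) o.
Proof.
move=> ha; elim: n => [|n ih] hb.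
  rewrite mul0n; apply: does_loop_exit; rewrite -[0 + 2]/(1 + 1).
  apply: (does_bind (does_is0 ha)); rewrite {1}/setp eqxx /=; apply: does_ret.
have hss q k l : setp (setp q a k) a l =1 setp q a l by move=> j; rewrite /setp; case: eqP.
have hmv : does (move1 a Left) (setp p a n.+1) o 1 tt (setp p a n) o.
  apply: (does_ext (@does_decr a (setp p a n.+1) o _ _)) => //.
  - by case/andP: ha.
  - by rewrite /setp eqxx.
  by move=> j; rewrite /setp eqxx; case: eqP.
rewrite -addn1 iotaD has_cat add0n /= orbF.
case hf: (f n).
  rewrite orbT; apply: does_loop_exit.
  apply: (does_ext (T1 := 1 + (1 + (T + ((n * 4 + 2) + 1)))) _ (frefl _) (frefl _)); last by lia.
  apply: (does_bind (does_is0 ha)); rewrite {1}/setp eqxx addn1 /=.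
  apply: (does_bind (e := tt) hmv); apply: (does_bind (hb n _)); rewrite ?addn1 //.
  rewrite hf -[(_ + 2).+1]addn1; apply: (does_bind (e := tt) (p1 := setp p a 0) (o1 := o)); last exact: does_ret.
  by apply: (does_ext (@does_clear a (setp p a n) o ha)) => //; rewrite /setp eqxx.
rewrite orbF.
apply: (does_ext (T1 := (1 + (1 + (T + 1))) + (n * (T + 7) + 2)) _ (frefl _) (frefl _)); last by lia.
apply: does_loop_continue; last by apply: ih => k hk; apply: hb; lia.
apply: (does_bind (does_is0 ha)); rewrite {1}/setp eqxx addn1 /=.
apply: (does_bind (e := tt) hmv); apply: (does_bind (hb n _)); rewrite ?addn1 //.
by rewrite hf; apply: does_ret.
Qed.

End Words.
End Programs.

(** * Bounded first-order formulas as programs *)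


Inductive term := TVar of nat | TC of nat | TAdd of term & term
  | TSub of term & term | TMul of term & term.

Inductive fof := FZ of term | FBit of bool & term | FNot of fof
  | FAnd of fof & fof | FEx of term & fof.

Fixpoint evT (env : seq nat) (t : term) : nat :=
  match t with
  | TVar i => nth 0 env i
  | TC c => c
  | TAdd a b => evT env a + evT env b
  | TSub a b => evT env a - evT env b
  | TMul a b => evT env a * evT env b
  end.

(* Variables are de Bruijn levels: a quantifier appends to the environment.   *)
Fixpoint evF (x u : seq bool) (env : seq nat) (f : fof) : bool :=
  match f with
  | FZ t => evT env t == 0
  | FBit w t => nth false (if w then u else x) (evT env t)
  | FNot f => ~~ evF x u env f
  | FAnd f g => evF x u env f && evF x u env g
  | FEx t f => has (fun v => evF x u (rcons env v) f) (iota 0 (evT env t))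
  end.

Fixpoint vT (t : term) (S : nat) : nat :=
  match t with
  | TVar i => S
  | TC c => c
  | TAdd a b => vT a S + vT b S
  | TSub a b => vT a S
  | TMul a b => vT a S * vT b S
  end.

(** Step counts for variables of value at most [S]. A loop round costs its body plus 3, so copying a
    variable, with loop bodies of 2 and of 1 steps, costs 5 + 4 per unit. *)
Fixpoint tT (t : term) (S : nat) : nat :=
  match t with
  | TVar i => S * 9 + 5
  | TC c => c + 1
  | TAdd a b => tT a S + tT b S
  | TSub a b => tT a S + tT b S + vT b S * 5 + vT a S * 4 + 4
  | TMul a b => tT a S + vT a S * (tT b S + 3) + 2
  end.

Fixpoint tF (f : fof) (S : nat) : nat :=
  match f with
  | FZ t => tT t S + 4 * vT t S + 4
  | FBit w t => tT t S + vT t S * 9 + 12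
  | FNot f => tF f S + 1
  | FAnd f g => tF f S + tF g S + 1
  | FEx t f => tT t S + vT t S * (tF f (S + vT t S) + 7) + 2
  end.

Lemma evT_le env t S : all (leq^~ S) env -> evT env t <= vT t S.
Proof.
move=> h; elim: t => //= [i|a ha b hb|a ha b hb|a ha b hb]; try lia.
- have [hi|hi] := ltnP i (size env); last by rewrite nth_default.
  exact: (all_nthP 0 h).
- exact: leq_mul.
Qed.

Notation "P ;; Q" := (andthen P Q) (at level 60, right associativity).

(** The number of scratch registers to be provided; it determines how many tapes the machine
    gets. *)
Fixpoint dT (t : term) : nat :=
  match t with
  | TVar i => 1
  | TC c => 0
  | TAdd a b => dT a + dT b
  | TSub a b => dT a + dT b + 2
  | TMul a b => dT a + dT b + 1
  end.

Fixpoint dF (f : fof) : nat :=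
  match f with
  | FZ t => dT t + 1
  | FBit w t => dT t + 2
  | FNot f => dF f
  | FAnd f g => dF f + dF g
  | FEx t f => dT t + dF f + 1
  end.

Section Compile.
Variable m : nat.

Notation incr r := (move1 m r Right).
Notation decr r := (move1 m r Left).

(* Adds the value of t to register r, using the registers from d on, which    *)
(* are 0 before and after; e is the number of variables.                      *)
Fixpoint cT (e : nat) (t : term) (r d : nat) : prog m unit :=
  match t with
  | TVar i => if i < e then down (4 + i) (incr r ;; incr d) ;; down d (incr (4 + i))
              else ret m tt
  | TC c => iter c (fun P => incr r ;; P) (ret m tt)
  | TAdd a b => cT e a r d ;; cT e b r d
  | TSub a b => cT e a d d.+2 ;; cT e b d.+1 d.+2 ;;
      down d.+1 (ite (is0 m d) (ret m tt) (decr d)) ;; down d (incr r)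
  | TMul a b => cT e a d d.+1 ;; down d (cT e b r d.+1)
  end.

(** Variable [i] lives in register [4 + i]. The first free register [4 + e] first receives the bound
    of a quantifier and then, as counter of the search, is itself the register of the new variable.
    For [FBit] the head on the word advances one cell more than the index, because of the mark, and
    [d.+1] records the way back. *)
Fixpoint cF (e : nat) (f : fof) : prog m bool :=
  let d := 4 + e in
  match f with
  | FZ t => cT e t d d.+1 ;; bind (is0 m d) (fun z : bool => clear m d ;; ret m z)
  | FBit w t => let h := if w then 3 else 2 in
      cT e t d d.+1 ;; incr h ;; incr d.+1 ;; down d (incr h ;; incr d.+1) ;;
      bind (rd m h) (fun b : bool => down d.+1 (decr h) ;; ret m b)
  | FNot f => bind (cF e f) (fun b : bool => ret m (~~ b))
  | FAnd f g => bind (cF e f) (fun b : bool => if b then cF e g else ret m false)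
  | FEx t f => cT e t d d.+1 ;; search d (cF e.+1 f)
  end.

Variables x u : seq bool.
Notation does := (does x u).

Lemma does_seq E (P : prog m unit) (Q : prog m E) p o T1 p1 o1 T2 e' p2 o2 :
  does P p o T1 tt p1 o1 -> does Q p1 o1 T2 e' p2 o2 ->
  does (P ;; Q) p o (T1 + T2) e' p2 o2.
Proof. by move=> h1 h2; apply: does_bind h1 h2. Qed.

Lemma does_post E (P : prog m E) p o T1 T e p1' p' o' :
  does P p o T1 e p1' o' -> p1' =1 p' -> T1 <= T -> does P p o T e p' o'.
Proof. by move=> h; apply: does_ext h _. Qed.

Ltac setp_cases := rewrite /setp /=;
  repeat match goal with |- context [@eq_op ?T ?a ?b] =>
    case: (@eqP T a b) => ?; subst => // end; try lia.
Ltac setp_tac := let j := fresh "j" in move=> j; setp_cases.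

Lemma cT_ok t env S p o r d :
  all (leq^~ S) env ->
  (forall i, i < size env -> p (4 + i) = nth 0 env i) ->
  (forall j, d <= j -> p j = 0) ->
  4 + size env <= r < d -> d + dT t <= m.+1 ->
  does (cT (size env) t r d) p o (tT t S) tt (setp p r (p r + evT env t)) o.
Proof.
move=> hS; elim: t p o r d => [i|c|a iha b ihb|a iha b ihb|a iha b ihb] p o r d
  hp h0 hr /= hm.
- case: ltnP => hi; last first.
    rewrite nth_default // addn0.
    apply: (does_ext (@does_ret m x u _ tt p o)) => //; [|lia].
    by move=> j; rewrite /setp; case: eqP => // ->.
  set v := nth 0 env i; have hv : v <= S by apply: (all_nthP 0 hS).
  have hpv : p (4 + i) = v by apply: hp.
  (* Reading a register empties it: the first loop moves the value to both [r] and [d], the second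
     returns it from [d]. In [st] and [st2], [k] is what the running counter still holds. *)
  pose st k := setp (setp (setp p (4 + i) k) r (p r + (v - k))) d (v - k).
  pose st2 k := setp (setp (setp p (4 + i) (v - k)) r (p r + v)) d k.
  apply: (does_ext (T1 := (v * (2 + 3) + 2) + (v * (1 + 3) + 2)) (p1 := st v)
     (p1' := st2 0)); last by lia.
  + apply: (does_seq (p1 := st2 v) (o1 := o)).
      apply: (does_ext (@does_down m x u (4 + i) _ 2 v st (fun=> o) _ _ _)) => //.
      * by lia.
      * by move=> k _; rewrite /st /setp; case: eqP => [|_]; [lia|]; case: eqP; [lia|]; rewrite eqxx.
      * move=> k hk; apply: (does_post (T1 := 1 + 1)); [by apply: does_seq; apply: does_incr; lia| |by []].
        by rewrite /st; setp_tac.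
      * by rewrite /st /st2; setp_tac.
    apply: (@does_down m x u d _ 1 v st2 (fun=> o) _ _ _) => //.
    + by lia.
    + by move=> k _; rewrite /st2 /setp eqxx.
    + move=> k hk; apply: (does_post (T1 := 1)); [by apply: does_incr; lia| |by []].
      by rewrite /st2; setp_tac.
  + by rewrite /st; setp_tac; rewrite ?h0 //; lia.
  + by rewrite /st2; setp_tac; rewrite ?h0 //; lia.
- elim: c p {hp h0} => [|c ih] p /=.
    apply: (does_ext (@does_ret m x u _ tt p o)) => //.
    by setp_tac.
  have -> : c.+1 + 1 = 1 + (c + 1) by lia.
  apply: does_seq; first by apply: does_incr; lia.
  by apply: (does_ext (ih _)) => //; setp_tac.
- apply: does_seq; first by apply: iha => //; lia.
  apply: (does_ext (ihb (setp p r (p r + evT env a)) o r d _ _ _ _)) => //.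
  + by move=> i hi; rewrite -hp // /setp; case: eqP => //; lia.
  + by move=> j hj; rewrite -(h0 _ hj) /setp; case: eqP => //; lia.
  + lia.
  + by setp_tac.
- set va := evT env a; set vb := evT env b.
  have hva : va <= vT a S by apply: evT_le.
  have hvb : vb <= vT b S by apply: evT_le.
  have -> : tT a S + tT b S + vT b S * 5 + vT a S * 4 + 4 =
     tT a S + (tT b S + ((vT b S * 5 + 2) + (vT a S * 4 + 2))) by lia.
  (* Truncated subtraction: [d] starts with the minuend and stays at 0 once there, while [d.+1]
     counts the subtrahend down. *)
  pose st k := setp (setp p d (va - (vb - k))) d.+1 k.
  pose st2 k := setp (setp p d k) r (p r + ((va - vb) - k)).
  apply: (does_seq (p1 := setp p d va) (o1 := o)).
    apply: (does_ext (iha p o d d.+2 _ _ _ _)) => //; try lia.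
    + by move=> j hj; apply: h0; lia.
    + by setp_tac; rewrite ?h0 //; lia.
  apply: (does_seq (p1 := st vb) (o1 := o)).
    apply: (does_ext (ihb (setp p d va) o d.+1 d.+2 _ _ _ _)) => //; try lia.
    + by move=> i hi; rewrite -hp // /setp; case: eqP => //; lia.
    + by move=> j hj; rewrite /setp; case: eqP; [lia|]; rewrite h0 //; lia.
    + by rewrite /st; setp_tac; rewrite ?subnn ?subn0 //; rewrite h0 //; lia.
  apply: (does_seq (p1 := st2 (va - vb)) (o1 := o)).
    apply: (does_ext (@does_down m x u d.+1 _ 2 vb st (fun=> o) _ _ _)) => //.
    + by lia.
    + by move=> k _; rewrite /st /setp eqxx.
    + move=> k hk; rewrite -[2]/(1 + 1); apply: does_bind; first by apply: does_is0; lia.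
      have hst : setp (st k.+1) d.+1 k d = va - (vb - k.+1).
        by rewrite /st; setp_cases.
      rewrite hst; case: eqP => hk0.
        apply: (does_post (@does_ret m x u _ tt _ o)); [|by []].
        by rewrite /st; setp_tac.
      apply: (does_post (T1 := 1)); [apply: does_decr; first lia| |by []].
        by rewrite hst; lia.
      by rewrite /st; setp_tac.
    + by rewrite /st /st2; setp_tac; rewrite ?h0 //; lia.
    + by lia.
  apply: (does_ext (@does_down m x u d _ 1 (va - vb) st2 (fun=> o) _ _ _)) => //; try lia.
  + by move=> k _; rewrite /st2 /setp; case: eqP; [lia|rewrite eqxx].
  + move=> k hk; apply: (does_post (T1 := 1)); [by apply: does_incr; lia| |by []].
    by rewrite /st2; setp_tac.
  + by rewrite /st2; setp_tac; rewrite ?h0 //; lia.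
- set va := evT env a; set vb := evT env b.
  have hva : va <= vT a S by apply: evT_le.
  have -> : tT a S + vT a S * (tT b S + 3) + 2 = tT a S + (vT a S * (tT b S + 3) + 2) by lia.
  pose st k := setp (setp p d k) r (p r + (va - k) * vb).
  apply: (does_seq (p1 := st va) (o1 := o)).
    apply: (does_ext (iha p o d d.+1 _ _ _ _)) => //; try lia.
    + by move=> j hj; apply: h0; lia.
    + by rewrite /st; setp_tac; rewrite ?h0 // subnn mul0n; lia.
  apply: (does_ext (@does_down m x u d _ (tT b S) va st (fun=> o) _ _ _)) => //; try lia.
  + by move=> k _; rewrite /st /setp; case: eqP; [lia|rewrite eqxx].
  + move=> k hk; apply: (does_ext (ihb _ o r d.+1 _ _ _ _)); try lia; try exact: frefl.
    * by move=> i hi; rewrite -hp // /st; setp_cases.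
    * by move=> j hj; rewrite /st; setp_cases; apply: h0; lia.
    have e : (va - k) * vb = (va - k.+1) * vb + vb by rewrite -mulSnr; congr muln; lia.
    by rewrite /st e; setp_tac.
  + by rewrite /st; setp_tac; rewrite ?h0 // subn0.
  + by rewrite leq_add2r leq_mul2r hva orbT.
Qed.

Definition regs (env : seq nat) : nat -> nat :=
  fun j => if j < 4 then 0 else nth 0 env (j - 4).

Lemma regs0 env j : 4 + size env <= j -> regs env j = 0.
Proof. by move=> h; rewrite /regs; case: ltnP => // h'; rewrite nth_default //; lia. Qed.

Lemma cT_regs t env S o : all (leq^~ S) env -> 4 + size env + dT t <= m ->
  does (cT (size env) t (4 + size env) (4 + size env).+1) (regs env) o (tT t S) tt
    (setp (regs env) (4 + size env) (evT env t)) o.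
Proof.
move=> hS hm; apply: (does_ext (@cT_ok t env S (regs env) o _ _ _ _ _ _ _)) => //; try lia.
- by move=> i hi; rewrite /regs /=; congr nth; lia.
- by move=> j hj; apply: regs0; lia.
- by move=> j; rewrite /setp regs0.
Qed.

Lemma cF_ok f env S o : all (leq^~ S) env -> 4 + size env + dF f <= m.+1 ->
  does (cF (size env) f) (regs env) o (tF f S) (evF x u env f) (regs env) o.
Proof.
elim: f env S o => [t|w t|f ih|f ihf g ihg|t f ih] env S o hS hm /=.
- have hv := evT_le t hS; set d := 4 + size env.
  have -> : tT t S + 4 * vT t S + 4 = tT t S + (1 + ((vT t S * 4 + 2) + 1)) by lia.
  apply: does_seq; first by apply: cT_regs => //; rewrite /= in hm; lia.
  apply: does_bind; first by apply: does_is0; rewrite /= in hm; lia.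
  rewrite {1}/setp eqxx; apply: (does_seq (p1 := regs env) (o1 := o)); last exact: does_ret.
  apply: (does_ext (@does_clear m x u d (setp (regs env) d (evT env t)) o _)) => //.
  + by rewrite /= in hm; lia.
  + by setp_tac; rewrite regs0 //; lia.
  + by rewrite /setp eqxx; lia.
- have hv := evT_le t hS; rewrite /= in hm; set d := 4 + size env.
  set h := if w then 3 else 2; have hh : 2 <= h <= 3 by rewrite /h; case: (w).
  have -> : tT t S + vT t S * 9 + 12 =
     tT t S + (1 + (1 + ((vT t S * 5 + 2) + (1 + (((vT t S).+1 * 4 + 2) + 1))))) by lia.
  set v := evT env t.
  have r0 : regs env h = 0 by rewrite /regs; case: ltnP => //; lia.
  pose st k := setp (setp (setp (regs env) d k) h (v - k).+1) d.+1 (v - k).+1.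
  pose st2 k := setp (setp (regs env) h k) d.+1 k.
  apply: does_seq; first by apply: cT_regs => //; lia.
  apply: does_seq; first by apply: does_incr; lia.
  apply: (does_seq (p1 := st v) (o1 := o)).
    apply: (does_post (T1 := 1)); [by apply: does_incr; lia| |by []].
    by rewrite /st; setp_tac; rewrite ?subnn ?r0 ?regs0 //; lia.
  apply: (does_seq (p1 := st2 v.+1) (o1 := o)).
    apply: (does_ext (@does_down m x u d _ 2 v st (fun=> o) _ _ _)) => //; try lia.
    + by move=> k _; rewrite /st /setp; do 2 (case: eqP => [|_]; first by lia); rewrite eqxx.
    + move=> k hk; apply: (does_post (T1 := 1 + 1)); [by apply: does_seq; apply: does_incr; lia| |by []].
      by rewrite /st; setp_tac.
    + by rewrite /st /st2; setp_tac; rewrite ?regs0 //; lia.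
  apply: does_bind; first by apply: does_rd; lia.
  have -> : (0 < st2 v.+1 h) && nth false (word x u h) (st2 v.+1 h).-1 =
     nth false (if w then u else x) v.
    have -> : st2 v.+1 h = v.+1 by rewrite /st2 /setp; case: eqP => //; rewrite eqxx.
    by rewrite /= /word /h; case: (w).
  apply: (does_seq (p1 := regs env) (o1 := o)); last exact: does_ret.
  apply: (does_ext (@does_down m x u d.+1 _ 1 v.+1 st2 (fun=> o) _ _ _)) => //; try lia.
  + by move=> k _; rewrite /st2 /setp eqxx.
  + move=> k hk.
    apply: (does_post (T1 := 1)); [apply: does_decr; first lia| |by []].
      by rewrite /st2; setp_cases.
    by rewrite /st2; setp_tac.
  + by rewrite /st2; setp_tac; rewrite ?r0 ?regs0 //; lia.
- by apply: does_bind (ih _ _ _ hS hm) _; apply: does_ret.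
- have -> : tF f S + tF g S + 1 = tF f S + (tF g S + 1) by lia.
  rewrite /= in hm; apply: does_bind (ihf _ _ _ hS _) _; first by lia.
  case: evF => /=; last by apply: (does_ext (@does_ret m x u _ false _ o)) => //; lia.
  by apply: (does_ext (ihg _ _ _ hS _)) => //; lia.
have hv := evT_le t hS; rewrite /= in hm; set d := 4 + size env.
rewrite -addnA; apply: does_seq; first by apply: cT_regs => //; lia.
have h0 : setp (regs env) d 0 =1 regs env by setp_tac; rewrite regs0 //; lia.
apply: (does_ext (T1 := evT env t * (tF f (S + vT t S) + 7) + 2)); [|exact: frefl|exact: h0|]; last first.
  by rewrite leq_add2r leq_mul2r hv orbT.
apply: does_search => [|k hk]; first by lia.
have hr : regs (rcons env k) =1 setp (regs env) d k.
  move=> j; rewrite /regs /setp nth_rcons /d.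
  have [h4|h4] := ltnP j 4; first by case: eqP => //; lia.
  have [h5|h5] := ltnP (j - 4) (size env); first by case: eqP => //; lia.
  have -> : (j - 4 == size env) = (j == 4 + size env) by lia.
  by rewrite nth_default.
have := ih (rcons env k) (S + vT t S) o; rewrite size_rcons => {}ih.
apply: (does_ext (ih _ _)) => //; last by lia.
rewrite all_rcons; apply/andP; split; first by lia.
by apply: sub_all hS => y /=; lia.
Qed.

End Compile.

(** * Polynomial time *)


(** Since the base is at least 2, constants and sums are absorbed by a larger exponent and no
    coefficients have to be tracked. *)
Definition polyb (f : nat -> nat) := exists C, forall S, f S <= (S + 2) ^ C.

Lemma polyb_const c : polyb (fun=> c).
Proof.
exists c => S; apply: leq_trans (ltnW (ltn_expl c (ltnSn 1))) _.
by case: c => // c; rewrite leq_exp2r // leq_addl.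
Qed.

Lemma polyb_id : polyb id.
Proof. by exists 1 => S; rewrite expn1 leq_addr. Qed.

Lemma polyb_mul f g : polyb f -> polyb g -> polyb (fun S => f S * g S).
Proof. by move=> [a ha] [b hb]; exists (a + b) => S; rewrite expnD leq_mul. Qed.

Lemma polyb_add f g : polyb f -> polyb g -> polyb (fun S => f S + g S).
Proof.
move=> [a ha] [b hb]; exists (a + b + 1) => S; rewrite !expnD expn1.
have h n : 0 < (S + 2) ^ n by rewrite expn_gt0 addn2.
have := ha S; have := hb S; have := h a; have := h b; nia.
Qed.

Lemma polyb_comp f g : polyb f -> polyb g -> polyb (fun S => f (g S)).
Proof.
move=> [a ha] [b hb]; exists ((b + 1 + 1) * a) => S; apply: leq_trans (ha _) _.
have [->|a0] := posnP a; first by rewrite muln0.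
rewrite expnM leq_exp2r //.
have := hb S; rewrite !expnD expn1; have : 0 < (S + 2) ^ b by rewrite expn_gt0 addn2.
nia.
Qed.

Lemma polyb_vT t : polyb (vT t).
Proof.
elim: t => [i|c|a ha b hb|a ha b hb|a ha b hb] /=; last exact: polyb_mul.
- exact: polyb_id.
- exact: polyb_const.
- exact: polyb_add.
- exact: ha.
Qed.

Ltac polyb_tac := repeat first [ assumption | exact: polyb_vT | exact: polyb_id
  | exact: polyb_const | apply: polyb_add | apply: polyb_mul ].

Lemma polyb_tT t : polyb (tT t).
Proof. by elim: t => [i|c|a ha b hb|a ha b hb|a ha b hb] /=; polyb_tac. Qed.

Lemma polyb_tF f : polyb (tF f).
Proof.
elim: f => [t|w t|f h|f hf g hg|t f h] /=; have ht := polyb_tT; polyb_tac => //.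
by apply: (polyb_comp (g := fun S => S + vT t S)) => //; polyb_tac.
Qed.

Lemma polyb_poly f : polyb f -> exists p : {poly nat}, forall S, f S <= p.[S]%R.
Proof.
move=> [C hC]; exists (('X + 2%:R) ^+ C)%R => S; apply: leq_trans (hC S) _.
rewrite horner_exp hornerD hornerX.
by rewrite -[2%:R%R]polyC_natr hornerC.
Qed.

(** * Machines from programs, and the loading of the input *)

Section Machines.
Variable m : nat.
Notation I := 'I_m.+1.
Notation tps := {ffun I -> stape}.

Definition mach (P : prog m unit) : TM :=
  @MkTM m unit (option (pts P)) (Some (entry P)) (fun q => q == None)
    (fun q s => if q is Some q' then
        let a := stp q' s in
        (match a.1 with inl q'' => Some q'' | inr _ => None end, a.2)
      else (None, [ffun i => (s i, Stay)])).

Lemma step_mach (P : prog m unit) q (ts : tps) :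
  @step (mach P) (Some q, ts) =
  (match (pstep q ts).1 with inl q' => Some q' | inr _ => None end, (pstep q ts).2).
Proof. by []. Qed.

Lemma runs_mach (P : prog m unit) q (ts : tps) t ts' : runs (P := P) q ts t tt ts' ->
  iter t (@step (mach P)) (Some q, ts) = (None, ts').
Proof.
elim=> {q ts t ts'} [q ts e ts'|q ts q' ts1 n e ts'] h.
  by rewrite /= step_mach h.
by move=> _ ih; rewrite iterSr step_mach h.
Qed.

Lemma rbitsE (P : prog m unit) s : @read_bits (mach P) s = rbits s.
Proof. by elim: s => // -[[]|] //= b s ->. Qed.

Definition initt (x u : seq bool) : tps :=
  [ffun i : I => ([::], bits (nth [::] [:: x; u] i))].

(** The halted configuration persists, so a bound on the number of steps suffices. Inputs matter
    only through [nth [::]], so a one-word input is treated as a pair with an empty second word. *)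
Lemma does_outputs (P : prog m unit) x u ws T y :
  (forall i, nth [::] ws i = nth [::] [:: x; u] i) ->
  (exists t ts', [/\ t <= T, runs (entry P) (initt x u) t tt ts' & rbits (ts' ord0).2 = y]) ->
  outputs_within (mach P) ws T y.
Proof.
move=> hws [t [ts' [hT hr hy]]]; rewrite /outputs_within.
have -> : init (mach P) ws = (Some (entry P), initt x u).
  by congr pair; apply/ffunP=> i; rewrite !ffunE hws.
have hs k : iter k (@step (mach P)) (None, ts') = (None, ts').
  by elim: k => //= k ->.
by rewrite -(subnK hT) iterD (runs_mach hr) hs /output /= rbitsE.
Qed.

Definition isbit (s : sym) := if s is Some (inl _) then true else false.

Definition setup : prog m unit :=
  atom (fun s => (tt, [ffun i : I => if i < 2 then (s i, Stay) else
    (mark, if i < 4 then Right else Stay)])).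

(** Tapes 0 and 1 are erased while their bits go to tapes 2 and 3; this leaves tape 0 blank for the
    output. Tapes 4 and 5 advance in parallel and end as registers holding the two lengths, the
    initial environment. *)
Definition copy : prog m unit :=
  loop (atom (fun s : {ffun I -> sym} =>
   let bit k := isbit (s (inord k)) in
   (if bit 0 || bit 1 then None else Some tt,
    [ffun i : I => let k := nat_of_ord i in
      if k < 2 then (None, if bit k then Right else Stay) else
      if k < 4 then (if bit (k - 2) then (s (inord (k - 2)), Right) else (s i, Stay)) else
      (s i, if (k < 6) && bit (k - 4) then Right else Stay)]))).

Definition src (w : seq bool) (t : stape) :=
  all (pred1 None) t.1 /\ nth None t.2 =1 nth None (bits w).

Definition pos (x u : seq bool) (i : nat) :=
  nth 0 [:: 0; 0; (size x).+1; (size u).+1; size x; size u] i.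

(** [x1] and [u1] are already copied, [x2] and [u2] still have to be read. *)
Definition inv x1 x2 u1 u2 (ts : tps) :=
  [/\ src x2 (ts (inord 0)), src u2 (ts (inord 1)) &
   forall i : I, 2 <= i -> tape_at (word x1 u1 i) (pos x1 u1 i) (ts i)].

Lemma src_scn w t : src w t -> scn t = head None (bits w).
Proof. by case=> _ h; rewrite /scn -!nth0 h. Qed.

Lemma src_upd w t : src w t ->
  src (behead w) (upd t (None, if isbit (head None (bits w)) then Right else Stay)).
Proof.
case: w => [|b w] [h1 h2]; split=> //=.
- by case=> [|j] //=; rewrite nth_behead h2 nth_nil.
- by move=> j; rewrite nth_behead h2.
Qed.

Lemma tape_copy w1 w2 t : tape_at w1 (size w1).+1 t ->
  tape_at (w1 ++ take 1 w2) (size (w1 ++ take 1 w2)).+1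
    (upd t (if isbit (head None (bits w2)) then (head None (bits w2), Right)
            else (scn t, Stay))).
Proof.
case: w2 => [|b w2] /= h; first by rewrite cats0; apply: tape_at_stay.
by rewrite take0 cats1 size_rcons; apply: tape_at_write.
Qed.

Lemma tape_count w2 n t : tape_at [::] n t ->
  tape_at [::] (n + size (take 1 w2))
    (upd t (scn t, if isbit (head None (bits w2)) then Right else Stay)).
Proof.
case: w2 => [|b w2] /= h; first by rewrite addn0; apply: tape_at_stay.
by rewrite take0 addn1; apply: tape_at_right.
Qed.

Hypothesis m5 : 5 <= m.

Lemma runs_copy n x1 x2 u1 u2 ts : size x2 <= n -> size u2 <= n ->
  inv x1 x2 u1 u2 ts -> exists t ts',
  [/\ t <= n.+1, runs (entry copy) ts t tt ts' & inv (x1 ++ x2) [::] (u1 ++ u2) [::] ts'].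
Proof.
elim: n x1 x2 u1 u2 ts => [|n ih] x1 x2 u1 u2 ts hx hu hinv.
all: pose ts1 := (pstep (entry copy) ts).2.
all: have hin : inv (x1 ++ take 1 x2) (behead x2) (u1 ++ take 1 u2) (behead u2) ts1.
1,3: case: hinv => h0 h1 h2; have e0 := src_scn h0; have e1 := src_scn h1;
  (have k0 : (inord 0 : I) = 0 :> nat by rewrite inordK //; lia);
  (have k1 : (inord 1 : I) = 1 :> nat by rewrite inordK //; lia);
  split; [ | |move=> i hi]; rewrite /ts1 /pstep /= !ffunE ?k0 ?k1 /= ?ffunE ?e0 ?e1;
  [exact: src_upd|exact: src_upd|];
  have := h2 i hi; (have := ltn_ord i); rewrite /word /pos !size_cat;
  case: (nat_of_ord i) hi => [|[|[|[|[|[|j]]]]]] //= _ _;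
  rewrite ?ffunE ?subnn ?e0 ?e1 ?nth_nil; move=> h; 
  [have := @tape_copy x1 x2 _ h; rewrite size_cat; by case: ifP
  |have := @tape_copy u1 u2 _ h; rewrite size_cat; by case: ifP
  |exact: tape_count|exact: tape_count|exact: tape_at_stay].
all: have hex : (pstep (entry copy) ts).1 =
   if (x2 == [::]) && (u2 == [::]) then inr tt else inl tt.
1,3: case: hinv => h0 h1 h2; have e0 := src_scn h0; have e1 := src_scn h1;
  rewrite /pstep /= !ffunE e0 e1; by case: (x2) (u2) => [|? ?] [|? ?].
all: case: ifP hex => [/andP[/eqP ex /eqP eu]|hne] hex.
1,3: by subst x2 u2; exists 1, ts1; split=> //; apply: runs_exit;
  rewrite [LHS]surjective_pairing hex.
  by move: hne; case: (x2) (u2) hx hu => [|? ?] [|? ?].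
have [||t [ts' [h1 h2 h3]]] := ih _ _ _ _ _ _ _ hin; rewrite ?size_behead; try lia.
exists t.+1, ts'; split=> //.
  by apply: runs_step h2; rewrite [LHS]surjective_pairing hex.
have hc (w : seq bool) : take 1 w ++ behead w = w by case: w => //= a w; rewrite take0.
by move: h3; rewrite -!catA !hc.
Qed.

Lemma runs_prep x u : exists t ts', [/\ t <= size x + size u + 2,
  runs (entry (andthen setup copy)) (initt x u) t tt ts' & rep x u (pos x u) [::] ts'].
Proof.
pose ts1 := (pstep (entry setup) (initt x u)).2.
have [|||t [ts' [h1 h2 [h3 h4 h5]]]] := @runs_copy (size x + size u) [::] x [::] u ts1;
  rewrite ?leq_addr ?leq_addl //.
  have k0 : (inord 0 : I) = 0 :> nat by rewrite inordK //; lia.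
  have k1 : (inord 1 : I) = 1 :> nat by rewrite inordK //; lia.
  split; [| |move=> i hi]; rewrite /ts1 /pstep /= !ffunE ?k0 ?k1 /=.
  - by split=> //=; case: (x) => //= j; rewrite nth_nil; case: j => //= j; rewrite nth_nil.
  - by split=> //=; case: (u) => //= j; rewrite nth_nil; case: j => //= j; rewrite nth_nil.
  case: (nat_of_ord i) hi => [|[|[|[|k]]]] //= _; rewrite ?nth_nil /=.
  1,2: by split=> -[|j] //=; rewrite ?nth_nil // /cell ?subn0 //= nth_nil.
  have -> : pos [::] [::] k.+4 = 0 by rewrite /pos; case: k => [|[|k]] //=; rewrite nth_nil.
  by split=> -[|j] //=; rewrite ?nth_nil.
exists t.+1, ts'; split=> //; first by lia.
  rewrite -add1n; apply: runs_bind h2.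
  by apply: runs_exit; rewrite [LHS]surjective_pairing.
have e0 : inord 0 = ord0 :> I by apply: val_inj; rewrite /= inordK.
split=> //; case: h3; rewrite e0 // => _ /(_ 0).
by case: (ts' ord0).2 => //= a s; case: a.
Qed.

(** Copying leaves the heads on the words behind the last bit, whereas [regs] expects them on the
    mark. *)
Definition prep : prog m unit := andthen (andthen setup copy) (andthen (clear m 2) (clear m 3)).

Lemma runs_prep_then (P : prog m unit) x u T p o :
  does x u P (regs [:: size x; size u]) [::] T tt p o ->
  exists t ts', [/\ t <= (size x + size u) * 9 + 20 + T,
    runs (entry (andthen prep P)) (initt x u) t tt ts' & rbits (ts' ord0).2 = o].
Proof.
move=> hP; have [t [ts1 [h1 h2 h3]]] := runs_prep x u.
have hc : does x u (andthen (clear m 2) (clear m 3)) (pos x u) [::]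
   (((size x).+1 * 4 + 2) + ((size u).+1 * 4 + 2)) tt (regs [:: size x; size u]) [::].
  apply: does_bind; first by apply: does_clear; lia.
  apply: (does_ext (@does_clear m x u 3 (setp (pos x u) 2 0) [::] _)) => //; first by lia.
  by do 6 (case=> //).
have [t2 [ts2 [h4 h5 h6]]] := hc _ h3.
have [t3 [ts3 [h7 h8 [_ h9 _]]]] := hP _ h6.
exists (t + t2 + t3), ts3; split=> //; first by lia.
exact: (runs_bind (runs_bind h2 h5) h8).
Qed.

End Machines.

Theorem fo_verifier (f : fof) :
  polytime_verifier (fun x u => evF x u [:: size x; size u] f).
Proof.
pose m := 6 + dF f.
pose P : prog m unit := bind (cF m 2 f) (emit m).
have hb : polyb (fun S => S * 9 + 20 + (tF f S + 2)) by have hf := polyb_tF f; polyb_tac.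
have [p hp] := polyb_poly hb.
exists (mach (andthen (prep m) P)), p => x u.
apply: (does_outputs (x := x) (u := u)) => //.
have hP : does x u P (regs [:: size x; size u]) [::] (tF f (size x + size u) + 2) tt
   (regs [:: size x; size u]) [:: evF x u [:: size x; size u] f].
  apply: does_bind; last exact: does_emit.
  apply: (@cF_ok m x u f [:: size x; size u] (size x + size u)).
    by rewrite /= leq_addr leq_addl.
  by rewrite /m /=; lia.
have [|t [ts [h1 h2 h3]]] := runs_prep_then _ hP; first by rewrite /m; lia.
by exists t, ts; split=> //; apply: leq_trans h1 _; apply: leq_trans (hp _); lia.
Qed.

(** The counter over the output positions, register 6, is also the register of the third variable
    [p]. It runs downwards, which is the order in which the output stack wants the bits. *)
Theorem fo_function (f : fof) (L : term) :
  polytime_function (fun x => mkseq (fun p => evF x [::] [:: size x; 0; p] f)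
                                    (evT [:: size x; 0] L)).
Proof.
pose m := 7 + dT L + dF f.
pose P : prog m unit :=
  andthen (cT m 2 L 6 7) (down 6 (bind (cF m 3 f) (emit m))).
pose tB S := S * 9 + 20 + (tT L S + (vT L S * (tF f (S + vT L S) + 2 + 3) + 2)).
have hb : polyb tB.
  have hT := polyb_tT L; rewrite /tB; polyb_tac.
  by apply: (polyb_comp (f := tF f)); [exact: polyb_tF|polyb_tac].
have [p hp] := polyb_poly hb.
exists (mach (andthen (prep m) P)), p => x; set n := size x.
apply: (does_outputs (x := x) (u := [::])); first by case=> [|[|i]] //=; rewrite nth_nil.
cbv beta; rewrite -/n; pose l := evT [:: n; 0] L; pose g p := evF x [::] [:: n; 0; p] f.
rewrite -/l -/g.
have hS : all (leq^~ n) [:: n; 0] by rewrite /= leqnn.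
have hl : l <= vT L n by apply: evT_le.
pose st k := regs [:: n; 0; k].
have hP : does x [::] P (regs [:: n; 0]) [::]
    (tT L n + (vT L n * (tF f (n + vT L n) + 2 + 3) + 2)) tt (st 0) (mkseq g l).
  apply: (does_bind (e := tt) (p1 := st l) (o1 := drop l (mkseq g l))).
    rewrite drop_oversize ?size_mkseq //.
    apply: (does_ext (@cT_regs m x [::] L [:: n; 0] n [::] hS _)) => //.
      by rewrite /m /=; lia.
    by rewrite /st /setp /=; do 7 (case=> //); move=> j; rewrite /regs /= !nth_default.
  (* With the counter at [k], the stack holds the output from position [k] on. *)
  have := @does_down m x [::] 6 (bind (cF m 3 f) (emit m)) (tF f (n + vT L n) + 2) l st
    (fun k => drop k (mkseq g l)).
  rewrite drop0 => h; apply: (does_ext (h _ _ _)) => //.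
  - move=> k hk; apply: (does_bind (p1 := st k)).
      apply: (does_ext (@cF_ok m x [::] f [:: n; 0; k] (n + vT L n) (drop k.+1 (mkseq g l)) _ _)) => //.
      + by rewrite /= leq_addr /=; lia.
      + by rewrite /m /=; lia.
      + by rewrite /st /setp /=; do 7 (case=> //).
    have -> : drop k (mkseq g l) = g k :: drop k.+1 (mkseq g l).
      by rewrite (drop_nth false) ?size_mkseq // nth_mkseq.
    exact: does_emit.
  - by rewrite leq_add2r leq_mul2r hl orbT.
have [|t [ts [h1 h2 h3]]] := runs_prep_then _ hP; first by rewrite /m; lia.
exists t, ts; split=> //; apply: leq_trans h1 _; apply: leq_trans (hp _).
by rewrite /tB addn0.
Qed.

(** * Cliques, orderings and vertex Folkman graphs *)


Section Cliques.
Variable V : eqType.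

Definition cls (r : rel V) (s : seq V) :=
  uniq s && all (fun a => all (fun b => (a != b) ==> r a b) s) s.

Lemma clsP (r : rel V) s :
  reflect (uniq s /\ {in s &, forall a b, a != b -> r a b}) (cls r s).
Proof.
apply: (iffP andP) => -[h1 h2]; split=> //.
  by move=> a b ha hb; move/allP: h2 => /(_ a ha) /allP /(_ b hb) /implyP.
by apply/allP=> a ha; apply/allP=> b hb; apply/implyP; apply: h2.
Qed.

Definition bdd (r : rel V) K := forall s, cls r s -> size s <= K.

Lemma cls_sub (r : rel V) s s' : cls r s -> uniq s' -> {subset s' <= s} -> cls r s'.
Proof.
by move=> /clsP[h1 h2] hu hs; apply/clsP; split=> // a b /hs ha /hs hb; apply: h2.
Qed.

Lemma cls_cat (r : rel V) s1 s2 : symmetric r -> (forall a, r a a = false) ->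
  cls r s1 -> cls r s2 -> (forall a b, a \in s1 -> b \in s2 -> r a b) ->
  cls r (s1 ++ s2).
Proof.
move=> hs hi /clsP[u1 h1] /clsP[u2 h2] h; apply/clsP; split.
  rewrite cat_uniq u1 u2 andbT; apply/hasPn => a ha; apply/negP=> ha'.
  by have := h a a ha' ha; rewrite hi.
move=> a b; rewrite !mem_cat => /orP[ha|ha] /orP[hb|hb] hab.
- exact: h1.
- exact: h.
- by rewrite hs; apply: h.
- exact: h2.
Qed.

(* An ordering is given by an injective g; be is the backedge graph.          *)
Definition be (e : rel V) (g : V -> nat) : rel V :=
  fun a b => (g a < g b) && e b a || (g b < g a) && e a b.

Definition istour (e : rel V) :=
  (forall a, e a a = false) /\ (forall a b, a != b -> e a b = ~~ e b a).

Lemma be_sym e g : symmetric (be e g).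
Proof. by move=> a b; rewrite /be orbC. Qed.

Lemma be_irr e g a : be e g a a = false.
Proof. by rewrite /be ltnn. Qed.

Lemma be_lt e g a b : g a < g b -> be e g a b = e b a.
Proof. by move=> h; rewrite /be h ltnNge ltnW //= orbF. Qed.

End Cliques.

(** With an order given by a rank, restriction is composition, and orders on disjoint sums can be
    written down by arithmetic. [diclP] links this form to [diclique_number]. *)
Definition dicl (V : eqType) (e : rel V) K := exists g : V -> nat,
  injective g /\ bdd (be e g) K.

Lemma cls_map (V V' : eqType) (r : rel V) (r' : rel V') (f : V -> V') s :
  cls r s -> {in s &, injective f} ->
  {in s &, forall a b, a != b -> r a b -> r' (f a) (f b)} -> cls r' (map f s).
Proof.
move=> /clsP[hu hr] hf h; apply/clsP; split; first by rewrite map_inj_in_uniq.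
move=> _ _ /mapP[a ha ->] /mapP[b hb ->] hab.
have hab' : a != b by apply: contraNneq hab => ->.
by apply: h => //; apply: hr.
Qed.

Lemma dicl_pull (V V' : eqType) (e : rel V) (e' : rel V') (f : V' -> V) K :
  injective f -> (forall a b, e' a b = e (f a) (f b)) -> dicl e K -> dicl e' K.
Proof.
move=> hf he [g [hg hK]]; exists (g \o f); split; first exact: inj_comp.
move=> s hs; rewrite -(size_map f); apply: hK; apply: (cls_map hs) => [a b _ _|a b _ _ _].
  exact: hf.
by rewrite /be /= !he.
Qed.

Section Dicliques.
Variables (V : finType) (T : tournament V).

Lemma clique_cls (r : rel V) (C : {set V}) : clique r C = cls r (enum C).
Proof.
apply/forall_inP/clsP => [h|[_ h] a ha].
  split; first exact: enum_uniq.
  move=> a b; rewrite !mem_enum => ha hb hab.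
  by have := h a ha => /forall_inP /(_ b hb) /implyP /(_ hab).
by apply/forall_inP => b hb; apply/implyP => hab; apply: h; rewrite ?mem_enum.
Qed.

Lemma diclP K : reflect (dicl T K) (diclique_number T <= K).
Proof.
have minP (P : pred {set V * V}) F n : (\big[minn/n]_(r | P r) F r <= K) =
    (n <= K) || [exists r, P r && (F r <= K)].
  have -> : [exists r, P r && (F r <= K)] = has (fun r => P r && (F r <= K)) (index_enum _).
    apply/existsP/hasP => [[r hr]|[r _ hr]]; last by exists r.
    by exists r => //; apply: mem_index_enum.
  elim: (index_enum _) => [|r s ih]; first by rewrite big_nil orbF.
  rewrite big_cons /=; case: (P r); rewrite ?geq_min ih //=.
  by case: (n <= K) => //; rewrite orbT.
have cnP (r : rel V) : (clique_number r <= K) <-> bdd r K.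
  rewrite /clique_number; split.
    move=> /bigmax_leqP h s hs; have hu : uniq s by case/clsP: hs.
    rewrite -(card_uniqP hu) -cardsE; apply: h; rewrite clique_cls.
    apply: (cls_sub hs); first exact: enum_uniq.
    by move=> a; rewrite mem_enum inE.
  move=> h; apply/bigmax_leqP => C; rewrite clique_cls cardE; exact: h.
have toR (g : V -> nat) : injective g ->
    exists r, strict_total_order r /\ backedge T r =2 be T g.
  move=> hg; exists [set p | g p.1 < g p.2]; split; last first.
    by move=> a b; rewrite /backedge !inE.
  apply/and3P; split.
  - by apply/forallP=> a; rewrite inE ltnn.
  - apply/forallP=> a; apply/forallP=> b; apply/forallP=> c; rewrite !inE /=.
    by apply/implyP=> /andP[]; apply: ltn_trans.
  - apply/forallP=> a; apply/forallP=> b; apply/implyP=> hab; rewrite !inE /= -neq_ltn.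
    by apply: contra hab => /eqP /hg ->.
have cls_ext (r r' : rel V) s : r =2 r' -> cls r s = cls r' s.
  move=> h; rewrite /cls; congr andb; apply: eq_all => a; apply: eq_all => b.
  by rewrite h.
rewrite /diclique_number minP; apply: (iffP orP).
  (* The default value of the minimum is a case of its own: if [#|V| <= K], every order will do. *)
  case=> [hV|/existsP[r /andP[hr /cnP hK]]].
    exists (fun v => enum_rank v : nat); split.
      by move=> a b h; apply: enum_rank_inj; apply: val_inj.
    move=> s /clsP[hu _]; apply: leq_trans hV; rewrite -(card_uniqP hu).
    exact: max_card.
  have [/forallP hi /forallP ht /forallP hc] := and3P hr.
  have tr a b c : (a, b) \in r -> (b, c) \in r -> (a, c) \in r.
    by move=> h1 h2; have /forallP/(_ b)/forallP/(_ c)/implyP := ht a; apply; rewrite h1.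
  (* In a finite total order the number of predecessors is a rank. *)
  pose g v := #|[set u | (u, v) \in r]|.
  have hlt a b : (a, b) \in r -> g a < g b.
    move=> hab; apply: proper_card; apply/properP; split.
      by apply/subsetP=> c; rewrite !inE => hc'; apply: tr hab.
    by exists a; rewrite !inE // (negPf (hi a)).
  have tot a b : a != b -> ((a, b) \in r) || ((b, a) \in r).
    by move=> hab; have /forallP/(_ b)/implyP := hc a; apply.
  have hg : injective g.
    move=> a b hab; apply/eqP; apply: contraT => /tot /orP[] /hlt; rewrite hab ltnn //.
  exists g; split=> // s hs; apply: hK; rewrite (cls_ext _ (be T g)) // => a b.
  have hle c d : (c, d) \in r = (g c < g d).
    apply/idP/idP => [/hlt //|hcd].
    have /tot/orP[//|/hlt] : c != d by apply: contraTneq hcd => ->; rewrite ltnn.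
    by move=> hdc; have := ltn_trans hcd hdc; rewrite ltnn.
  by rewrite /backedge /be !hle.
move=> [g [/toR[r [hr hb]] hK]]; right; apply/existsP; exists r; rewrite hr /=.
by apply/cnP => s; rewrite (cls_ext _ _ _ hb); apply: hK.
Qed.

End Dicliques.

(** The minimum over all orders is computable, which permits the case distinction in [critical]
    without classical axioms. *)
Lemma dicl_dec (V : finType) (e : rel V) K : istour e -> dicl e K \/ ~ dicl e K.
Proof.
by case=> h1 h2; have [h|h] := diclP (Tournament h1 h2) K; [left|right].
Qed.

Section Folkman.
Variable a : nat.

Definition mono (V : finType) (adj : rel V) (c : V -> nat) i b :=
  exists s, [/\ cls adj s, size s = b & all (fun v => c v == i) s].

Definition folk r := exists (V : finType) (adj : rel V),
  [/\ symmetric adj, irreflexive adj, bdd adj a & forall c : V -> nat,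
    (exists2 i, i < r & mono adj c i a) \/ exists v, r <= c v].

(** An intermediate property for the induction on [r]: it is trivial for [b = 0] and becomes
    [folk r.+1] for [b = a]. *)
Definition folkb r b := exists (V : finType) (adj : rel V),
  [/\ symmetric adj, irreflexive adj, bdd adj a & forall c : V -> nat,
    [\/ exists2 i, i < r & mono adj c i a, mono adj c r b | exists v, r < c v]].

(** The new graph has a copy of [F] for every vertex of [H], and a copy of [H] for every function
    [S] from [H] to subsets of [F]; in the latter, [h] is joined to [S h] in the copy of [F] at [h],
    provided [S h] is a [b]-clique. If every copy of [F] contains a [b]-clique of colour [r], take
    the copy of [H] for such a choice: a vertex of colour [r] extends its [b]-clique, and without
    such a vertex [folk r] applies. *)
Lemma folkb_step r b : b < a -> folk r -> folkb r b -> folkb r b.+1.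
Proof.
move=> hb [H [aH [sH iH bH pH]]] [F [aF [sF iF bF pF]]].
pose N := (H * F + {ffun H -> {set F}} * H)%type.
pose lk (S : {ffun H -> {set F}}) h h' f :=
  [&& h == h', f \in S h & (#|S h| == b) && cls aF (enum (S h))].
pose adj (p q : N) := match p, q with
  | inl (h, f), inl (h', f') => (h == h') && aF f f'
  | inr (D, h), inr (D', h') => (D == D') && aH h h'
  | inr (D, h), inl (h', f) | inl (h', f), inr (D, h) => lk D h h' f
  end.
have sadj : symmetric adj.
  move=> [[h f]|[S h]] [[h' f']|[S' h']] /=; [by rewrite eq_sym sF| | |by rewrite eq_sym sH].
    exact: erefl.
  exact: erefl.
have iadj : irreflexive adj.
  by move=> [[h f]|[S h]] /=; [rewrite iF|rewrite iH]; rewrite andbF.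
exists N, adj; split=> //.
- move=> s hs; have /clsP[hu hr] := hs.
  (* A clique of vertices of one kind projects to a clique of [H] or of [F]. A mixed clique has a
     single vertex [(S, h)], and its other vertices come from the [b]-set [S h], where [b < a]. *)
  case/boolP: (has (fun p : N => if p is inl _ then true else false) s); last first.
    move=> /hasPn hl;
    pose h0 (p : N) : H := match p with inl q => q.1 | inr q => q.2 end.
    rewrite -(size_map h0); apply: bH; apply: (cls_map hs).
      move=> [[h f]|[S h]] [[h' f']|[S' h']] hp hq /=; try by [have := hl _ hp|have := hl _ hq].
      move=> e; apply/eqP; apply: contraT => hne; have := hr _ _ hp hq hne.
      by rewrite /= => /andP[/eqP eS _]; move: hne; rewrite eS e eqxx.
    move=> [[h f]|[S h]] [[h' f']|[S' h']] hp hq _ /=; try by [have := hl _ hp|have := hl _ hq].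
    by case/andP.
  case/hasP=> -[[h f]|//] hin _.
  case/boolP: (has (fun p : N => if p is inr _ then true else false) s); last first.
    move=> /hasPn hl; pose f0 (p : N) : F := if p is inl q then q.2 else f.
    have hh h' f' : inl (h', f') \in s -> h' = h.
      move=> hin'; case: (eqVneq (inl (h', f') : N) (inl (h, f))) => [[-> //]|hne].
      by have := hr _ _ hin' hin hne => /= /andP[/eqP].
    rewrite -(size_map f0); apply: bF; apply: (cls_map hs).
      move=> [[h1 f1]|[S h1]] [[h2 f2]|[S' h2]] hp hq /=; try by [have := hl _ hp|have := hl _ hq].
      by move=> ->; rewrite (hh _ _ hp) (hh _ _ hq).
    move=> [[h1 f1]|[S h1]] [[h2 f2]|[S' h2]] hp hq _ /=; try by [have := hl _ hp|have := hl _ hq].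
    by case/andP.
  case/hasP=> -[//|[S h']] hin' _.
  have hl h1 f1 : inl (h1, f1) \in s -> lk S h' h1 f1 by move=> h2; apply: (hr _ _ hin' h2).
  have := hl _ _ hin; rewrite /lk => /and3P[/eqP eh hfS /andP[/eqP hSb hScl]]; subst h'.
  apply: leq_trans hb; rewrite -hSb cardE -(size_map (fun f => inl (h, f) : N)).
  rewrite -[_.+1]/(size ((inr (S, h) : N) :: _)); apply: uniq_leq_size => // -[[h1 f1]|[S1 h1]] h2.
    have /and3P[/eqP <- hf1 _] := hl _ _ h2.
    by rewrite inE /=; apply/mapP; exists f1; rewrite ?mem_enum.
  have := hr _ _ h2 hin isT; rewrite /= /lk => /and3P[/eqP e1 _ _]; subst h1.
  case: (eqVneq (inr (S1, h) : N) (inr (S, h))) => [->|hne]; first by rewrite inE eqxx.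
  have := hr _ _ h2 hin' hne; rewrite /= => /andP[/eqP eS].
  by move: hne; rewrite eS eqxx.
move=> c; pose ok h (S : {set F}) :=
  [&& cls aF (enum S), #|S| == b & all (fun f => c (inl (h, f)) == r) (enum S)].
case/boolP: [forall h, [exists S, ok h S]] => [/forallP hall|]; last first.
  rewrite negb_forall => /existsP[h /existsPn hno].
  have emb i k : mono aF (fun f => c (inl (h, f))) i k -> mono adj c i k.
    move=> [s [h1 h2 h3]]; exists (map (fun f => inl (h, f)) s); split.
    - apply: (cls_map h1) => [f f' _ _ []//|f f' _ _ _ /= ->].
      by rewrite eqxx.
    - by rewrite size_map.
    - by rewrite all_map.
  case: (pF (fun f => c (inl (h, f)))) => [[i hi hm]|[s [h1 h2 h3]]|[v hv]].
  - by constructor 1; exists i => //; apply: emb.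
  - have hu : uniq s by case/clsP: h1.
    have hms : [set f in s] =i s by move=> f; rewrite inE.
    have := hno [set f in s]; rewrite /ok cardsE (card_uniqP hu) h2 eqxx /=.
    rewrite (cls_sub h1 (enum_uniq _)) /=; last by move=> f; rewrite mem_enum hms.
    case/negP; apply/allP=> f; rewrite mem_enum hms; exact: (allP h3).
  - by constructor 3; exists (inl (h, v)).
pose S := [ffun h => xchoose (existsP (hall h))].
have hS h : ok h (S h) by rewrite ffunE; apply: (xchooseP (existsP (hall h))).
case: (pH (fun h => c (inr (S, h)))) => [[i hi [s [h1 h2 h3]]]|[v hv]].
  constructor 1; exists i => //; exists (map (fun h => inr (S, h)) s); split.
  - apply: (cls_map h1) => [h h' _ _ []//|h h' _ _ _ /= ->].
    by rewrite eqxx.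
  - by rewrite size_map.
  - by rewrite all_map.
case: (ltngtP r (c (inr (S, v)))) hv => // [hv _|hv _].
  by constructor 3; exists (inr (S, v)).
have /and3P[o1 /eqP o2 o3] := hS v.
constructor 2; exists (inr (S, v) :: map (fun f => inl (v, f)) (enum (S v))); split.
- rewrite -cat1s; apply: cls_cat => //.
  + by rewrite /cls /= eqxx.
  + apply: (cls_map o1) => [f f' _ _ []//|f f' _ _ _ /= ->].
    by rewrite eqxx.
  + move=> p q; rewrite inE => /eqP -> /mapP[f hf ->] /=.
    by rewrite /lk eqxx o2 eqxx o1 -mem_enum hf.
- by rewrite /= size_map -cardE o2.
- by rewrite /= -hv eqxx all_map.
Qed.

Lemma folkman r : 0 < a -> folk r.
Proof.
move=> ha; elim: r => [|r ih].
  (* Without colours, the colour of any vertex is out of range. *)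
  exists unit, (fun _ _ => false); split=> //; last by move=> c; right; exists tt.
  move=> s /clsP[hu hs]; case: s hu hs => [|[] [|[] s]] //.
have hb b : b <= a -> folkb r b.
  elim: b => [_|b ihb hb]; last by apply: folkb_step => //; apply: ihb; apply: ltnW.
  exists void, (fun _ _ => false); split=> //; first by case=> [|[]].
  by move=> c; constructor 2; exists [::].
have [V [adj [h1 h2 h3 h4]]] := hb a (leqnn a); exists V, adj; split=> // c.
case: (h4 c) => [[i hi hm]|hm|hv]; [left|left|by right].
  by exists i => //; apply: ltnW.
by exists r.
Qed.

End Folkman.

(** * Chains of copies of a tournament *)


Section Chain.
Variables (U : finType) (eU : rel U) (K : nat).
Hypothesis tU : istour eU.
Hypothesis hU : forall g : U -> nat, injective g ->
  exists s, cls (be eU g) s && (K <= size s).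
Variables (Q : finType) (rk : Q -> nat) (m : nat) (eQ : rel Q).
Hypothesis rk_inj : injective rk.
Hypothesis rk_lt : forall z, rk z < m.
Hypothesis tQ : istour eQ.

(** A vertex [z] stands between the copies of [U] numbered [rk z] and [rk z + 1]. Arcs point
    forward, except that [eU] rules inside a copy and [eQ] inside [Q]. *)
Definition chain := (U * 'I_m.+1 + Q)%type.

Definition eX (p q : chain) : bool := match p, q with
  | inl (u, i), inl (v, j) => if i == j then eU u v else i < j
  | inl (u, i), inr z => i <= rk z
  | inr z, inl (u, i) => rk z < i
  | inr z, inr z' => eQ z z'
  end.

Lemma tour_chain : istour eX.
Proof.
case: tU => u1 u2; case: tQ => q1 q2; split=> [[[u i]|z]|[[u i]|z] [[v j]|z']] /=.
- by rewrite eqxx.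
- by [].
- rewrite [j == i]eq_sym; case: (eqVneq i j) => [<-|hij _].
    by move=> h; apply: u2; apply: contraNneq h => ->.
  by rewrite -leqNgt ltn_neqAle hij.
- by rewrite -leqNgt.
- by rewrite -ltnNge.
- by move=> h; apply: q2.
Qed.

Section Order.
Variable g : chain -> nat.
Hypothesis g_inj : injective g.
Hypothesis g_bdd : bdd (be eX g) K.

Let cop i (u : U) : chain := inl (u, i).

Lemma copy_clique i : exists s, cls (be eU (g \o cop i)) s && (K <= size s).
Proof. by apply: hU => u v /g_inj []. Qed.

Let Cs i := xchoose (copy_clique i).
Let cnt i t := count (fun u => g (cop i u) < t) (Cs i).

Lemma Cs_cls i : cls (be eU (g \o cop i)) (Cs i).
Proof. by case/andP: (xchooseP (copy_clique i)). Qed.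

Lemma Cs_size i : K <= size (Cs i).
Proof. by case/andP: (xchooseP (copy_clique i)). Qed.

Lemma cop_cls i (P : pred U) : cls (be eX g) (map (cop i) (filter P (Cs i))).
Proof.
apply: (@cls_map _ _ (be eU (g \o cop i))) => [|u v _ _ []//|u v _ _ _].
  apply: cls_sub (Cs_cls i) _ _; first by rewrite filter_uniq //; case/clsP: (Cs_cls i).
  by move=> u; rewrite mem_filter => /andP[].
by rewrite /be /= eqxx.
Qed.

(* An initial part of a late copy, a vertex x between, and a final part of an *)
(* early copy form a clique.                                                  *)
Lemma cnt_le (i j : 'I_m.+1) t : i < j -> cnt j t <= cnt i t.
Proof.
move=> hij.
have := g_bdd (s := map (cop j) [seq u <- Cs j | g (cop j u) < t] ++
                map (cop i) [seq u <- Cs i | ~~ (g (cop i u) < t)]).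
rewrite size_cat !size_map !size_filter => h.
have h2 : count (fun u => g (cop i u) < t) (Cs i) +
    count (fun u => ~~ (g (cop i u) < t)) (Cs i) = size (Cs i) := count_predC _ _.
have := Cs_size i; rewrite /cnt /= => h1.
suff {}/h : cls (be eX g) (map (cop j) [seq u <- Cs j | g (cop j u) < t] ++
                map (cop i) [seq u <- Cs i | ~~ (g (cop i u) < t)]).
  move=> {}h; rewrite -(leq_add2r (count (fun u => ~~ (g (cop i u) < t)) (Cs i))) h2.
  exact: leq_trans h h1.
apply: cls_cat; [exact: be_sym|exact: be_irr|exact: cop_cls|exact: cop_cls|].
move=> _ _ /mapP[u hu ->] /mapP[v hv ->].
move: hu hv; rewrite !mem_filter -leqNgt => /andP[h3 _] /andP[h4 _].
rewrite be_lt; last exact: leq_trans h4.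
rewrite /= hij; case: eqP => // e; by rewrite e ltnn in hij.
Qed.

(** Placed exactly at time [t], the vertex [z] enlarges the clique used for [cnt_le] by one, which
    makes the inequality strict. *)
Lemma cnt_lt (i j : 'I_m.+1) z : i <= rk z < j ->
  cnt j (g (inr z)) < cnt i (g (inr z)).
Proof.
move=> /andP[hi hj]; set t := g (inr z).
have := g_bdd (s := map (cop j) [seq u <- Cs j | g (cop j u) < t] ++ [:: inr z] ++
                map (cop i) [seq u <- Cs i | ~~ (g (cop i u) < t)]).
rewrite !size_cat !size_map !size_filter => h.
have h2 : count (fun u => g (cop i u) < t) (Cs i) +
    count (fun u => ~~ (g (cop i u) < t)) (Cs i) = size (Cs i) := count_predC _ _.
have := Cs_size i; rewrite /cnt /= => h1.
suff {}/h : cls (be eX g) (map (cop j) [seq u <- Cs j | g (cop j u) < t] ++ [:: inr z] ++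
                map (cop i) [seq u <- Cs i | ~~ (g (cop i u) < t)]).
  move=> {}h; rewrite -(leq_add2r (count (fun u => ~~ (g (cop i u) < t)) (Cs i))) h2.
  by apply: leq_trans h1; rewrite addSnnS.
have ht u k : g (cop k u) <> t by move/g_inj.
apply: cls_cat; [exact: be_sym|exact: be_irr|exact: cop_cls| |].
  apply: cls_cat; [exact: be_sym|exact: be_irr|by rewrite /cls /= eqxx|exact: cop_cls|].
  move=> _ _ /[1!inE] /eqP -> /mapP[v hv ->].
  move: hv; rewrite mem_filter -leqNgt => /andP[h4 _].
  by rewrite be_lt //= -/t; have := ht v i; lia.
move=> _ p /mapP[u hu ->]; move: hu; rewrite mem_filter => /andP[h3 _].
rewrite mem_cat inE => /orP[/eqP ->|/mapP[v hv ->]]; first by rewrite be_lt.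
move: hv; rewrite mem_filter -leqNgt => /andP[h4 _].
rewrite be_lt; last exact: leq_trans h4.
by rewrite /=; case: eqP => [e|_]; [move: hi hj; rewrite e; lia|lia].
Qed.

(** The colour is [cnt] of the copy just before [z] at time [g z]; it is at most [K] because the
    counted clique is. If [rk z < rk z'] but [z'] were not later than [z], then [cnt_le] from the
    copy after [z] to the copy before [z'], monotonicity in time, and [cnt_lt] across [z] would give
    [c z' < c z]. *)
Lemma chain_colour : exists c : Q -> nat, (forall z, c z < K.+1) /\
  (forall z z', rk z < rk z' -> c z = c z' -> g (inr z) < g (inr z')).
Proof.
pose lo z : 'I_m.+1 := inord (rk z); pose hi z : 'I_m.+1 := inord (rk z).+1.
have loE z : lo z = rk z :> nat by rewrite inordK // ltnS ltnW.
have hiE z : hi z = (rk z).+1 :> nat by rewrite inordK // ltnS.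
exists (fun z => cnt (lo z) (g (inr z))); split=> [z|z z' hz hc].
  rewrite ltnS; apply: leq_trans (count_size _ _) _.
  have := cop_cls (lo z) predT; rewrite filter_predT => /g_bdd.
  by rewrite size_map.
rewrite ltnNge; apply/negP => hle.
have hm i : cnt i (g (inr z')) <= cnt i (g (inr z)).
  by apply: sub_count => u /= h; apply: leq_trans h hle.
have h1 : cnt (hi z) (g (inr z)) < cnt (lo z) (g (inr z)).
  by apply: cnt_lt; rewrite loE hiE leqnn ltnSn.
have h2 : cnt (lo z') (g (inr z')) <= cnt (hi z) (g (inr z')).
  case: (ltngtP (hi z) (lo z')) => [||e]; [exact: cnt_le| |by rewrite (val_inj e)].
  by rewrite loE hiE; lia.
by have := hm (hi z); lia.
Qed.

End Order.
End Chain.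

(** * Frames *)


(** Cliques range over the finitely many subsets of [V], so the negated bound yields a witness
    constructively. *)
Lemma dicl_large (V : finType) (e : rel V) K (g : V -> nat) :
  ~ dicl e K -> injective g -> exists s, cls (be e g) s && (K < size s).
Proof.
move=> hn hg.
case/boolP: [exists C : {set V}, cls (be e g) (enum C) && (K < #|C|)].
  by case/existsP=> C; rewrite cardE; exists (enum C).
move/existsPn => h; case: hn; exists g; split=> // s hs.
have hu : uniq s by case/clsP: hs.
have hm a : a \in enum [set x in s] -> a \in s by rewrite mem_enum inE.
have := h [set x in s]; rewrite cardsE (card_uniqP hu).
by rewrite (cls_sub hs (enum_uniq _) hm) /= -leqNgt.
Qed.

Section Backward.
Variables (Q : eqType) (rk : Q -> nat) (adj : rel Q).
Hypothesis rk_inj : injective rk.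
Hypothesis adj_sym : symmetric adj.

(** The tournament whose backedge graph for the order [rk] is [adj]. *)
Definition bk (z z' : Q) := (z != z') && (if rk z < rk z' then ~~ adj z z' else adj z z').

Lemma tour_bk : istour bk.
Proof.
split=> [a|a b hab]; rewrite /bk ?eqxx // hab eq_sym hab /= adj_sym.
by case: ltngtP => // [_|/rk_inj e]; [rewrite negbK|rewrite e eqxx in hab].
Qed.

Lemma bk_cls (X : eqType) (e : rel X) (g : X -> nat) (f : Q -> X) s :
  injective f -> (forall z z', e (f z) (f z') = bk z z') -> cls adj s ->
  {in s &, forall z z', rk z < rk z' -> g (f z) < g (f z')} ->
  cls (be e g) (map f s).
Proof.
move=> hf he hs hg; apply: (cls_map hs) => [z z' _ _ /hf //|].
have hlt z z' : z \in s -> z' \in s -> rk z < rk z' -> adj z z' -> be e g (f z) (f z').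
  move=> h1 h2 h3 h4; rewrite be_lt; last exact: hg.
  rewrite he /bk ltnNge (ltnW h3) /= adj_sym h4 andbT.
  by apply: contraTneq h3 => ->; rewrite ltnn.
move=> z z' h1 h2 hne h; case: (ltngtP (rk z) (rk z')) => [h3|h3|/rk_inj e3].
- exact: hlt.
- by rewrite be_sym; apply: hlt => //; rewrite adj_sym.
- by rewrite e3 eqxx in hne.
Qed.

End Backward.

(** Given [U] for [K], a chain over a Folkman graph serves for [K + 1]: an order with cliques of at
    most [K + 1] vertices would give [K + 2] colours, hence a naturally ordered [(K + 2)]-clique of
    the graph, which is a clique of backward arcs. *)
Lemma unbounded K : exists (U : finType) (e : rel U), istour e /\ ~ dicl e K.
Proof.
elim: K => [|K [U [e [tU hU]]]].
  exists unit, (fun _ _ => false); split; first by split=> // -[] [].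
  by case=> g [_ /(_ [:: tt])]; rewrite /cls /= => /(_ isT).
have [F [adj [sF iF bF pF]]] := folkman K.+2 (ltn0Sn K.+1).
pose rk (z : F) : nat := enum_rank z.
have rk_inj : injective rk by move=> a b /val_inj /enum_rank_inj.
have rk_lt z : rk z < #|F| by apply: ltn_ord.
have tQ := tour_bk rk_inj sF.
exists (chain U F #|F|), (eX e rk (bk rk adj)); split; first exact: tour_chain.
move=> [g [hg hb]].
have hU' (g' : U -> nat) : injective g' -> exists s, cls (be e g') s && (K.+1 <= size s).
  by move=> hg'; apply: dicl_large.
have [c [hc1 hc2]] := chain_colour hU' rk_lt hg hb.
case: (pF c) => [[i hi [s [h1 h2 /allP h3]]]|[v]]; last by rewrite leqNgt hc1.
suff /hb : cls (be (eX e rk (bk rk adj)) g) (map inr s) by rewrite size_map h2 ltnn.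
apply: (bk_cls rk_inj sF _ _ h1) => [z z' []//|//|z z' /h3/eqP e1 /h3/eqP e2 hz].
by apply: hc2; rewrite // e1 e2.
Qed.

(** Vertices are deleted while the clique number stays above [k]. At the end any vertex serves as
    [w], and [g] extends a good order of the rest. *)
Lemma critical k : exists (U : finType) (e : rel U) (w : U) (g : U -> nat),
  [/\ istour e, ~ dicl e k, injective g &
      forall s, cls (be e g) s -> w \notin s -> size s <= k].
Proof.
have [U [e [tU hU]]] := unbounded k.
move: {-1}#|U| (leqnn #|U|) => n; elim: n U e tU hU => [|n ih] U e tU hU hn.
  have h0 (a : U) : False by have := card0_eq (eqP (etrans (esym (leqn0 _)) hn)) a; rewrite inE.
  case: hU; exists (fun=> 0); split=> [a|[|a s]] //; by case: (h0 a).
case/boolP: [exists w : U, true] => [/existsP[w _]|/existsPn h0]; last first.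
  by case: hU; exists (fun=> 0); split=> [a|[|a s]] //; have := h0 a.
pose U' := {x : U | x != w}; pose e' : rel U' := fun a b => e (val a) (val b).
have tU' : istour e'.
  by case: tU => h1 h2; split=> [a|a b hab]; [apply: h1|apply: h2].
case: (dicl_dec k tU') => [[g' [hg' hb]]|hU']; last first.
  by apply: (ih _ _ tU' hU'); rewrite card_sig cardC1; lia.
(* [w] is put first, at 0. *)
pose g v := if insub v is Some v' then (g' (v' : U')).+1 else 0.
have gE (v : U') : g (val v) = (g' v).+1 by rewrite /g valK.
exists U, e, w, g; split=> //.
  move=> a b; rewrite /g; case: insubP => [a' _ <-|ha]; case: insubP => [b' _ <-|hb'] //.
    by case=> /hg' ->.
  by move=> _; move: ha hb'; rewrite !negbK => /eqP -> /eqP ->.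
move=> s hs hw; have /clsP[hu hr] := hs.
have -> : size s = size (pmap insub s : seq U').
  rewrite size_pmap_sub; apply/esym/eqP; rewrite -all_count; apply/allP=> a ha /=.
  by apply: contraNneq hw => <-.
apply: hb; apply/clsP; split; first exact: pmap_sub_uniq.
move=> a b; rewrite !mem_pmap_sub => ha hb' hab.
by have := hr _ _ ha hb' hab; rewrite /be !gE !ltnS.
Qed.

(** The order [g0] has cliques of at most [k + 1] vertices, and inside S1 and inside its complement
    at most [k], leaving room for one vertex of Y. The last condition is the rigidity of all orders
    with bound [k + 1]. *)
Definition frame k := exists (X : finType) (e : rel X) (S1 : pred X) (g0 : X -> nat),
  [/\ istour e, injective g0 /\ bdd (be e g0) k.+1,
   (forall s, cls (be e g0) s -> all S1 s -> size s <= k),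
   (forall s, cls (be e g0) s -> all (predC S1) s -> size s <= k) &
   forall g, injective g -> bdd (be e g) k.+1 -> exists A B,
     [/\ cls (be e g) A, cls (be e g) B, size A = k, size B = k &
       [/\ all S1 A, all (predC S1) B & forall a b, a \in A -> b \in B -> g a < g b]]].

(** The chain carries [2 * q] consecutive blocks, each a copy of a Folkman graph; the first half of
    the blocks belongs to S1. Every block contains a monochromatic [k]-clique, hence a naturally
    ordered one. *)
Lemma frame_exists k : 2 <= k -> frame k.
Proof.
move=> hk; have [U [eU [w [gU [tU hU hgU hw]]]]] := critical k.
have [|F [adj [sF iF bF pF]]] := @folkman k k.+2; first by lia.
(* There are [k + 2] colours, so among [k + 3] blocks two have cliques of the same colour; this is
   wanted in either half. *)
pose q := k.+3; pose n := #|F|; pose Q := ('I_(q + q) * F)%type.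
pose rk (z : Q) : nat := z.1 * n + enum_rank z.2; pose m := (q + q) * n.
have rk_lex (z z' : Q) : z.1 < z'.1 -> rk z < rk z'.
  move=> h; have := ltn_ord (enum_rank z.2); rewrite /rk -/n.
  have : z.1.+1 * n <= z'.1 * n by rewrite leq_mul2r h orbT.
  rewrite mulSn; lia.
have rk_inj : injective rk.
  move=> z z' h; have e1 : z.1 = z'.1.
    by apply: val_inj; case: (ltngtP z.1 z'.1) => // /rk_lex; rewrite h ltnn.
  move: h; rewrite /rk e1 => /addnI /val_inj /enum_rank_inj.
  by case: z z' e1 => [? ?] [? ?] /= -> ->.
have rk_lt z : rk z < m.
  have := ltn_ord (enum_rank z.2); have : z.1.+1 * n <= m by rewrite leq_mul2r ltn_ord orbT.
  by rewrite /rk -/n mulSn; lia.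
pose adjQ (z z' : Q) := (z.1 == z'.1) && adj z.2 z'.2.
have sQ : symmetric adjQ by move=> z z'; rewrite /adjQ eq_sym sF.
pose eQ := bk rk adjQ; have tQ : istour eQ := tour_bk rk_inj sQ.
pose X := chain U Q m; pose e : rel X := eX eU rk eQ.
have tX : istour e by apply: tour_chain.
(* A copy of [U] may contain a clique of [k + 1] vertices. With only [w] in S1, the part outside S1
   has cliques of at most [k] vertices by criticality, and the part in S1 is a single vertex. *)
pose S1 (p : X) := match p with inl (u, i) => u == w | inr z => z.1 < q end.
pose B := (\max_u gU u).+1.
have hB u : gU u < B by rewrite ltnS leq_bigmax.
pose blk (p : X) : nat := match p with inl (u, i) => i.*2 | inr z => (rk z).*2.+1 end.
pose off (p : X) : nat := match p with inl (u, i) => gU u | inr z => 0 end.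
pose g0 p := blk p * B + off p.
have hoff p : off p < B by case: p => [[u i]|z] /=.
have g0_lex p p' : blk p < blk p' -> g0 p < g0 p'.
  move=> h; have := hoff p; rewrite /g0.
  have : (blk p).+1 * B <= blk p' * B by rewrite leq_mul2r h orbT.
  rewrite mulSn; lia.
have g0_blk p p' : g0 p = g0 p' -> blk p = blk p'.
  by move=> h; case: (ltngtP (blk p) (blk p')) => // /g0_lex; rewrite h ltnn.
have g0_inj : injective g0.
  move=> p p' h; have hb := g0_blk _ _ h; move: h; rewrite /g0 hb => /addnI.
  case: p p' hb => [[u i]|z] [[v j]|z'] /= hb; try lia.
    by move/hgU ->; rewrite (val_inj (double_inj hb)).
  by move=> _; rewrite (rk_inj _ _ (double_inj (succn_inj hb))).
have be_fwd p p' : blk p < blk p' -> e p p' -> be e g0 p p' = false.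
  move=> h h'; rewrite be_lt; last exact: g0_lex.
  case: tX => _ /(_ p' p) ->; first by rewrite h'.
  by apply: contraTneq h => ->; rewrite ltnn.
have be_cop u i v j : be e g0 (inl (u, i)) (inl (v, j)) -> i = j /\ be eU gU u v.
  case: (eqVneq i j) => [<-|hij].
    by rewrite /be /g0 /= eqxx !ltn_add2l.
  case: (ltngtP i j) => [h|h|/val_inj e1]; last by rewrite e1 eqxx in hij.
    by rewrite be_fwd //= ?ltn_double // (negPf hij).
  by rewrite be_sym be_fwd //= ?ltn_double // eq_sym (negPf hij).
have be_mix u i z : be e g0 (inl (u, i)) (inr z) = false.
  case: (leqP i (rk z)) => h; first by rewrite be_fwd //= ltnS leq_double.
  by rewrite be_sym be_fwd //=; lia.
have be_q z z' : be e g0 (inr z) (inr z') -> adjQ z z'.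
  have h1 y y' : rk y < rk y' -> be e g0 (inr y) (inr y') -> adjQ y y'.
    move=> h; rewrite be_lt; last by apply: g0_lex; rewrite /= ltnS ltn_double.
    by rewrite /e /= /eQ /bk ltnNge (ltnW h) /= sQ => /andP[].
  case: (ltngtP (rk z) (rk z')) => h; [exact: h1|by rewrite be_sym sQ; apply: h1|].
  by rewrite (rk_inj _ _ h) be_irr.
(* All arcs that are backward for [g0] lie inside one copy of [U] or one block, and the blocks have
   cliques of at most [k] vertices. *)
have cases s : cls (be e g0) s ->
    (exists i s', s = map (fun u => inl (u, i)) s' /\ cls (be eU gU) s') \/ size s <= k.
  move=> hs; have /clsP[hu hr] := hs.
  case: s hs hu hr => [|p s] hs hu hr; first by right.
  case: p hs hu hr => [[u i]|z] hs hu hr.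
    left; exists i; pose pr (p : X) := if p is inl (v, _) then v else u.
    have hin p : p \in inl (u, i) :: s -> p = inl (pr p, i).
      move=> hp; case: (eqVneq (inl (u, i)) p) => [<- //|hne].
      have := hr _ _ (mem_head _ _) hp hne.
      by case: p {hp hne} => [[v j] /be_cop [<-]|z]; rewrite ?be_mix.
    exists (map pr (inl (u, i) :: s)); split.
      rewrite -map_comp; apply/esym/map_id_in => p hp /=; by rewrite -(hin p hp).
    apply: (cls_map hs) => [p p' /hin h1 /hin h2 h|p p' /hin h1 /hin h2 _].
      by rewrite h1 h2 h.
    by rewrite h1 h2 => /be_cop[].
  right; pose pr (p : X) := if p is inr y then y.2 else z.2.
  have hin p : p \in inr z :: s -> p = inr (z.1, pr p).
    move=> hp; case: (eqVneq (inr z) p) => [<- /=|hne]; first by case: (z).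
    have := hr _ _ (mem_head _ _) hp hne.
    case: p {hp hne} => [[v j]|y]; first by rewrite be_sym be_mix.
    by move/be_q => /andP[/eqP -> _]; case: (y).
  rewrite -(size_map pr); apply: bF; apply: (cls_map hs) => [p p' /hin h1 /hin h2 h|].
    by rewrite h1 h2 h.
  by move=> p p' /hin h1 /hin h2 _; rewrite h1 h2 => /be_q /andP[].
exists X, e, S1, g0; split=> //.
- split=> // s /cases[[i [s' [-> hs']]]|]; last exact: leqW.
  rewrite size_map; case/boolP: (w \in s') => hws; last by apply: leqW; apply: hw.
  have hu : uniq s' by case/clsP: hs'.
  have -> : size s' = (size (rem w s')).+1 by rewrite size_rem //; case: (s') hws.
  rewrite ltnS; apply: hw; last by rewrite mem_rem_uniqF.
  by apply: (cls_sub hs'); [exact: rem_uniq|exact: mem_rem].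
- move=> s /cases[[i [s' [-> hs']]]|//]; rewrite all_map size_map => /allP hall.
  have hu : uniq s' by case/clsP: hs'.
  apply: (@leq_trans 1); last by lia.
  by apply: (@uniq_leq_size _ _ [:: w]) => // a /hall /= /eqP ->; rewrite inE.
- move=> s /cases[[i [s' [-> hs']]]|//]; rewrite all_map size_map => /allP hall.
  by apply: hw => //; apply/negP => /hall /=; rewrite eqxx.
move=> g hg hb.
have hU' (g' : U -> nat) : injective g' -> exists s, cls (be eU g') s && (k.+1 <= size s).
  by move=> hg'; apply: dicl_large.
have [c [hc1 hc2]] := chain_colour hU' rk_lt hg hb.
pose ok (b : 'I_(q + q)) (i : 'I_k.+2) (S : {set F}) :=
  [&& cls adj (enum S), #|S| == k & all (fun v => c (b, v) == i) (enum S)].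
have hok b : exists i, exists S, ok b i S.
  case: (pF (fun v => c (b, v))) => [[i hi [s [h1 h2 /allP h3]]]|[v]]; last by rewrite leqNgt hc1.
  have hu : uniq s by case/clsP: h1.
  have hm v : v \in enum [set v in s] -> v \in s by rewrite mem_enum inE.
  exists (Ordinal hi), [set v in s]; rewrite /ok cardsE (card_uniqP hu) h2 eqxx /=.
  rewrite (cls_sub h1 (enum_uniq _) hm) /=; by apply/allP=> v /hm /h3.
have hokb b : exists i, [exists S, ok b i S].
  by have [i [S h]] := hok b; exists i; apply/existsP; exists S.
pose col b := xchoose (hokb b).
have pig (f : 'I_q -> 'I_(q + q)) : exists i j : 'I_q, i < j /\ col (f i) = col (f j).
  have : ~~ injectiveb (fun i => col (f i)).
    by apply/negP => /injectiveP /leq_card; rewrite !card_ord /q; lia.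
  case/injectivePn => i [j hij hcol].
  case: (ltngtP i j) => [h|h|/val_inj h]; last by rewrite h eqxx in hij.
    by exists i, j.
  by exists j, i.
have hS b : exists S, ok b (col b) S by apply/existsP; apply: (xchooseP (hokb b)).
pose St b := xchoose (hS b).
pose A b := map (fun v => inr (b, v) : X) (enum (St b)).
have hA b : [/\ cls (be e g) (A b), size (A b) = k & forall v, v \in St b -> c (b, v) = col b].
  have /and3P[h1 /eqP h2 /allP h3] := xchooseP (hS b).
  have h3' v : v \in St b -> c (b, v) = col b by move=> hv; apply/eqP/h3; rewrite mem_enum.
  split=> //; last by rewrite size_map -cardE.
  have -> : A b = map inr (map (fun v => (b, v) : Q) (enum (St b))) by rewrite -map_comp.
  apply: (bk_cls rk_inj sQ _ _ _) => [z z' []//|//||].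
    apply: (cls_map h1) => [v v' _ _ []//|v v' _ _ _ h].
    by rewrite /adjQ eqxx.
  move=> _ _ /mapP[v hv ->] /mapP[v' hv' ->] h; apply: hc2 => //.
  by rewrite mem_enum in hv; rewrite mem_enum in hv'; rewrite !h3'.
have lt_blk (b b' : 'I_(q + q)) (a a' : X) : b < b' -> col b = col b' -> a \in A b -> a' \in A b' -> g a < g a'.
  move=> hbb hcol /mapP[v hv ->] /mapP[v' hv' ->]; apply: hc2; first exact: rk_lex.
  have [_ _ h1] := hA b; have [_ _ h2] := hA b'; rewrite mem_enum in hv; rewrite mem_enum in hv'.
  by rewrite h1 // h2 // hcol.
(* Two blocks of equal colour in each half turn a single comparison into one for whole cliques: from
   one [a] of [b2] before one [a'] of [b3] it follows that all of [b1] precedes [a], and [a']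
   precedes all of [b4]. *)
have [i1 [i2 [h12 c12]]] := pig (@lshift q q).
have [i3 [i4 [h34 c34]]] := pig (@rshift q q).
set b1 := lshift q i1 in c12; set b2 := lshift q i2 in c12.
set b3 := rshift q i3 in c34; set b4 := rshift q i4 in c34.
have [cA1 sA1 _] := hA b1; have [cA2 sA2 _] := hA b2.
have [cA3 sA3 _] := hA b3; have [cA4 sA4 _] := hA b4.
have [a [a' [ha ha' hlt]]] : exists a a', [/\ a \in A b2, a' \in A b3 & g a < g a'].
  case/boolP: (has (fun a => has (fun a' => g a < g a') (A b3)) (A b2)).
    by case/hasP=> a ha /hasP[a' ha' h]; exists a, a'.
  move/hasPn => hno.
  (* All of A b3 before all of A b2 would be a clique with 2k > k + 1 elements. *)
  have : cls (be e g) (A b3 ++ A b2).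
    apply: cls_cat => //; [exact: be_sym|exact: be_irr|] => a' a ha' ha.
    have := hno a ha => /hasPn /(_ a' ha'); rewrite -leqNgt leq_eqVlt.
    case/orP=> [/eqP/hg e1|h].
      by move: ha ha'; rewrite e1 => /mapP[v _ ->] /mapP[v' _ []] e2 _; have := ltn_ord i2; lia.
    rewrite be_lt //; case/mapP: ha => v _ ->; case/mapP: ha' => v' _ ->.
    have hbb : b2 < b3 by rewrite /=; have := ltn_ord i2; lia.
    rewrite /e /= /eQ /bk rk_lex //= /adjQ /=.
    have /negPf hne : b2 != b3 by apply: contraTneq hbb => ->; rewrite ltnn.
    by rewrite hne andbT; apply/eqP => -[] e2 _; have := ltn_ord i2; lia.
  by move/hb; rewrite size_cat sA2 sA3; clear -hk; lia.
exists (A b1), (A b4); split; [exact: cA1|exact: cA4|exact: sA1|exact: sA4|split].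
- by apply/allP=> _ /mapP[v _ ->] /=; apply: ltn_ord.
- by apply/allP=> _ /mapP[v _ ->] /=; rewrite -leqNgt leq_addr.
move=> p p' hp hp'.
have h1 : g p < g a by apply: lt_blk c12 hp ha.
have h2 : g a' < g p' by apply: lt_blk c34 ha' hp'; rewrite /= ltn_add2l.
exact: ltn_trans (ltn_trans h1 hlt) h2.
Qed.

(** * Splitting into two transitive parts *)


(** One rank [h] orders both classes; only its restriction to each class matters. *)
Definition splits (Y : eqType) (e : rel Y) := exists (col : Y -> bool) (h : Y -> nat),
  injective h /\ forall y y', col y = col y' -> h y < h y' -> e y y'.

Definition glue (X Y : eqType) (eX : rel X) (S1 : pred X) (eY : rel Y) : rel (X + Y) :=
  fun p q => match p, q with
  | inl a, inl b => eX a b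
  | inl a, inr _ => ~~ S1 a
  | inr _, inl b => S1 b
  | inr y, inr y' => eY y y'
  end.

Lemma tour_glue (X Y : eqType) (eX : rel X) S1 (eY : rel Y) :
  istour eX -> istour eY -> istour (glue eX S1 eY).
Proof.
move=> [x1 x2] [y1 y2]; split=> [[a|y]|[a|y] [b|y']] //=.
- by move=> h; apply: x2.
- by rewrite negbK.
- by move=> h; apply: y2.
Qed.

(** A backward pair of Y with both ends after [A], or both before [B], would complete that
    [k]-clique to [k + 2] vertices. Conversely, a splitting is turned into an order by putting the
    frame between the two classes. *)
Lemma glue_exists k : 2 <= k -> exists (X : finType) (eX : rel X) (S1 : pred X),
  istour eX /\ forall (Y : finType) (eY : rel Y), istour eY ->
  dicl (glue eX S1 eY) k.+1 <-> splits eY.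
Proof.
move=> hk; have [X [eX [S1 [g0 [tX [g0i g0b] b1 b2 hf]]]]] := frame_exists hk.
exists X, eX, S1; split=> // Y eY tY; split.
  move=> [g [gi gb]].
  have [||A [B [cA cB sA sB [aA aB hAB]]]] := hf (g \o inl).
  - by move=> a b /gi [].
  - move=> s hs; rewrite -(size_map (inl : X -> X + Y)); apply: gb.
    by apply: (cls_map hs) => [a b _ _ []|].
  have big (C : seq X) y y' : cls (be eX (g \o inl)) C -> size C = k -> y != y' ->
     be eY (g \o inr) y y' ->
     (forall a, a \in C -> be (glue eX S1 eY) g (inl a) (inr y)) ->
     (forall a, a \in C -> be (glue eX S1 eY) g (inl a) (inr y')) -> False.
    move=> cC sC hne hyy h1 h2.
    have : cls (be (glue eX S1 eY) g) (map inl C ++ [:: inr y; inr y']).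
      apply: cls_cat; [exact: be_sym|exact: be_irr| | |].
      + by apply: (cls_map cC) => [a b _ _ []|].
      + apply/clsP; split; first by rewrite /= inE (inj_eq (@inr_inj _ _)) hne.
        move=> p q; rewrite !inE => /orP[] /eqP -> /orP[] /eqP ->; rewrite ?eqxx // => _.
        by rewrite be_sym.
      + by move=> _ q /mapP[a ha ->]; rewrite !inE => /orP[] /eqP ->; [apply: h1|apply: h2].
    by move/gb; rewrite size_cat size_map sC /=; lia.
  (* A vertex that is not after all of [A] precedes some element of [A], hence all of [B]. *)
  exists (fun y => all (fun a => g (inl a) < g (inr y)) A), (g \o inr).
  split=> [y y' /gi []//|y y' hc hlt].
  apply: contraT => hne.
  have hyy : y != y' by apply: contraTneq hlt => ->; rewrite ltnn.
  have hb : be eY (g \o inr) y y'.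
    by rewrite be_lt //; case: tY => _ ->; rewrite // eq_sym.
  case: (boolP (all _ A)) hc => [h1 /esym h2|h1 /esym/negbT h2].
    case: (big A y y') => // a ha.
      by rewrite be_lt ?(allP h1) //=; apply: (allP aA).
    by rewrite be_lt ?(allP h2) //=; apply: (allP aA).
  have hB y0 a : ~~ all (fun a => g (inl a) < g (inr y0)) A -> a \in B ->
      be (glue eX S1 eY) g (inl a) (inr y0).
    case/allPn => a0 ha0; rewrite -leqNgt leq_eqVlt => /orP[/eqP/gi //|h] ha.
    rewrite be_sym be_lt /=; first exact: (allP aB).
    exact: ltn_trans h (hAB _ _ ha0 ha).
  by case: (big B y y') => // a ha; apply: hB.
move=> [col [h [hi hc]]].
pose H := (\max_y h y).+1; pose G := (\max_x g0 x).+1.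
have hH y : h y < H by rewrite ltnS leq_bigmax.
have hG x : g0 x < G by rewrite ltnS leq_bigmax.
(* Class [false], then the frame, then class [true]. A vertex of Y is then adjacent to exactly S1 in
   the backedge graph if its class is [true], and to exactly the complement otherwise. *)
pose g (p : X + Y) := match p with inl x => H + g0 x
  | inr y => if col y then H + G + h y else h y end.
exists g; split.
  move=> [x|y] [x'|y'] /=.
  - by move/addnI/g0i ->.
  - by case: (col y'); have := hH y'; have := hG x; lia.
  - by case: (col y); have := hH y; have := hG x'; lia.
  - by have := hH y; have := hH y'; case: (col y); case: (col y') => h1 h2 h3;
      congr inr; apply: hi; lia.
have ncl y y' : col y = col y' -> be (glue eX S1 eY) g (inr y) (inr y') = false.
  move=> hcc; have lt y1 y2 : col y1 = col y2 -> g (inr y1) < g (inr y2) -> h y1 < h y2.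
    by rewrite /g => ->; case: (col y2); lia.
  have nb y1 y2 : col y1 = col y2 -> g (inr y1) < g (inr y2) -> ~~ eY y2 y1.
    move=> h1 h2; have h3 := lt _ _ h1 h2.
    case: tY => _ <-; first exact: hc.
    by apply: contraTneq h3 => ->; rewrite ltnn.
  by apply/negbTE/negP; rewrite /be => /orP[] /andP[h1 /=]; apply/negP; apply: nb.
have bx y x : be (glue eX S1 eY) g (inr y) (inl x) -> S1 x = col y.
  case hy: (col y); last first.
    rewrite be_lt /= ?hy; first by move/negbTE.
    by have := hH y; have := hG x; lia.
  rewrite be_sym be_lt //= hy; by have := hG x; lia.
move=> s hs; have /clsP[hu hr] := hs.
pose sx := pmap (fun p : X + Y => if p is inl x then Some x else None) s.
pose sy := pmap (fun p : X + Y => if p is inr y then Some y else None) s.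
have ssum : size s = size sx + size sy.
  by rewrite /sx /sy; elim: (s) => //= -[x|y] s' /= ->; rewrite ?addnS.
have mx x : (x \in sx) = (inl x \in s).
  by rewrite /sx; elim: (s) => //= -[x'|y] s' /=; rewrite !inE => ->.
have my y : (y \in sy) = (inr y \in s).
  by rewrite /sy; elim: (s) => //= -[x'|y'] s' /=; rewrite !inE => ->.
have ux : uniq sx by apply: (@pmap_uniq _ _ _ inl) hu; case.
have uy : uniq sy by apply: (@pmap_uniq _ _ _ inr) hu; case.
have cx : cls (be eX g0) sx.
  apply/clsP; split=> // a b; rewrite !mx => ha hb hab.
  by have := hr _ _ ha hb hab; rewrite /be /g /= !ltn_add2l.
have hyc y y' : y \in sy -> y' \in sy -> y != y' -> col y != col y'.
  rewrite !my => h1 h2 h3; apply/eqP => h4.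
  by have := hr _ _ h1 h2 h3; rewrite ncl.
have sy2 : size sy <= 2.
  rewrite -(size_map col); apply: (@uniq_leq_size _ _ [:: true; false]); last by move=> [].
  rewrite map_inj_in_uniq // => y y' h1 h2 h3; apply/eqP; apply: contraT => h4.
  by have := hyc _ _ h1 h2 h4; rewrite h3 eqxx.
have hsy y : y \in sy -> all (fun x => S1 x == col y) sx.
  rewrite my => hy; apply/allP => x; rewrite mx => hx; apply/eqP.
  exact: bx (hr _ _ hy hx isT).
(* Without a vertex of Y the bound is that of [g0]. One vertex of Y confines the rest to one side of
   the frame, with at most [k] elements. Two come from different classes and leave no common
   neighbour in the frame. *)
case esy: sy hsy hyc sy2 => [|y [|y' l]] hsy hyc sy2.
- by rewrite ssum esy addn0; apply: g0b.
- rewrite ssum esy addn1 ltnS; have := hsy y (mem_head _ _).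
  case: (col y) => hall.
    by apply: b1 => //; apply: sub_all hall => x /eqP ->.
  by apply: b2 => //; apply: sub_all hall => x /= /eqP ->.
have y12 : y != y' by have := uy; rewrite esy /= inE negb_or => /andP[/andP[]].
have c12 : col y != col y' by apply: hyc => //; rewrite !inE eqxx ?orbT.
have h1 := hsy y (mem_head _ _); have h2 : all (fun x => S1 x == col y') sx.
  by apply: hsy; rewrite !inE eqxx orbT.
case esx : (sx) h1 h2 => [|x l'] /=; last first.
  by move=> /andP[/eqP -> _] /andP[/eqP hh _]; rewrite hh eqxx in c12.
by move=> _ _; rewrite ssum esx esy; move: sy2; rewrite /=; lia.
Qed.

(** * Tournaments made of six-vertex blocks *)

Section Blocks.
Variables (trip : nat -> bool) (link : rel nat).

(** The backward arcs. Places 0, 1, 2 of a block carry values, and [trip] makes them a cyclic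
    triangle; places 3, 4, 5 are always one. That triangle stands after the values of its block and
    before all later blocks, so a [link] to a later block is a backward arc over it. *)
Definition BE (i j : nat) : bool :=
  if i %/ 6 == j %/ 6 then
    (i %% 6 == 3) && (j %% 6 == 5) || trip (i %/ 6) && (i %% 6 == 0) && (j %% 6 == 2)
  else (i %% 6 < 3) && (j %% 6 < 3) && link i j.

Definition blockT (i j : nat) : bool := (i < j) && ~~ BE i j || (j < i) && BE j i.

Lemma tour_blockT n : istour (fun i j : 'I_n => blockT i j).
Proof.
split=> [a|a b hab]; rewrite /blockT ?ltnn //.
case: (ltngtP a b) => /= [h|h|/val_inj e]; rewrite ?orbF ?negbK //.
by rewrite e eqxx in hab.
Qed.

Lemma blockT_in b s s' : s < 6 -> s' < 6 -> blockT (6 * b + s) (6 * b + s') =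
  (s < s') && ~~ ((s == 3) && (s' == 5) || trip b && (s == 0) && (s' == 2)) ||
  (s' < s) && ((s' == 3) && (s == 5) || trip b && (s' == 0) && (s == 2)).
Proof.
move=> h h'; rewrite /blockT /BE !ltn_add2l.
have e r : r < 6 -> (6 * b + r) %/ 6 = b /\ (6 * b + r) %% 6 = r by lia.
by have [-> ->] := e _ h; have [-> ->] := e _ h'; rewrite eqxx.
Qed.

Definition colours n (c : nat -> bool) :=
  (forall i j, i < j < n -> i %/ 6 != j %/ 6 -> i %% 6 < 3 -> j %% 6 < 3 ->
     link i j -> c i != c j) /\
  (forall b, 6 * b < n -> trip b ->
     ~~ [&& c (6 * b) == c (6 * b + 1) & c (6 * b) == c (6 * b + 2)]).

(** A class of a splitting contains no cyclic triangle, which yields the constraints. Conversely,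
    the natural order with a few exchanges orders both classes. *)
Lemma splits_blockT N :
  splits (fun i j : 'I_(6 * N) => blockT i j) <-> exists c, colours (6 * N) c.
Proof.
set n := 6 * N; split.
  move=> [col [h [hi hc]]].
  pose c i := if insub i is Some i' then col (i' : 'I_n) else false.
  exists c.
  have cyc i j k : i < n -> j < n -> k < n -> c i = c j -> c j = c k ->
      blockT i j -> blockT j k -> blockT k i -> False.
    move=> hin hjn hkn; rewrite /c !insubT /=.
    set a := Sub i hin; set b := Sub j hjn; set d := Sub k hkn => h1 h2 e1 e2 e3.
    have lt (p q : 'I_n) : col p = col q -> blockT p q -> h p < h q.
      move=> hab eab; rewrite ltnNge leq_eqVlt; apply/negP => /orP[/eqP/hi e|h'].
        by move: eab; rewrite e /blockT ltnn.
      have := hc _ _ (esym hab) h'; case: (tour_blockT n) => _ /(_ q p) ->.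
        by rewrite eab.
      by apply: contraTneq h' => ->; rewrite ltnn.
    have := lt a b h1 e1; have := lt b d h2 e2.
    by have := lt d a (esym (etrans h1 h2)) e3; lia.
  have z3 b : 6 * b < n -> ~~ [&& c (6 * b + 3) == c (6 * b + 4) & c (6 * b + 4) == c (6 * b + 5)].
    move=> hb; apply/negP => /andP[/eqP h1 /eqP h2].
    by apply: (cyc _ _ _ _ _ _ h1 h2); rewrite ?blockT_in //= ?andbF // /n in hb *; lia.
  split.
    move=> i j /andP[hij hjn] hne him hjm hl; apply/eqP => hcc.
    pose b := i %/ 6.
    (* The triangle 3, 4, 5 meets both parts, so one of its vertices has the colour of [i] and
       closes a cyclic triangle with [i] and [j]. *)
    have [z [hz hz2 hcz]] : exists z, [/\ 6 * b + 3 <= z <= 6 * b + 5, z < n & c z = c i].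
      have hb : 6 * b + 5 < n by rewrite /b /n in hjn *; lia.
      have := z3 b; rewrite (_ : 6 * b < n = true); last by lia.
      move=> /(_ isT).
      case: (eqVneq (c (6 * b + 3)) (c i)) => [e|h3]; first by exists (6 * b + 3); split=> //; lia.
      case: (eqVneq (c (6 * b + 4)) (c i)) => [e|h4]; first by exists (6 * b + 4); split=> //; lia.
      case: (eqVneq (c (6 * b + 5)) (c i)) => [e|h5]; first by exists (6 * b + 5); split=> //; lia.
      by move: h3 h4 h5; case: (c i); do 3 case: (c (_ + _)).
    have bij : BE i j by rewrite /BE (negPf hne) him hjm hl.
    apply: (cyc i z j) => //; try by rewrite ?hcz //; lia.
    + rewrite /blockT /BE; rewrite /b in hz.
      have -> : i < z by lia.
      have -> : (i %/ 6 == z %/ 6) = true by lia.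
      have -> : (i %% 6 == 3) = false by lia.
      have -> : (z %% 6 == 2) = false by lia.
      by rewrite andbF.
    + rewrite /blockT /BE; rewrite /b in hz.
      have -> : z < j by lia.
      have -> : (z %/ 6 == j %/ 6) = false by lia.
      by have -> : (z %% 6 < 3) = false by lia.
    + by rewrite /blockT hij bij orbT.
  move=> b hb ht; apply/negP => /andP[/eqP h1 /eqP h2].
  rewrite -{1}[6 * b]addn0 in h1; rewrite -{1}[6 * b]addn0 in h2.
  apply: (cyc (6 * b + 0) (6 * b + 1) (6 * b + 2)); rewrite ?blockT_in //= ?ht // -?h1 -?h2 //;
    by rewrite /n in hb *; lia.
move=> [c [hl ht]].
(* If the ends 0 and 2 of a backward arc share a part, they are exchanged in the order; place 1 is
   then in the other part and does not interfere. The arc between places 3 and 5 is dealt with by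
   putting only 5 into part [true]. *)
pose sw b := trip b && (c (6 * b) == c (6 * b + 2)).
pose col i := if i %% 6 < 3 then c i else i %% 6 == 5.
pose ps (b s : nat) := if sw b then (if s == 0 then 2 else if s == 2 then 0 else s) else s.
pose h i := 6 * (i %/ 6) + ps (i %/ 6) (i %% 6).
have psl b s : s < 6 -> ps b s < 6 by rewrite /ps; case: (sw _) => //; do 2 case: ifP => //.
have hdiv i : h i %/ 6 = i %/ 6.
  by rewrite /h; have := psl (i %/ 6) (i %% 6); rewrite ltn_mod => /(_ isT); lia.
exists (fun i => col (val i)), (fun i => h (val i)); split.
  move=> i j hij; apply: val_inj => /=; have e : i %/ 6 = j %/ 6 by rewrite -hdiv hij hdiv.
  move: hij; rewrite /h e => /addnI; rewrite /ps.
  suff : i %% 6 = j %% 6 -> val i = val j.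
    by move=> hh; case: (sw _); do ?[case: eqP => ?]; move=> h'; apply: hh; lia.
  by rewrite /=; lia.
move=> [i hin] [j hjn] /= hcol hlt.
have key : i != j -> (i < j -> ~~ BE i j) -> (j < i -> BE j i) -> blockT i j.
  by rewrite /blockT; case: ltngtP => //= _ _ h1 h2; rewrite ?orbF; [apply: h1|apply: h2].
apply: key; first by apply: contraTneq hlt => ->; rewrite ltnn.
  move=> hij; rewrite /BE; case: eqP => hb.
    apply/negP => /orP[/andP[/eqP h3 /eqP h5]|/andP[/andP[h0 /eqP h1] /eqP h2]].
      by move: hcol; rewrite /col h3 h5.
    have e0 : i = 6 * (i %/ 6) by lia.
    have e2 : j = 6 * (i %/ 6) + 2 by lia.
    have hsw : sw (i %/ 6) by rewrite /sw h0 -e2 -e0; move: hcol; rewrite /col h1 h2 /= => ->.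
    by move: hlt; rewrite /h -hb /ps hsw h1 h2 /=; lia.
  apply/negP => /andP[/andP[h1 h2] h3].
  have := hl i j; rewrite hij hjn => /(_ isT); move: hcol; rewrite /col h1 h2 => ->.
  by rewrite eqxx => /(_ _ isT isT h3) hh; have := hh (introN eqP hb).
move=> hji; have hb : i %/ 6 = j %/ 6.
  by have := hdiv i; have := hdiv j; lia.
have : sw (j %/ 6) by apply: contraLR hlt => hn; rewrite /h hb /ps (negPf hn); lia.
move=> hsw; move: hlt; rewrite /h hb /ps hsw /BE hb eqxx.
have /andP[ht' /eqP hc02] := hsw; rewrite ht'.
have := ht (j %/ 6); rewrite ht' hc02 eqxx andbT => /(_ _ isT).
rewrite (_ : 6 * (j %/ 6) < n = true); last by lia.
move=> /(_ isT) hc1.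
case: (eqVneq (i %% 6) 0) => i0; case: (eqVneq (j %% 6) 0) => j0;
 case: (eqVneq (i %% 6) 2) => i2; case: (eqVneq (j %% 6) 2) => j2 //=; try lia.
- move=> hlt; have e1 : i %% 6 = 1 by lia.
  have ej : j = 6 * (j %/ 6) by lia. have ei : i = 6 * (j %/ 6) + 1 by lia.
  by case/eqP: hc1; rewrite -hc02 -ei -ej; move: hcol; rewrite /col e1 j0.
- move=> hlt; have e1 : j %% 6 = 1 by lia.
  have ei : i = 6 * (j %/ 6) + 2 by lia. have ej : j = 6 * (j %/ 6) + 1 by lia.
  by case/eqP: hc1; rewrite -ei -ej; move: hcol; rewrite /col e1 i2.
Qed.

End Blocks.

(** * Local clauses on a grid *)


(* A literal (dt, do, f, sg) of a clause anchored at cell (t, o) says that    *)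
(* fact f has truth value sg at cell (t + dt, o + do).                        *)
Definition lit := (nat * nat * nat * bool)%type.
Definition ldt (l : lit) := l.1.1.1.
Definition ldo (l : lit) := l.1.1.2.
Definition lf (l : lit) := l.1.2.
Definition lsg (l : lit) := l.2.
Definition rule := (lit * lit * lit)%type.
Definition rule0 : rule := let l := (0, 0, 0, true) in (l, l, l).
Definition l0 (r : rule) := r.1.1.
Definition l1 (r : rule) := r.1.2.
Definition l2 (r : rule) := r.2.

Section Grid.
Variables (nf : nat) (rules : seq rule) (H W : nat).
Variable frc : bool -> nat -> nat -> nat -> bool.

Notation nr := (size rules).
Notation NB := (2 * nf + 2 * nr).
Notation R r := (nth rule0 rules r).

Definition okf (r : rule) := [&& lf (l0 r) < nf, lf (l1 r) < nf & lf (l2 r) < nf].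
Hypothesis rules_ok : all okf rules.

Definition inr_ t o (l : lit) := (t + ldt l < H) && (o + ldo l < W).
Definition holds (A : nat -> nat -> nat -> bool) t o (l : lit) :=
  A (t + ldt l) (o + ldo l) (lf l) == lsg l.

Definition sat (A : nat -> nat -> nat -> bool) :=
  (forall t o r, t < H -> o < W -> r \in rules ->
     inr_ t o (l0 r) -> inr_ t o (l1 r) -> inr_ t o (l2 r) ->
     [|| holds A t o (l0 r), holds A t o (l1 r) | holds A t o (l2 r)]) /\
  (forall sg t o f, t < H -> o < W -> f < nf -> frc sg t o f -> A t o f = sg).

(** Block 0 is reserved: its first vertex is the reference for true. A cell has [nf] blocks for
    facts, [nf] for their negations, and two for each rule. *)
Definition blk t o b := 1 + ((t * W + o) * NB + b).
Definition vtx t o b s := 6 * blk t o b + s.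

Definition ln (i j t o b s b' s' dt do : nat) :=
  [&& i == vtx t o b s, t + dt < H, o + do < W & j == vtx (t + dt) (o + do) b' s'].
Definition lnl i j t o b s (l : lit) :=
  ln i j t o b s (if lsg l then nf + lf l else lf l) 0 (ldt l) (ldo l).

(** A link means different values. A clause with literals [a], [b], [d] becomes the not-all-equal
    triples [(a, b, z)] and [(~ z, d, false)]: if all three literals fail, the first forces [z] and
    the second breaks. A literal is copied by a link to the vertex of its negation, and constants by
    a link to vertex 0. *)
Definition LK (i j : nat) : bool :=
  has (fun t => has (fun o =>
    has (fun f => ln i j t o f 0 (nf + f) 0 0 0 ||
       (j == 0) && ((i == vtx t o (nf + f) 0) && frc true t o f ||
                    (i == vtx t o f 0) && frc false t o f)) (iota 0 nf) ||
    has (fun r => [|| lnl i j t o (2 * nf + r) 0 (l0 (R r)),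
       lnl i j t o (2 * nf + r) 1 (l1 (R r)),
       lnl i j t o (2 * nf + nr + r) 1 (l2 (R r)),
       ln i j t o (2 * nf + r) 2 (2 * nf + nr + r) 0 0 0 |
       (j == 0) && (i == vtx t o (2 * nf + nr + r) 2)]) (iota 0 nr))
   (iota 0 W)) (iota 0 H).

Definition gtrip (b : nat) : bool :=
  has (fun t => has (fun o => has (fun d => b == blk t o d)
    (iota (2 * nf) (2 * nr))) (iota 0 W)) (iota 0 H).

Definition glink i j := LK i j || LK j i.

Definition gsize := 6 * (1 + H * W * NB).

Lemma vtxE t o b s : s < 6 -> vtx t o b s %/ 6 = blk t o b /\ vtx t o b s %% 6 = s.
Proof. by rewrite /vtx; lia. Qed.

Lemma cell_lt t o : t < H -> o < W -> t * W + o < H * W.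
Proof. by move=> ht ho; have : t.+1 * W <= H * W by [rewrite leq_mul2r ht orbT]; rewrite mulSn; lia. Qed.

Lemma blk_lt t o b : t < H -> o < W -> b < NB -> blk t o b < 1 + H * W * NB.
Proof.
move=> ht ho hb; have hc := cell_lt ht ho; rewrite /blk ltn_add2l.
have : (t * W + o).+1 * NB <= H * W * NB by rewrite leq_mul2r hc orbT.
by rewrite mulSn; lia.
Qed.

Lemma vtx_lt t o b s : t < H -> o < W -> b < NB -> s < 6 -> vtx t o b s < gsize.
Proof. by move=> ht ho hb hs; have := blk_lt ht ho hb; rewrite /vtx /gsize; lia. Qed.

Lemma blk_dec t o b : o < W -> b < NB ->
  [/\ (blk t o b - 1) %/ NB %/ W = t, (blk t o b - 1) %/ NB %% W = o & (blk t o b - 1) %% NB = b].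
Proof.
move=> ho hb; rewrite /blk addKn divnMDl ?(divn_small hb) ?addn0; last by lia.
rewrite divnMDl ?(divn_small ho) ?addn0; last by lia.
by rewrite !modnMDl !modn_small.
Qed.

Lemma blk_neq t o b t' o' b' : b < NB -> b' < NB -> b != b' -> blk t o b != blk t' o' b'.
Proof.
move=> hb hb' hne; apply: contraNneq hne; rewrite /blk => /addnI /(congr1 (modn^~ NB)).
by rewrite !modnMDl !modn_small // => ->.
Qed.

Lemma okR r : r < nr -> okf (R r).
Proof. by move=> h; apply: (allP rules_ok); apply: mem_nth. Qed.

Lemma lit_lt l : lf l < nf -> (if lsg l then nf + lf l else lf l) < 2 * nf.
Proof. by case: (lsg l); lia. Qed.

Theorem grid_colours : (exists A, sat A) <-> exists c, colours gtrip glink gsize c.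
Proof.
split=> [[A [hA hF]]|[c [hc ht]]].
  (* A literal that leaves the grid has no link and may count as true, in accordance with [sat]. *)
  pose lv t o l := ~~ inr_ t o l || holds A t o l.
  pose cc t o b s :=
    if b < nf then A t o b
    else if b < 2 * nf then ~~ A t o (b - nf)
    else if b < 2 * nf + nr then
      let r := R (b - 2 * nf) in
      if s == 0 then lv t o (l0 r) else if s == 1 then lv t o (l1 r)
      else ~~ (lv t o (l0 r) || lv t o (l1 r))
    else let r := R (b - (2 * nf + nr)) in
      if s == 0 then lv t o (l0 r) || lv t o (l1 r)
      else if s == 1 then lv t o (l2 r) else false.
  pose c v := if v %/ 6 == 0 then true else
    let q := v %/ 6 - 1 in cc (q %/ NB %/ W) (q %/ NB %% W) (q %% NB) (v %% 6).
  have cE t o b s : o < W -> b < NB -> s < 6 -> c (vtx t o b s) = cc t o b s.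
    move=> ho hb hs; rewrite /c; have [-> ->] := vtxE t o b hs.
    by have [-> -> ->] := blk_dec t ho hb.
  have cF t o f : o < W -> f < nf -> c (vtx t o f 0) = A t o f.
    by move=> ho hf; rewrite cE; [rewrite /cc hf|..]; lia.
  have cN t o f : o < W -> f < nf -> c (vtx t o (nf + f) 0) = ~~ A t o f.
    move=> ho hf; rewrite cE; [rewrite /cc|..]; try lia.
    rewrite ifF; last by lia.
    by rewrite ifT ?addKn //; lia.
  have c1 t o r s : o < W -> r < nr -> s < 6 -> c (vtx t o (2 * nf + r) s) =
     if s == 0 then lv t o (l0 (R r)) else if s == 1 then lv t o (l1 (R r))
      else ~~ (lv t o (l0 (R r)) || lv t o (l1 (R r))).
    move=> ho hr hs; rewrite cE; [rewrite /cc|..]; try lia.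
    rewrite ifF; last by lia.
    rewrite ifF; last by lia.
    by rewrite ltn_add2l hr addKn.
  have c2 t o r s : o < W -> r < nr -> s < 6 -> c (vtx t o (2 * nf + nr + r) s) =
     if s == 0 then lv t o (l0 (R r)) || lv t o (l1 (R r))
      else if s == 1 then lv t o (l2 (R r)) else false.
    move=> ho hr hs; rewrite cE; [rewrite /cc|..]; try lia.
    rewrite ifF; last by lia.
    rewrite ifF; last by lia.
    rewrite ifF; last by lia.
    by rewrite addKn.
  have lnlP i j t o b s l : o < W -> lf l < nf -> lnl i j t o b s l ->
      c (vtx t o b s) = lv t o l -> c i != c j.
    move=> ho hl /and4P[/eqP -> h1 h2 /eqP ->] ->; rewrite /lv /inr_ h1 h2 /= /holds.
    by case: (lsg l); rewrite ?cN ?cF //; case: (A _ _ _).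
  have hLK i j : LK i j -> c i != c j.
    case/hasP=> t /[!mem_iota] /= ht /hasP[o /[!mem_iota] /= ho] /orP[/hasP[f]|/hasP[r]].
      rewrite mem_iota /= => hf /orP[/and4P[/eqP -> h1 h2 /eqP ->]|].
        by rewrite !addn0 cF // cN //; case: (A _ _ _).
      case/andP=> /eqP -> /orP[] /andP[/eqP -> /hF]; rewrite ?cN ?cF // => ->//.
    rewrite mem_iota /= => hr; have /and3P[o0 o1 o2] := okR hr.
    case/or4P.
    - by move/(lnlP _ _ _ _ _ _ _ ho o0); apply; rewrite c1.
    - by move/(lnlP _ _ _ _ _ _ _ ho o1); apply; rewrite c1.
    - by move/(lnlP _ _ _ _ _ _ _ ho o2); apply; rewrite c2.
    case/orP=> [/and4P[/eqP -> h1 h2 /eqP ->]|/andP[/eqP -> /eqP ->]].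
      by rewrite !addn0 c1 // c2 //=; case: (_ || _).
    by rewrite c2.
  exists c; split.
    by move=> i j _ _ _ _ /orP[/hLK //|/hLK]; rewrite eq_sym.
  move=> b hb /hasP[t /[!mem_iota] /= ht /hasP[o /[!mem_iota] /= ho] /hasP[d]].
  rewrite mem_iota => hd /eqP eb.
  have e0 : 6 * b = vtx t o d 0 by rewrite /vtx eb addn0.
  have e1 : 6 * b + 1 = vtx t o d 1 by rewrite /vtx eb.
  have e2 : 6 * b + 2 = vtx t o d 2 by rewrite /vtx eb.
  rewrite e1 e2 e0.
  have [hd'|hd'] := ltnP d (2 * nf + nr).
    have -> : d = 2 * nf + (d - 2 * nf) by lia.
    by rewrite !c1 //=; try lia; case: (lv _ _ _); case: (lv _ _ _).
  have -> : d = 2 * nf + nr + (d - (2 * nf + nr)) by lia.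
  set r := d - _; have hr : r < nr by rewrite /r; lia.
  rewrite !c2 //=; have := hA t o (R r) ht ho (mem_nth _ hr); rewrite /lv.
  by case: (inr_ t o (l0 _)) => //=; case: (inr_ t o (l1 _)) => //=; rewrite ?orbT //;
    case: (inr_ t o (l2 _)) => //= h; try (have := h isT isT isT);
    do ?[case: (holds _ _ _ _) => //=].
have hL i j : LK i j -> i < gsize -> j < gsize -> i %/ 6 != j %/ 6 -> i %% 6 < 3 -> j %% 6 < 3 ->
    c i != c j.
  move=> h hi hj hd hi3 hj3; case: (ltngtP i j) => hij.
  - by apply: hc => //; rewrite ?hij // /glink h.
  - rewrite eq_sym; apply: hc => //; rewrite ?hij //; first by rewrite eq_sym.
    by rewrite /glink h orbT.
  - by rewrite hij eqxx in hd.
have hL2 t o b s t' o' b' s' : LK (vtx t o b s) (vtx t' o' b' s') ->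
   t < H -> o < W -> b < NB -> s < 3 -> t' < H -> o' < W -> b' < NB -> s' < 3 -> b != b' ->
   c (vtx t o b s) != c (vtx t' o' b' s').
  move=> h ht1 ho hb hs ht' ho' hb' hs' hne.
  have [|e1 e2] := @vtxE t o b s; first by lia.
  have [|e1' e2'] := @vtxE t' o' b' s'; first by lia.
  by apply: hL => //; rewrite ?vtx_lt ?e1 ?e1' ?e2 ?e2' ?blk_neq //; lia.
have hL0 t o b s : LK (vtx t o b s) 0 -> t < H -> o < W -> b < NB -> s < 3 ->
   c (vtx t o b s) != c 0.
  move=> h ht1 ho hb hs; have [|e1 e2] := @vtxE t o b s; first by lia.
  by apply: hL => //; rewrite ?vtx_lt ?e1 ?e2 //; rewrite /gsize; lia.
have kf t o f i j : t < H -> o < W -> f < nf -> ln i j t o f 0 (nf + f) 0 0 0 ||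
       (j == 0) && ((i == vtx t o (nf + f) 0) && frc true t o f ||
                    (i == vtx t o f 0) && frc false t o f) -> LK i j.
  move=> ht1 ho hf h; apply/hasP; exists t; first by rewrite mem_iota.
  apply/hasP; exists o; first by rewrite mem_iota.
  by apply/orP; left; apply/hasP; exists f; first by rewrite mem_iota.
have kr t o r i j : t < H -> o < W -> r < nr -> [|| lnl i j t o (2 * nf + r) 0 (l0 (R r)),
       lnl i j t o (2 * nf + r) 1 (l1 (R r)),
       lnl i j t o (2 * nf + nr + r) 1 (l2 (R r)),
       ln i j t o (2 * nf + r) 2 (2 * nf + nr + r) 0 0 0 |
       (j == 0) && (i == vtx t o (2 * nf + nr + r) 2)] -> LK i j.
  move=> ht1 ho hf h; apply/hasP; exists t; first by rewrite mem_iota.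
  apply/hasP; exists o; first by rewrite mem_iota.
  by apply/orP; right; apply/hasP; exists r; first by rewrite mem_iota.
have hN t o f : t < H -> o < W -> f < nf -> c (vtx t o f 0) != c (vtx t o (nf + f) 0).
  move=> ht1 ho hf; apply: hL2 => //; try lia.
  by apply: (kf t o f) => //; rewrite /ln !addn0 !eqxx ht1 ho.
(* Comparison with vertex 0 removes the freedom to exchange the two parts. *)
pose A t o f := c (vtx t o f 0) == c 0.
exists A; split; last first.
  move=> sg t o f ht1 ho hf hfr; rewrite /A.
  have := hN t o f ht1 ho hf; case: sg hfr => hfr.
    have : c (vtx t o (nf + f) 0) != c 0.
      apply: hL0 => //; try lia; apply: (kf t o f) => //.
      by rewrite !eqxx hfr orbT.
    by case: (c _); case: (c _); case: (c _).
  have : c (vtx t o f 0) != c 0.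
    apply: hL0 => //; try lia; apply: (kf t o f) => //.
    by rewrite !eqxx hfr !orbT.
  by case: (c _); case: (c _).
move=> t o r0 ht1 ho /(nthP rule0) [r hr0 <-] i0 i1 i2.
have hr : r < nr := hr0.
have t1 : 2 * nf <= 2 * nf + r < NB by clear -hr; lia.
have t2 : 2 * nf <= 2 * nf + nr + r < NB by clear -hr; lia.
have t12 : 2 * nf + r != 2 * nf + nr + r by clear -hr; lia.
have [/andP[t1a t1b] /andP[t2a t2b]] := (t1, t2).
have /and3P[o0 o1 o2] := okR hr.
apply: contraT; rewrite !negb_or => /and3P[n0 n1 n2].
have lf_ b s l : inr_ t o l -> lf l < nf -> ~~ holds A t o l -> s < 3 -> 2 * nf <= b -> b < NB ->
    (forall i j, lnl i j t o b s l -> LK i j) -> c (vtx t o b s) != c 0.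
  move=> /andP[j1 j2] hl; rewrite /holds /A => hn hs hb hbN hk.
  have hl2 := lit_lt hl.
  have : c (vtx t o b s) != c (vtx (t + ldt l) (o + ldo l) (if lsg l then nf + lf l else lf l) 0).
    apply: hL2 => //; first by apply: hk; rewrite /lnl /ln !eqxx j1 j2.
    - exact: leq_trans hl2 (leq_addr _ _).
    - by rewrite neq_ltn (leq_trans hl2 hb) orbT.
  have := hN _ _ _ j1 j2 hl; move: hn; clear; case: (lsg l); case: (c _); case: (c _);
    case: (c _) => //; case: (c _) => //.
have d0 : c (vtx t o (2 * nf + r) 0) != c 0.
  by apply: (lf_ _ _ _ i0) => // i j h; apply: (kr t o r) => //; rewrite h.
have d1 : c (vtx t o (2 * nf + r) 1) != c 0.
  by apply: (lf_ _ _ _ i1) => // i j h; apply: (kr t o r) => //; rewrite h orbT.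
have d2 : c (vtx t o (2 * nf + nr + r) 1) != c 0.
  by apply: (lf_ _ _ _ i2) => // i j h; apply: (kr t o r) => //; rewrite h !orbT.
have d3 : c (vtx t o (2 * nf + nr + r) 2) != c 0.
  by apply: hL0 => //; apply: (kr t o r) => //; rewrite !eqxx !orbT.
have d4 : c (vtx t o (2 * nf + r) 2) != c (vtx t o (2 * nf + nr + r) 0).
  apply: hL2 => //; apply: (kr t o r) => //.
  by rewrite /ln !addn0 !eqxx ht1 ho !orbT.
have tr d : 2 * nf <= d < NB -> gtrip (blk t o d).
  move=> hd; apply/hasP; exists t; first by rewrite mem_iota.
  apply/hasP; exists o; first by rewrite mem_iota.
  by apply/hasP; exists d; rewrite ?mem_iota ?eqxx //; clear -hd; lia.
have tN d : 2 * nf <= d < NB ->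
  ~~ [&& c (vtx t o d 0) == c (vtx t o d 1) & c (vtx t o d 0) == c (vtx t o d 2)].
  move=> hd; have hlt : 6 * blk t o d < gsize.
    by have := @vtx_lt t o d 0 ht1 ho; rewrite /vtx addn0; apply => //; case/andP: hd.
  by have := ht _ hlt (tr d hd); rewrite /vtx !addn0.
move: (tN _ t1) (tN _ t2) d0 d1 d2 d3 d4; clear; case: (c 0);
  case: (c (vtx t o (2 * nf + r) 0)) => //; case: (c (vtx t o (2 * nf + r) 1)) => //;
  case: (c (vtx t o (2 * nf + r) 2)) => //; case: (c (vtx t o (2 * nf + nr + r) 0)) => //;
  case: (c (vtx t o (2 * nf + nr + r) 1)) => //; case: (c (vtx t o (2 * nf + nr + r) 2)) => //.
Qed.

End Grid.

(** * First-order definition of the reduction *)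


Definition FF := FZ (TC 1).
Definition FT := FZ (TC 0).
Definition FOr f g := FNot (FAnd (FNot f) (FNot g)).
Definition FLe a b := FZ (TSub a b).
Definition FLt a b := FLe (TAdd a (TC 1)) b.
Definition FEq a b := FAnd (FLe a b) (FLe b a).
Definition FOrs (l : seq fof) := foldr FOr FF l.
Definition FAll t f := FNot (FEx t (FNot f)).

Section Eval.
Variables (x u : seq bool) (env : seq nat).
Notation ev := (evF x u env).

Lemma ev_or f g : ev (FOr f g) = ev f || ev g.
Proof. by rewrite /= negb_and !negbK. Qed.
Lemma ev_le a b : ev (FLe a b) = (evT env a <= evT env b).
Proof. by rewrite /= subn_eq0. Qed.
Lemma ev_lt a b : ev (FLt a b) = (evT env a < evT env b).
Proof. by rewrite ev_le /= addn1. Qed.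
Lemma ev_eq a b : ev (FEq a b) = (evT env a == evT env b).
Proof. by rewrite /FEq [LHS]/= !subn_eq0 eqn_leq. Qed.
Lemma ev_and f g : ev (FAnd f g) = ev f && ev g.
Proof. by []. Qed.
Lemma ev_not f : ev (FNot f) = ~~ ev f.
Proof. by []. Qed.
Lemma ev_ff : ev FF = false.
Proof. by []. Qed.
Lemma ev_tt : ev FT = true.
Proof. by []. Qed.
Lemma ev_ors l : ev (FOrs l) = has ev l.
Proof. by elim: l => // f l ih; rewrite [FOrs _]/(FOr f (FOrs l)) ev_or ih. Qed.
Lemma ev_orsmap (T : Type) (F : T -> fof) l : ev (FOrs (map F l)) = has (fun a => ev (F a)) l.
Proof. by rewrite ev_ors has_map. Qed.
Lemma ev_ex t f : ev (FEx t f) = has (fun v => evF x u (rcons env v) f) (iota 0 (evT env t)).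
Proof. by []. Qed.
Lemma ev_all t f : ev (FAll t f) = all (fun v => evF x u (rcons env v) f) (iota 0 (evT env t)).
Proof. by rewrite /= -all_predC; apply: eq_all => v /=; rewrite negbK. Qed.
End Eval.

Definition evE := (ev_or, ev_le, ev_lt, ev_eq, ev_and, ev_not, ev_ff, ev_tt,
  ev_orsmap, ev_ors, ev_ex, ev_all).

Lemma rows_mkseq (S : Type) (F : nat -> S) N m :
  flatten [seq [seq F (i * N + j) | j <- iota 0 N] | i <- iota 0 m] = mkseq F (m * N).
Proof.
elim: m => // m ih; rewrite -addn1 iotaD map_cat flatten_cat ih add0n /= cats0.
rewrite mulnDl mul1n /mkseq iotaD map_cat add0n; congr (_ ++ _).
by have -> : iota (m * N) N = map (addn (m * N)) (iota 0 N) by [rewrite -iotaDl addn0]; rewrite -map_comp.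
Qed.

Definition matrix_word n (e : rel 'I_n) : seq bool :=
  [seq e i j | i <- enum 'I_n, j <- enum 'I_n].

Lemma matrix_wordE N (T : rel 'I_N) (F : nat -> bool) :
  (forall i j : 'I_N, F (i * N + j) = T i j) -> matrix_word T = mkseq F (N * N).
Proof.
move=> h; rewrite -rows_mkseq /matrix_word -val_enum_ord -map_comp.
congr flatten; apply: eq_map => i /=; rewrite -map_comp.
by apply: eq_map => j /=; rewrite h.
Qed.

Lemma matrix_nth N (T : rel 'I_N) (i j : 'I_N) :
  nth false (matrix_word T) (i * N + j) = T i j.
Proof.
pose F p := if insub (p %/ N) is Some a then
  if insub (p %% N) is Some b then T a b else false else false.
have hF (a b : 'I_N) : F (a * N + b) = T a b.
  have hN : 0 < N by have := ltn_ord a; lia.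
  by rewrite /F divnMDl // modnMDl (divn_small (ltn_ord b)) addn0 (modn_small (ltn_ord b)) !valK.
rewrite (matrix_wordE hF) nth_mkseq //.
have : i.+1 * N <= N * N by rewrite leq_mul2r ltn_ord orbT.
by rewrite mulSn; have := ltn_ord j; lia.
Qed.

Section Reduction.
Variables (nf : nat) (rules : seq rule) (tH tW : term) (H W : nat -> nat).
Variables (frcF : bool -> nat -> fof) (frc : seq bool -> bool -> nat -> nat -> nat -> bool).
Hypothesis rules_ok : all (okf nf) rules.
Hypothesis HE : forall n env, evT (n :: env) tH = H n.
Hypothesis WE : forall n env, evT (n :: env) tW = W n.
Hypothesis frcE : forall x sg f p i j b b' t o,
  evF x [::] [:: size x; 0; p; i; j; b; b'; t; o] (frcF sg f) = frc x sg t o f.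

Notation nr := (size rules).
Notation NB := (2 * nf + 2 * nr).
Notation R r := (nth rule0 rules r).
Notation v := TVar.

(** Levels of the environment: 2 is the output position, 3 and 4 the row and column, 5 and 6 the
    blocks of the two vertices, 7 and 8 a grid cell. *)
Definition blkT t o d :=
  TAdd (TC 1) (TAdd (TMul (TAdd (TMul t tW) o) (TC NB)) d).
Definition vtxT t o b s := TAdd (TMul (TC 6) (blkT t o (TC b))) (TC s).

Definition tripF := FEx tH (FEx tW (FOrs [seq FEq (v 5) (blkT (v 7) (v 8) (TC d)) |
  d <- iota (2 * nf) (2 * nr)])).

Definition lnF ti tj b s b' s' dt do :=
  FAnd (FEq ti (vtxT (v 7) (v 8) b s)) (FAnd (FLt (TAdd (v 7) (TC dt)) tH)
  (FAnd (FLt (TAdd (v 8) (TC do)) tW)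
        (FEq tj (vtxT (TAdd (v 7) (TC dt)) (TAdd (v 8) (TC do)) b' s')))).
Definition lnlF ti tj b s (l : lit) :=
  lnF ti tj b s (if lsg l then nf + lf l else lf l) 0 (ldt l) (ldo l).

Definition LKF ti tj := FEx tH (FEx tW (FOr
  (FOrs [seq FOr (lnF ti tj f 0 (nf + f) 0 0 0)
     (FAnd (FEq tj (TC 0))
       (FOr (FAnd (FEq ti (vtxT (v 7) (v 8) (nf + f) 0)) (frcF true f))
            (FAnd (FEq ti (vtxT (v 7) (v 8) f 0)) (frcF false f)))) | f <- iota 0 nf])
  (FOrs [seq FOr (lnlF ti tj (2 * nf + r) 0 (l0 (R r)))
     (FOr (lnlF ti tj (2 * nf + r) 1 (l1 (R r)))
     (FOr (lnlF ti tj (2 * nf + nr + r) 1 (l2 (R r)))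
     (FOr (lnF ti tj (2 * nf + r) 2 (2 * nf + nr + r) 0 0 0)
          (FAnd (FEq tj (TC 0)) (FEq ti (vtxT (v 7) (v 8) (2 * nf + nr + r) 2)))))) |
     r <- iota 0 nr]))).

Definition bbF ti tj s s' := FOr
  (FAnd (FEq (v 5) (v 6)) (if (s == 3) && (s' == 5) then FT
     else if (s == 0) && (s' == 2) then tripF else FF))
  (FAnd (FNot (FEq (v 5) (v 6)))
     (if (s < 3) && (s' < 3) then FOr (LKF ti tj) (LKF tj ti) else FF)).

(** Terms have no division: quotients by 6 are quantified, and remainders are finite
    disjunctions. *)
Definition beF ti tj := FEx (TAdd ti (TC 1)) (FEx (TAdd tj (TC 1))
  (FOrs [seq FOrs [seq FAnd (FEq ti (TAdd (TMul (TC 6) (v 5)) (TC s)))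
    (FAnd (FEq tj (TAdd (TMul (TC 6) (v 6)) (TC s'))) (bbF ti tj s s')) |
     s' <- iota 0 6] | s <- iota 0 6])).

Section AtWord.
Variable x : seq bool.
Notation n := (size x).
Notation gt := (gtrip nf rules (H n) (W n)).
Notation gl := (glink nf rules (H n) (W n) (frc x)).

Lemma tripFE p i j b b' :
  evF x [::] [:: n; 0; p; i; j; b; b'] tripF = gt b.
Proof.
rewrite /tripF !evE HE; apply: eq_has => t; rewrite evE /= WE.
apply: eq_has => o; rewrite evE; apply: eq_has => d; rewrite evE /= WE.
by [].
Qed.

Lemma LKFE (ti tj : term) a c p i j b b' :
  (forall l, evT [:: n, 0, p, i, j & l] ti = a) -> (forall l, evT [:: n, 0, p, i, j & l] tj = c) ->
  evF x [::] [:: n; 0; p; i; j; b; b'] (LKF ti tj) = LK nf rules (H n) (W n) (frc x) a c.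
Proof.
move=> ha hc; rewrite /LKF /LK !evE HE; apply: eq_has => t; rewrite [rcons _ _]/= evE WE.
apply: eq_has => o; rewrite [rcons _ _]/= evE; congr orb; rewrite evE; apply: eq_has => f.
  by rewrite !evE !frcE ha hc /= HE !WE.
by rewrite !evE ha hc /= HE !WE.
Qed.

Lemma beFE (ti tj : term) a c p i j :
  (forall l, evT [:: n, 0, p, i, j & l] ti = a) -> (forall l, evT [:: n, 0, p, i, j & l] tj = c) ->
  evF x [::] [:: n; 0; p; i; j] (beF ti tj) = BE gt gl a c.
Proof.
move=> ha hc; rewrite /beF evE.
have key b b' : evF x [::] [:: n; 0; p; i; j; b; b']
   (FOrs [seq FOrs [seq FAnd (FEq ti (TAdd (TMul (TC 6) (v 5)) (TC s)))
    (FAnd (FEq tj (TAdd (TMul (TC 6) (v 6)) (TC s'))) (bbF ti tj s s')) |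
     s' <- iota 0 6] | s <- iota 0 6]) = [&& b == a %/ 6, b' == c %/ 6 & BE gt gl a c].
  have hbb s s' : evF x [::] [:: n; 0; p; i; j; b; b'] (bbF ti tj s s') =
     ((b == b') && ((s == 3) && (s' == 5) || gt b && (s == 0) && (s' == 2)) ||
      (b != b') && ((s < 3) && (s' < 3) && gl a c)).
    have e56 : evF x [::] [:: n; 0; p; i; j; b; b'] (FEq (v 5) (v 6)) = (b == b').
      by rewrite ev_eq.
    rewrite /bbF ev_or ev_and [X in _ || X]ev_and ev_not e56; congr orb; congr andb.
      case: ifP => [_|_]; first by rewrite ev_tt.
      case: ifP => [/andP[/eqP -> /eqP ->]|hs]; first by rewrite tripFE !andbT.
      by rewrite ev_ff -andbA hs andbF.
    case: ifP => _; last by rewrite ev_ff.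
    by rewrite ev_or (LKFE _ _ ha hc) (LKFE _ _ hc ha).
  rewrite evE; apply/hasP/and3P => [[s]|[/eqP hb /eqP hb' hBE]].
    rewrite mem_iota evE => hs /hasP[s']; rewrite mem_iota ev_and ev_eq ha ev_and ev_eq hc hbb /= => hs'.
    case/and3P=> /eqP ea /eqP ec hB.
    have -> : a %/ 6 = b by lia.
    have -> : c %/ 6 = b' by lia.
    rewrite !eqxx; split=> //; rewrite /BE.
    have -> : a %/ 6 = b by lia.
    have -> : c %/ 6 = b' by lia.
    have -> : a %% 6 = s by lia.
    have -> : c %% 6 = s' by lia.
    by move: hB; case: eqP => /= _; rewrite ?orbF.
  exists (a %% 6); first by rewrite mem_iota ltn_mod.
  rewrite evE; apply/hasP; exists (c %% 6); first by rewrite mem_iota ltn_mod.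
  rewrite ev_and ev_eq ha ev_and ev_eq hc hbb /= hb hb'.
  have -> : (a == 6 * (a %/ 6) + a %% 6) by lia.
  have -> : (c == 6 * (c %/ 6) + c %% 6) by lia.
  by move: hBE; rewrite /BE; case: eqP => /= _; rewrite ?orbF.
rewrite [evT _ _]/= ha addn1; apply/hasP/idP => [[b _]|hBE].
  by rewrite evE => /hasP[b' _]; rewrite [rcons _ _]/= key => /and3P[].
exists (a %/ 6); first by rewrite mem_iota ltnS leq_div.
rewrite evE [rcons _ _]/=; apply/hasP; exists (c %/ 6).
  by rewrite mem_iota /= hc addn1 ltnS leq_div.
by rewrite [rcons _ _]/= key !eqxx.
Qed.

End AtWord.

(** * The matrix of the glued tournament *)

Section Frame.
Variables (X : finType) (eX : rel X) (S1 : pred X).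
Notation s := #|X|.
Notation rkX a := (nat_of_ord (enum_rank (a : X))).

Definition tG := TMul (TC 6) (TAdd (TC 1) (TMul (TMul tH tW) (TC NB))).
Definition tN := TAdd (TC s) tG.

(** Vertices below [s] are those of the frame, which is independent of the input, so its arcs are
    listed one by one. *)
Definition bodyF := FOr
  (FOrs [seq FAnd (FEq (v 3) (TC (rkX ab.1))) (FEq (v 4) (TC (rkX ab.2))) |
     ab <- enum [pred ab : X * X | eX ab.1 ab.2]])
  (FOr
  (FOrs [seq FAnd (FEq (v 3) (TC (rkX a))) (FLe (TC s) (v 4)) | a <- enum (predC S1)])
  (FOr (FOrs [seq FAnd (FEq (v 4) (TC (rkX a))) (FLe (TC s) (v 3)) | a <- enum S1])
  (FAnd (FLe (TC s) (v 3)) (FAnd (FLe (TC s) (v 4)) (FOr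
    (FAnd (FLt (v 3) (v 4)) (FNot (beF (TSub (v 3) (TC s)) (TSub (v 4) (TC s)))))
    (FAnd (FLt (v 4) (v 3)) (beF (TSub (v 4) (TC s)) (TSub (v 3) (TC s))))))))).

Definition adjF := FEx tN (FEx tN
  (FAnd (FEq (v 2) (TAdd (TMul (v 3) tN) (v 4))) bodyF)).

Variable x : seq bool.
Notation n := (size x).
Notation g := (gsize nf rules (H n) (W n)).
Notation N := (s + g).
Notation eY := (fun i j : 'I_g => blockT (gtrip nf rules (H n) (W n))
                  (glink nf rules (H n) (W n) (frc x)) i j).

Definition dec (i : 'I_N) : X + 'I_g :=
  match split i with inl a => inl (enum_val a) | inr y => inr y end.
Definition enc (p : X + 'I_g) : 'I_N :=
  match p with inl a => lshift g (enum_rank a) | inr y => rshift s y end.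

Lemma decK : cancel dec enc.
Proof.
by move=> i; rewrite /dec; case: split_ordP => j ->; rewrite /= ?enum_valK.
Qed.

Lemma encK : cancel enc dec.
Proof.
move=> [a|y]; rewrite /dec /enc.
  by rewrite -[lshift _ _]/(unsplit (inl _)) unsplitK enum_rankK.
by rewrite -[rshift _ _]/(unsplit (inr _)) unsplitK.
Qed.

Definition arcs : rel 'I_N := fun i j => glue eX S1 eY (dec i) (dec j).

Lemma tNE l : evT (n :: l) tN = N.
Proof. by rewrite /= HE WE. Qed.

Lemma bodyFE p (i j : 'I_N) :
  evF x [::] [:: n; 0; p; nat_of_ord i; nat_of_ord j] bodyF = arcs i j.
Proof.
rewrite -(decK i) -(decK j); move: (dec i) (dec j) => {i j} a b.
rewrite /arcs !encK; set i := nat_of_ord (enc a); set j := nat_of_ord (enc b).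
have -> : evF x [::] [:: n; 0; p; i; j] bodyF =
  [|| has (fun ab : X * X => (i == rkX ab.1) && (j == rkX ab.2))
        (enum [pred ab : X * X | eX ab.1 ab.2]),
      has (fun a => (i == rkX a) && (s <= j)) (enum (predC S1)),
      has (fun a => (j == rkX a) && (s <= i)) (enum S1) |
      [&& s <= i, s <= j & blockT (gtrip nf rules (H n) (W n))
                  (glink nf rules (H n) (W n) (frc x)) (i - s) (j - s)]].
  rewrite /bodyF 3!ev_or; congr [|| _, _, _ | _].
  - by rewrite ev_orsmap; apply: eq_has => c; rewrite !evE.
  - by rewrite ev_orsmap; apply: eq_has => c; rewrite !evE.
  - by rewrite ev_orsmap; apply: eq_has => c; rewrite !evE.
  rewrite ev_and ev_and !ev_le ev_or ev_and ev_lt ev_not ev_and ev_lt.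
  rewrite (@beFE x _ _ (i - s) (j - s)) // (@beFE x _ _ (j - s) (i - s)) //=.
  case hi: (s <= i) => //; case hj: (s <= j) => //; rewrite /blockT /=.
  have -> : (i - s < j - s) = (i < j) by clear -hi hj; lia.
  by have -> : (j - s < i - s) = (j < i) by clear -hi hj; lia.
have rkE (c d : X) : (rkX c == rkX d) = (c == d).
  by rewrite (inj_eq val_inj) (inj_eq enum_rank_inj).
have rkF (c : X) y : (s + y == rkX c) = false.
  by apply/negbTE; rewrite neq_ltn ltn_addr ?orbT // ltn_ord.
have rkL (c : X) : (s <= rkX c) = false by rewrite leqNgt ltn_ord.
have hasf (T : Type) (P : pred T) l : (forall c, P c = false) -> has P l = false.
  by move=> hP; elim: l => //= c l ->; rewrite hP.
have has1 (P : pred X) c : has (fun d => rkX c == rkX d) (enum P) = P c.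
  apply/hasP/idP => [[d]|hc]; first by rewrite mem_enum rkE => hd /eqP ->.
  by exists c; rewrite ?mem_enum ?eqxx.
rewrite {}/i {}/j; case: a => [a|y]; case: b => [b|y'] /=.
- rewrite !rkL /= orbF [X in _ || (X || _)]hasf; last by move=> c; rewrite andbF.
  rewrite [X in _ || (_ || X)]hasf ?orbF; last by move=> c; rewrite andbF.
  apply/hasP/idP => [[[c d]]|hab]; first by rewrite mem_enum !rkE /= inE /= => h /andP[/eqP -> /eqP ->].
  by exists (a, b); rewrite ?mem_enum ?inE //= !eqxx.
- rewrite hasf /=; last by move=> c; rewrite rkF andbF.
  rewrite rkL /= orbF [X in _ || X]hasf ?orbF; last by move=> c; rewrite andbF.
  by rewrite leq_addr; apply: etrans (has1 (predC S1) a); apply: eq_has => c; rewrite andbT.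
- rewrite hasf /=; last by move=> c; rewrite rkF.
  rewrite rkL /= hasf /=; last by move=> c; rewrite rkF.
  by rewrite andbF orbF leq_addr -(has1 S1); apply: eq_has => c; rewrite andbT.
rewrite hasf /=; last by move=> c; rewrite rkF.
rewrite hasf /=; last by move=> c; rewrite rkF.
rewrite hasf /=; last by move=> c; rewrite rkF.
by rewrite !leq_addr !addKn.
Qed.

Lemma adjFE (i j : 'I_N) :
  evF x [::] [:: n; 0; i * N + j] adjF = arcs i j.
Proof.
rewrite /adjF evE tNE; apply/hasP/idP.
  move=> [i' _]; rewrite [rcons _ _]/= evE tNE => /hasP[j'].
  rewrite mem_iota add0n => /andP[_ hj'].
  rewrite [rcons _ _]/= ev_and ev_eq [evT _ (v 2)]/=.
  rewrite [evT _ (TAdd _ _)]/(i' * evT [:: n; 0; i * N + j; i'; j'] tN + j') tNE.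
  case/andP=> /eqP e.
  have hN : 0 < N by apply: leq_ltn_trans hj'.
  have ei : i' = i.
    have := congr1 (divn^~ N) e.
    by rewrite !divnMDl // (divn_small (ltn_ord j)) (divn_small hj') !addn0 => ->.
  have ej : j' = j by move: e; rewrite ei => /addnI ->.
  by rewrite ei ej bodyFE.
move=> h; exists (i : nat); first by rewrite mem_iota add0n ltn_ord.
rewrite [rcons _ _]/= evE tNE; apply/hasP; exists (j : nat); first by rewrite mem_iota add0n ltn_ord.
rewrite [rcons _ _]/= ev_and bodyFE h andbT ev_eq [evT _ (v 2)]/=.
by rewrite [evT _ (TAdd _ _)]/(i * evT [:: n; 0; i * N + j; nat_of_ord i; nat_of_ord j] tN + j) tNE.
Qed.

End Frame.

Theorem grid_reducible (L : language) k : 3 <= k ->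
  (forall x, L x <-> exists A, sat nf rules (H (size x)) (W (size x)) (frc x) A) ->
  polytime_reducible L (diomega_ordering k).
Proof.
move=> hk hL; have [|X [eX [S1 [tX hX]]]] := @glue_exists k.-1; first by lia.
exists (fun x => mkseq (fun p => evF x [::] [:: size x; 0; p] (adjF eX S1))
   (evT [:: size x; 0] (TMul (tN X) (tN X)))).
split; first exact: fo_function.
move=> x; set n := size x; pose g := gsize nf rules (H n) (W n); pose N := #|X| + g.
pose tr := gtrip nf rules (H n) (W n); pose lk := glink nf rules (H n) (W n) (frc x).
have tY : istour (fun i j : 'I_g => blockT tr lk i j) := tour_blockT _ _ _.
have dec_inj : injective (@dec X x) := can_inj (@decK X x).
have tA : istour (arcs eX S1 (x := x)).
  have [h1 h2] := tour_glue S1 tX tY; split=> [a|a b hab]; first exact: h1.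
  by apply: h2; rewrite (inj_eq dec_inj).
case: (tA) => hA1 hA2; pose T := Tournament hA1 hA2.
have eT : encode_tournament T = mkseq (fun p => evF x [::] [:: n; 0; p] (adjF eX S1))
   (evT [:: n; 0] (TMul (tN X) (tN X))).
  rewrite [evT _ _]/(evT [:: n; 0] (tN X) * evT [:: n; 0] (tN X)) (tNE X x).
  by apply: (matrix_wordE (T := T)) => i j; rewrite adjFE.
have key : L x <-> diclique_number T <= k.
  rewrite hL -(rwP (diclP T k)).
  have e1 := grid_colours (H n) (W n) (frc x) rules_ok.
  have e2 := splits_blockT tr lk (1 + H n * W n * (2 * nf + 2 * nr)).
  have e3 := hX _ _ tY.
  rewrite e1 -e2 -e3 prednK; last by lia.
  split; first by apply: dicl_pull dec_inj _.
  apply: (dicl_pull (f := @enc X x) (can_inj (@encK X x))) => a b.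
  by rewrite /T /= /arcs !encK.
split=> [/key h|[n' [T' [ew hT']]]]; first by exists N, T; rewrite -eT.
apply/key; rewrite -/n -eT in ew.
(* A word has at most one reading as a matrix, since its length is the square of the number of
   vertices. *)
have eN : n' = N.
  have := congr1 size ew; rewrite /encode_tournament !size_allpairs !size_enum_ord.
  by move/eqP; rewrite !mulnn eqn_exp2r // => /eqP <-.
move: T' ew hT'; rewrite {}eN => T' ew /diclP hT'; apply/diclP.
by apply: (dicl_pull (f := id)) hT' => // a b; rewrite -(matrix_nth T) -(matrix_nth T') /matrix_word -/(encode_tournament T) ew.
Qed.

End Reduction.

(** * Simulation of Turing machines by local clauses *)


(** Horner's rule on the coefficient list; over natural numbers it is monotone, and it translates
    into a term of the formula language. *)
Fixpoint hrec (s : seq nat) (y : nat) : nat := if s is a :: s' then hrec s' y * y + a else 0.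

Lemma horner_hrec (p : {poly nat}) y : p.[y]%R = hrec p y.
Proof. by rewrite /horner; elim: (polyseq p) => //= a s ->. Qed.

Lemma hrec_mono s y z : y <= z -> hrec s y <= hrec s z.
Proof. by move=> h; elim: s => //= a s ih; rewrite leq_add2r leq_mul. Qed.

Definition polyT (s : seq nat) (t : term) : term :=
  foldr (fun a acc => TAdd (TMul acc t) (TC a)) (TC 0) s.

Lemma polyTE s t env : evT env (polyT s t) = hrec s (evT env t).
Proof. by elim: s => //= a s ->. Qed.

Section Look.
Variable M : TM.
Notation G := (option (bool + aux M))%type.

(** The tape drawn with its head in column [c]. *)
Definition look (tp : tape M) (c o : nat) : G :=
  if o < c then nth None tp.1 (c - o.+1) else nth None tp.2 (o - c).
Definition wr (tp : tape M) c (a : G) o : G := if o == c then a else look tp c o.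
(** The column in which the later content of column [o + 1] stood before the move. Anchoring at [o]
    avoids negative offsets. *)
Definition shd d o := match d with Left => o | Stay => o.+1 | Right => o.+2 end.

Lemma look_scanned tp c : look tp c c = scanned tp.
Proof. by rewrite /look ltnn subnn nth0. Qed.

Lemma look_update tp a d c o :
  look (update tp (a, d)) c o.+1 = wr tp c a (shd d o).
Proof.
have lL (l r : seq G) p : p < c -> look (l, r) c p = nth None l (c - p.+1) by rewrite /look => ->.
have lR (l r : seq G) p : c <= p -> look (l, r) c p = nth None r (p - c).
  by rewrite /look ltnNge => ->.
case: tp => l r; rewrite /wr; case: d => /=.
- case: (eqVneq o c) => [->|hne]; first by rewrite lR ?subSnn.
  have [h|[h|h]] : o.+1 < c \/ (o.+1 = c \/ c < o) by lia.
  + by rewrite !lL; [rewrite nth_behead; congr nth|..]; lia.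
  + rewrite lR; last by lia.
    by rewrite lL; [rewrite h subnn /= nth0|lia].
  + rewrite !lR; [|lia|lia]; have -> : o.+1 - c = (o - c).-1.+2 by lia.
    by rewrite /= nth_behead; congr nth; lia.
- case: (eqVneq o.+1 c) => [e|hne]; first by rewrite lR; [rewrite e subnn|lia].
  have [h|h] : o.+1 < c \/ c < o.+1 by lia.
  + by rewrite !lL.
  + rewrite !lR; [|lia|lia]; have -> : o.+1 - c = (o - c).+1 by lia.
    by rewrite /= nth_behead.
case: (eqVneq o.+2 c) => [e|hne]; first by rewrite lL; [rewrite e subnn|lia].
have [h|h] : o.+2 < c \/ c <= o.+1 by lia.
+ by rewrite !lL; [have -> : c - o.+2 = (c - o.+3).+1 by lia|lia|lia].
rewrite lR //; rewrite lR; last by lia.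
by rewrite nth_behead [LHS]/= nth_behead (subSn h).
Qed.

(** A halted machine idles by rewriting what it scans, so the clauses need no case for halting. *)
Definition trans' (q : state M) (s : {ffun 'I_(tapes_pred M).+1 -> G}) :=
  if halting q then (q, [ffun i => (s i, Stay)]) else trans q s.

Definition heads (cf : config M) : {ffun 'I_(tapes_pred M).+1 -> G} :=
  [ffun i => scanned (cf.2 i)].

Lemma step_state cf : (step cf).1 = (trans' cf.1 (heads cf)).1.
Proof. by rewrite /step /trans' /heads; case: (halting cf.1). Qed.

Lemma step_look cf c o i : let a := (trans' cf.1 (heads cf)).2 i in
  look ((step cf).2 i) c o.+1 = wr (cf.2 i) c a.1 (shd a.2 o).
Proof.
rewrite /step /trans'; case: (halting cf.1) => /=.
  by rewrite !ffunE /= /wr; case: eqP => // ->; rewrite look_scanned.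
by rewrite ffunE [X in update _ X]surjective_pairing look_update.
Qed.

Lemma iter_halting t t' cf : halting (iter t (@step M) cf).1 -> t <= t' ->
  iter t' (@step M) cf = iter t (@step M) cf.
Proof.
move=> hh ht; rewrite -(subnK ht) iterD; elim: (t' - t) => //= k ->.
by rewrite /step hh.
Qed.

End Look.

Section CookLevin.
Variables (M : TM) (sp sq : seq nat).
Notation m := (tapes_pred M).
Notation I := 'I_m.+1.
Notation G := (option (bool + aux M))%type.
Notation Q := (state M).
Notation SV := {ffun I -> G}.

(** A transition depends on all scanned symbols at once, too many for a three-literal clause; the
    index of the second kind counts the tapes already matched. The set of facts depends on the
    machine only. *)
Definition fact : finType := ('I_3 * I * G + 'I_m.+2 * Q * SV + 'I_6)%type.
Definition fsym (i : I) (a : G) : fact := inl (inl (inord 0, i, a)).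
Definition fscan (i : I) (a : G) : fact := inl (inl (inord 1, i, a)).
Definition fwrt (i : I) (a : G) : fact := inl (inl (inord 2, i, a)).
Definition fpre (j : nat) (q : Q) (s : SV) : fact := inl (inr (inord j, q, s)).
Definition fz (k : nat) : fact := inr (inord k).
Notation fctr := (fz 0).
Notation fcert := (fz 1).
Notation fnn := (fz 2).
Notation fk0 := (fz 3).
Notation fk1 := (fz 4).
Notation fk2 := (fz 5).
Definition ix (f : fact) : nat := enum_rank f.
Notation nf := #|fact|.
Definition mk dt do (f : fact) (sg : bool) : lit := (dt, do, ix f, sg).

Definition dir d := match d with Left => 0 | Stay => 1 | Right => 2 end.

(* sym: cell content relative to the head; scan: scanned symbol; wrt: content *)
(* after writing; pre j q s: state q, and s agrees with the first j scanned   *)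
(* symbols; ctr: the scanned column; cert: the certificate area, where nn, k0 *)
(* and k1 announce a certificate bit and k2 its end.                          *)
Definition rulesAt (z : I * G * (Q * SV * SV)) : seq rule :=
  let: (i, a, (q, s, s')) := z in
  let act := (trans' q s).2 i in
  let P f := mk 0 0 f true in let N f := mk 0 0 f false in
  [:: (N fctr, N (fsym i a), P (fscan i a));
      (N (fscan i a), N (fscan i a), mk 0 1 (fscan i a) true);
      (mk 0 1 (fscan i a) false, mk 0 1 (fscan i a) false, P (fscan i a));
      (N (fpre i q s), N (fscan i (s i)), P (fpre i.+1 q s));
      (N (fpre m.+1 q s), N (fpre m.+1 q s), mk 1 0 (fpre 0 (trans' q s).1 s') true);
      (N fctr, N (fpre m.+1 q s), P (fwrt i act.1));
      (P fctr, N (fsym i a), P (fwrt i a));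
      (mk 0 1 (fpre m.+1 q s) false, mk 0 (dir act.2) (fwrt i a) false, mk 1 1 (fsym i a) true);
      (N fcert, P fk2, P fnn);
      (N fnn, P fk0, P fk1);
      (N fk0, N fk0, P (if i == 1 :> nat then fsym i (Some (inl false)) else fk0));
      (N fk1, N fk1, P (if i == 1 :> nat then fsym i (Some (inl true)) else fk1));
      (N fk2, N fk2, P (if i == 1 :> nat then fsym i None else fk2));
      (N fk2, N fk2, mk 0 1 fk2 true)].

Definition rules : seq rule := flatten [seq rulesAt z | z <- enum {: I * G * (Q * SV * SV)}].

Lemma rules_ok : all (okf nf) rules.
Proof.
apply/allP=> r /flattenP[_ /mapP[[[i a] [[q s] s']] _ ->]] hr.
have hix f : ix f < nf by apply: ltn_ord.
by move: hr; rewrite /= !inE; repeat (case/orP=> [/eqP ->|]); try move/eqP ->;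
  rewrite /okf /lf /= !hix.
Qed.

Definition Bn n := hrec sq n.
Definition Tn n := hrec sp (n + Bn n).
(** The column of the heads. The border of the grid spoils one more column per step, and more than
    [Tn] columns on either side keep it away from the heads; the input and the certificate fit to
    the right. *)
Definition Cn n := Tn n + n + Bn n + 1.
Definition Hn n := Tn n + 1.
Definition Wn n := 2 * Cn n + 1.

Definition tB := polyT sq (TVar 0).
Definition tT_ := polyT sp (TAdd (TVar 0) tB).
Definition tC := TAdd (TAdd (TAdd tT_ (TVar 0)) tB) (TC 1).
Definition tHn := TAdd tT_ (TC 1).
Definition tWn := TAdd (TMul (TC 2) tC) (TC 1).

Lemma tBE n env : evT (n :: env) tB = Bn n. Proof. by rewrite polyTE. Qed.
Lemma tTE n env : evT (n :: env) tT_ = Tn n. Proof. by rewrite polyTE /= tBE. Qed.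
Lemma tCE n env : evT (n :: env) tC = Cn n. Proof. by rewrite /= tBE tTE. Qed.
Lemma tHE n env : evT (n :: env) tHn = Hn n. Proof. by rewrite /= tTE. Qed.
Lemma tWE n env : evT (n :: env) tWn = Wn n.
Proof. by rewrite [LHS]/(2 * evT (n :: env) tC + 1) tCE. Qed.

(** On tape 1 only the part left of the head is forced to be blank; the certificate to its right is
    free but ends within [Bn] cells. Acceptance is imposed negatively: at time [Tn], no symbol but
    the bit [true] is allowed in the head column of tape 0. *)
Definition frcM (x : seq bool) (sg : bool) (t o : nat) (f : fact) : bool :=
  let n := size x in let c := Cn n in
  if sg then match f with
    | inl (inl (z, i, a)) => [&& val z == 0, t == 0 &
        if val i == 0 then (if o < c then a == None else
           if o < c + n then a == Some (inl (nth false x (o - c))) else a == None)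
        else if val i == 1 then (o < c) && (a == None) else a == None]
    | inl (inr (j, q, s)) => [&& t == 0, val j == 0 & q == start M]
    | inr z => [|| (val z == 0) && (o == c), [&& val z == 1, t == 0 & c <= o] |
                   [&& val z == 5, t == 0 & c + Bn n <= o]]
    end
  else match f with
    | inl (inl (z, i, a)) =>
        [&& val z == 0, val i == 0, a != Some (inl true), t == Tn n & o == c]
    | inl (inr _) => false
    | inr z => (val z == 0) && (o != c)
    end.

Definition FB (b : bool) := if b then FT else FF.
Definition frcFM (sg : bool) (f : fact) : fof :=
  let t := TVar 7 in let o := TVar 8 in
  if sg then match f with
    | inl (inl (z, i, a)) => FAnd (FB (val z == 0)) (FAnd (FEq t (TC 0))
        (if val i == 0 then
           FOr (FAnd (FLt o tC) (FB (a == None))) (FAnd (FLe tC o)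
             (FOr (FAnd (FLt o (TAdd tC (TVar 0)))
                     (match a with Some (inl b) =>
                        if b then FBit false (TSub o tC) else FNot (FBit false (TSub o tC))
                      | _ => FF end))
                  (FAnd (FLe (TAdd tC (TVar 0)) o) (FB (a == None)))))
        else if val i == 1 then FAnd (FLt o tC) (FB (a == None)) else FB (a == None)))
    | inl (inr (j, q, s)) => FAnd (FEq t (TC 0)) (FB ((val j == 0) && (q == start M)))
    | inr z => FOr (FAnd (FB (val z == 0)) (FEq o tC))
         (FOr (FAnd (FB (val z == 1)) (FAnd (FEq t (TC 0)) (FLe tC o)))
              (FAnd (FB (val z == 5)) (FAnd (FEq t (TC 0)) (FLe (TAdd tC tB) o))))
    end
  else match f with
    | inl (inl (z, i, a)) => FAnd (FB [&& val z == 0, val i == 0 & a != Some (inl true)])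
        (FAnd (FEq t tT_) (FEq o tC))
    | inl (inr _) => FF
    | inr z => FAnd (FB (val z == 0)) (FNot (FEq o tC))
    end.

Definition frc (x : seq bool) (sg : bool) (t o f : nat) : bool :=
  if insub f is Some i then frcM x sg t o (enum_val (i : 'I_nf)) else false.
Definition frcF (sg : bool) (f : nat) : fof :=
  if insub f is Some i then frcFM sg (enum_val (i : 'I_nf)) else FF.

Lemma ev_FB x u env b : evF x u env (FB b) = b. Proof. by case: b. Qed.

Lemma frcFE x sg f p i j b b' t o :
  evF x [::] [:: size x; 0; p; i; j; b; b'; t; o] (frcF sg f) = frc x sg t o f.
Proof.
rewrite /frcF /frc; case: insub => [k|] //; move: (enum_val k) => {k f} f.
set env := [:: _, _ & _].
have ec : evT env tC = Cn (size x) by exact: tCE.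
have eb : evT env tB = Bn (size x) by exact: tBE.
have et : evT env tT_ = Tn (size x) by exact: tTE.
have e7 : evT env (TVar 7) = t by [].
have e8 : evT env (TVar 8) = o by [].
have e0 : evT env (TVar 0) = size x by [].
have eC k : evT env (TC k) = k by [].
have ea y z : evT env (TAdd y z) = evT env y + evT env z by [].
have es y z : evT env (TSub y z) = evT env y - evT env z by [].
case: sg; case: f => [[[[z k] a]|[[z q] s]]|z]; rewrite /frcFM /frcM; cbv beta iota zeta.
- rewrite ev_and ev_FB ev_and ev_eq e7 eC; congr [&& _, _ & _].
  case: ifP => _; last by case: ifP => _; rewrite ?ev_and ?ev_lt ev_FB ?e8 ?ec.
  rewrite ev_or ev_and ev_lt ev_FB ev_and ev_le ev_or ev_and ev_lt ev_and ev_le ev_FB ea e8 ec e0.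
  case: (ltnP o (Cn _)) => _; first by rewrite andTb andFb orbF.
  case: (ltnP o (Cn _ + _)) => _; last by rewrite andFb andTb.
  rewrite !andFb !andTb orFb orbF.
  have eB : evF x [::] env (FBit false (TSub (TVar 8) tC)) = nth false x (o - Cn (size x)).
    by rewrite -ec.
  by case: a => [[[]|]|] //; rewrite ?ev_not eB; case: nth.
- by rewrite ev_and ev_eq ev_FB e7 eC.
- rewrite ev_or ev_and ev_FB ev_eq ev_or ev_and ev_FB ev_and ev_eq ev_le.
  by rewrite ev_and ev_FB ev_and ev_eq ev_le ea e7 e8 ec eb eC.
- rewrite ev_and ev_FB ev_and !ev_eq e7 e8 et ec.
  by rewrite -!andbA.
- by [].
- by rewrite ev_and ev_FB ev_not ev_eq e8 ec.
Qed.

Section Word.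
Variable x : seq bool.
Notation n := (size x).
Notation c := (Cn n).
Notation T := (Tn n).

Definition run u t := iter t (@step M) (init M [:: x; u]).

Lemma look_init u i o : look ((run u 0).2 i) c o =
  if o < c then None else nth None [seq Some (inl b) | b <- nth [::] [:: x; u] i] (o - c).
Proof. by rewrite /look /= ffunE /= nth_nil. Qed.

Definition tv (u : seq bool) (t o : nat) (f : fact) : bool :=
  let cf := run u t in
  let ins := (t == 0) && (c <= o < c + size u) in
  match f with
  | inl (inl (z, i, a)) =>
      if val z == 0 then look (cf.2 i) c o == a
      else if val z == 1 then heads cf i == a
      else wr (cf.2 i) c ((trans' cf.1 (heads cf)).2 i).1 o == a
  | inl (inr (j, q, s)) => (cf.1 == q) && [forall i : I, (i < j) ==> (s i == heads cf i)]
  | inr z => match val z with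
     | 0 => o == c
     | 1 => (t == 0) && (c <= o)
     | 2 => ins
     | 3 => ins && ~~ nth false u (o - c)
     | 4 => ins && nth false u (o - c)
     | _ => (t == 0) && (c + size u <= o)
     end
  end.

Lemma complete u : size u <= Bn n -> scanned ((run u T).2 ord0) = Some (inl true) ->
  exists A, sat nf rules (Hn n) (Wn n) (frc x) A.
Proof.
move=> hu hacc.
pose A t o f := if insub f is Some i then tv u t o (enum_val (i : 'I_nf)) else false.
have AE t o f : A t o (ix f) = tv u t o f by rewrite /A /ix valK enum_rankK.
have i0 : val (inord 0 : 'I_3) = 0 by rewrite /= inordK.
have i1 : val (inord 1 : 'I_3) = 1 by rewrite /= inordK.
have i2 : val (inord 2 : 'I_3) = 2 by rewrite /= inordK.
have iz k : k < 6 -> val (inord k : 'I_6) = k by move=> h; rewrite /= inordK.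
have ip k : k < m.+2 -> val (inord k : 'I_m.+2) = k by move=> h; rewrite /= inordK.
have sE t o i a : tv u t o (fsym i a) = (look ((run u t).2 i) c o == a) by rewrite /tv /fsym i0.
have cE t o i a : tv u t o (fscan i a) = (heads (run u t) i == a) by rewrite /tv /fscan i1.
have wE t o i a : tv u t o (fwrt i a) =
   (wr ((run u t).2 i) c ((trans' (run u t).1 (heads (run u t))).2 i).1 o == a) by rewrite /tv /fwrt i2.
have pE t o j q s : j < m.+2 -> tv u t o (fpre j q s) =
   ((run u t).1 == q) && [forall i : I, (i < j) ==> (s i == heads (run u t) i)].
  by move=> hj; rewrite /tv /fpre; congr andb; apply: eq_forallb => k; rewrite ip.
have pT t o q s : tv u t o (fpre m.+1 q s) -> (run u t).1 = q /\ heads (run u t) = s.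
  rewrite pE // => /andP[/eqP -> /forallP h]; split=> //; apply/ffunP=> k.
  by have := h k; rewrite ltn_ord => /eqP ->.
have z0 t o : tv u t o fctr = (o == c) by rewrite /tv /fz iz.
have z1 t o : tv u t o fcert = (t == 0) && (c <= o) by rewrite /tv /fz iz.
have z2 t o : tv u t o fnn = (t == 0) && (c <= o < c + size u) by rewrite /tv /fz iz.
have z3 t o : tv u t o fk0 = (t == 0) && (c <= o < c + size u) && ~~ nth false u (o - c) by rewrite /tv /fz iz.
have z4 t o : tv u t o fk1 = (t == 0) && (c <= o < c + size u) && nth false u (o - c) by rewrite /tv /fz iz.
have z5 t o : tv u t o fk2 = (t == 0) && (c + size u <= o) by rewrite /tv /fz iz.
exists A; split; last first.
  move=> sg t o f _ _ hf; rewrite /frc /A insubT /=.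
  move: (enum_val _) => {hf f} f; case: sg; case: f => [[[[z k] a]|[[z q] s]]|z] /=.
  - case/and3P=> /eqP -> /eqP ->; rewrite eqxx look_init.
    case: k => [[|[|k]] hk] /=.
    + case: ltnP => // h1; first by move/eqP ->.
      case: ltnP => h2 /eqP ->; first by rewrite (nth_map false) ?eqxx //; lia.
      by rewrite nth_default ?size_map //; lia.
    + by case/andP=> -> /eqP ->.
    + by move/eqP ->; rewrite !nth_nil /= ?nth_nil; case: ifP.
  - case/and3P=> /eqP -> /eqP hz /eqP ->; rewrite /= eqxx /=.
    by apply/forallP=> i; rewrite hz.
  - case/or3P.
    + by case/andP=> /eqP -> /eqP ->; rewrite eqxx.
    + by case/and3P=> /eqP -> /eqP -> ->.
    + by case/and3P=> /eqP -> /eqP -> h /=; lia.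
  - case/and5P=> /eqP -> /eqP hk ha /eqP -> /eqP ->; rewrite eqxx look_scanned.
    have -> : k = ord0 by apply: val_inj.
    by rewrite hacc; apply/negbTE; rewrite eq_sym.
  - by [].
  - by case/andP=> /eqP -> /negbTE ->.
move=> t o r ht ho /flattenP[_ /mapP[[[i a] [[q s] s']] _ ->]] hr _ _ _.
have imp (b1 b2 b3 : bool) : (b1 -> b2 -> b3) -> [|| b1 == false, b2 == false | b3 == true].
  by case: b1; case: b2; case: b3 => // h; apply: h.
have key (r0 : rule) : r = r0 -> [|| holds A t o (l0 r0), holds A t o (l1 r0) | holds A t o (l2 r0)] ->
   [|| holds A t o (l0 r), holds A t o (l1 r) | holds A t o (l2 r)] by move=> ->.
move: hr; rewrite /rulesAt !inE /=.
case/orP=> [/eqP/key|]; first apply.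
  rewrite /holds /= !AE !addn0; apply: imp; rewrite z0 sE cE => /eqP -> /eqP <-.
  by rewrite look_scanned ffunE.
case/orP=> [/eqP/key|]; first apply.
  by rewrite /holds /= !AE !addn0; apply: imp; rewrite !cE.
case/orP=> [/eqP/key|]; first apply.
  by rewrite /holds /= !AE !addn0; apply: imp; rewrite !cE.
case/orP=> [/eqP/key|]; first apply.
  rewrite /holds /= !AE !addn0; apply: imp; rewrite cE !pE; try by have := ltn_ord i; lia.
  move=> /andP[-> /forallP h] /eqP h2; apply/forallP=> k; apply/implyP.
  rewrite ltnS leq_eqVlt => /orP[/eqP/val_inj ->|hk]; first by rewrite h2.
  by have := h k; rewrite hk.
case/orP=> [/eqP/key|]; first apply.
  rewrite /holds /= !AE !addn0 addn1; apply: imp => /pT[h1 h2] _; rewrite pE //.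
  rewrite [run u t.+1]iterS step_state -/(run u t) h1 h2 eqxx.
  by apply/forallP=> k.
case/orP=> [/eqP/key|]; first apply.
  rewrite /holds /= !AE !addn0; apply: imp; rewrite z0 wE => /eqP -> /pT[-> ->].
  by rewrite /wr eqxx.
case/orP=> [/eqP/key|]; first apply.
  rewrite /holds /= !AE !addn0 z0 sE wE /wr.
  by case: (o == c) => //=; case: (look _ _ _ == a).
case/orP=> [/eqP/key|]; first apply.
  rewrite /holds /= !AE !addn0 !addn1; apply: imp => /pT[h1 h2]; rewrite wE sE.
  rewrite [run u t.+1]iterS -/(run u t) step_look h1 h2 => /eqP <-.
  by case: ((trans' q s).2 i).2; rewrite /= ?addn0 ?addn1 ?addn2.
case/orP=> [/eqP/key|]; first apply.
  rewrite /holds /= !AE !addn0 z1 z2 z5; case: (t == 0) => //=.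
  by case: (leqP c o) => //= _; case: leqP.
case/orP=> [/eqP/key|]; first apply.
  by rewrite /holds /= !AE !addn0 z2 z3 z4; case: (_ && _) => //=; case: nth.
case/orP=> [/eqP/key|]; first apply.
  rewrite /holds /= !AE !addn0; apply: imp; case: eqP => // hi.
  rewrite z3 sE => /andP[/andP[/eqP -> /andP[h1 h2]] /negbTE h3] _; rewrite look_init ltnNge h1 hi /=.
  by rewrite (nth_map false) ?h3 //; lia.
case/orP=> [/eqP/key|]; first apply.
  rewrite /holds /= !AE !addn0; apply: imp; case: eqP => // hi.
  rewrite z4 sE => /andP[/andP[/eqP -> /andP[h1 h2]] h3] _; rewrite look_init ltnNge h1 hi /=.
  by rewrite (nth_map false) ?h3 //; lia.
case/orP=> [/eqP/key|]; first apply.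
  rewrite /holds /= !AE !addn0; apply: imp; case: eqP => // hi.
  rewrite z5 sE => /andP[/eqP -> h1] _; rewrite look_init hi /=.
  by rewrite nth_default ?size_map; [case: ifP|lia].
move/eqP/key; apply.
rewrite /holds /= !AE !addn0 addn1; apply: imp; rewrite !z5 => /andP[-> h] _ /=; lia.
Qed.

(** [A] may contain spurious facts. It is only shown that the facts of the genuine run for [u] are
    among them, and the prohibition at time [Tn] then excludes rejection. *)
Lemma sound A : sat nf rules (Hn n) (Wn n) (frc x) A ->
  exists u, size u <= Bn n /\ scanned ((run u T).2 ord0) = Some (inl true).
Proof.
move=> [hA hF].
have hc : T < c by rewrite /Cn; lia.
have cB : c + Bn n < Wn n by rewrite /Wn /Cn; lia.
have cW : c < Wn n by rewrite /Wn; lia.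
have HT t : t <= T -> t < Hn n by rewrite /Hn; lia.
have frcI sg t o f : frcM x sg t o f -> t < Hn n -> o < Wn n -> A t o (ix f) = sg.
  move=> h ht ho; apply: hF => //; first exact: ltn_ord.
  by rewrite /frc /ix valK enum_rankK.
have rin z k : k < 14 -> nth rule0 (rulesAt z) k \in rules.
  move=> hk; apply/flattenP; exists (rulesAt z); first by apply: map_f; rewrite mem_enum.
  by apply: mem_nth; case: z => [[i a] [[q s] s']].
have or3 (b1 b2 b3 : bool) : [|| b1 == false, b2 == false | b3 == true] -> b1 -> b2 -> b3.
  by case: b1; case: b2; case: b3.
pose q0 := start M; pose s0 : SV := [ffun=> None].
have f0 t o i b : t < Hn n -> o < Wn n -> A t o (ix fctr) -> A t o (ix (fsym i b)) ->
    A t o (ix (fscan i b)).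
  move=> ht ho; have := hA t o _ ht ho (rin (i, b, (q0, s0, s0)) 0 isT).
  by rewrite /inr_ /holds /= !addn0 ht ho => /(_ isT isT isT); apply: or3.
have f1 t o i b : t < Hn n -> o.+1 < Wn n -> A t o (ix (fscan i b)) -> A t o.+1 (ix (fscan i b)).
  move=> ht ho1; have ho := ltnW ho1; have := hA t o _ ht ho (rin (i, b, (q0, s0, s0)) 1 isT).
  by rewrite /inr_ /holds /= !addn0 addn1 ht ho ho1 => /(_ isT isT isT) /or3 h h1; apply: h.
have f2 t o i b : t < Hn n -> o.+1 < Wn n -> A t o.+1 (ix (fscan i b)) -> A t o (ix (fscan i b)).
  move=> ht ho1; have ho := ltnW ho1; have := hA t o _ ht ho (rin (i, b, (q0, s0, s0)) 2 isT).
  by rewrite /inr_ /holds /= !addn0 addn1 ht ho ho1 => /(_ isT isT isT) /or3 h h1; apply: h.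
have f3 t o (i : I) q s : t < Hn n -> o < Wn n -> A t o (ix (fpre i q s)) ->
    A t o (ix (fscan i (s i))) -> A t o (ix (fpre i.+1 q s)).
  move=> ht ho; have := hA t o _ ht ho (rin (i, None, (q, s, s0)) 3 isT).
  by rewrite /inr_ /holds /= !addn0 ht ho => /(_ isT isT isT); apply: or3.
have f4 t o q s s' : t.+1 < Hn n -> o < Wn n -> A t o (ix (fpre m.+1 q s)) ->
    A t.+1 o (ix (fpre 0 (trans' q s).1 s')).
  move=> ht1 ho; have ht := ltnW ht1; have := hA t o _ ht ho (rin (ord0, None, (q, s, s')) 4 isT).
  by rewrite /inr_ /holds /= !addn0 addn1 ht ho ht1 => /(_ isT isT isT) /or3 h h1; apply: h.
have f5 t o i q s : t < Hn n -> o < Wn n -> A t o (ix fctr) -> A t o (ix (fpre m.+1 q s)) ->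
    A t o (ix (fwrt i ((trans' q s).2 i).1)).
  move=> ht ho; have := hA t o _ ht ho (rin (i, None, (q, s, s0)) 5 isT).
  by rewrite /inr_ /holds /= !addn0 ht ho => /(_ isT isT isT); apply: or3.
have f6 t o i b : t < Hn n -> o < Wn n -> A t o (ix fctr) = false -> A t o (ix (fsym i b)) ->
    A t o (ix (fwrt i b)).
  move=> ht ho h1 h2; have := hA t o _ ht ho (rin (i, b, (q0, s0, s0)) 6 isT).
  by rewrite /inr_ /holds /= !addn0 ht ho h1 h2 => /(_ isT isT isT) /= /eqP.
have f7 t o i b q s : t.+1 < Hn n -> o.+2 < Wn n -> A t o.+1 (ix (fpre m.+1 q s)) ->
    A t (o + dir ((trans' q s).2 i).2) (ix (fwrt i b)) -> A t.+1 o.+1 (ix (fsym i b)).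
  move=> ht1 ho2; have ht := ltnW ht1; have ho1 := ltnW ho2; have ho := ltnW ho1.
  have hd : o + dir ((trans' q s).2 i).2 < Wn n by case: (_.2); rewrite /= ?addn0 ?addn1 ?addn2.
  have := hA t o _ ht ho (rin (i, b, (q, s, s0)) 7 isT).
  by rewrite /inr_ /holds /= !addn0 !addn1 ht ht1 ho1 hd => /(_ isT isT isT); apply: or3.
have f8 t o : t < Hn n -> o < Wn n -> A t o (ix fcert) -> A t o (ix fk2) = false -> A t o (ix fnn).
  move=> ht ho h1 h2; have := hA t o _ ht ho (rin (ord0, None, (q0, s0, s0)) 8 isT).
  by rewrite /inr_ /holds /= !addn0 ht ho h1 h2 => /(_ isT isT isT) /= /eqP.
have f9 t o : t < Hn n -> o < Wn n -> A t o (ix fnn) -> A t o (ix fk1) = false -> A t o (ix fk0).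
  move=> ht ho h1 h2; have := hA t o _ ht ho (rin (ord0, None, (q0, s0, s0)) 9 isT).
  by rewrite /inr_ /holds /= !addn0 ht ho h1 h2 orbF => /(_ isT isT isT) /= /eqP.
have f10 t o (i : I) : t < Hn n -> o < Wn n -> i = 1 :> nat -> A t o (ix fk0) ->
    A t o (ix (fsym i (Some (inl false)))).
  move=> ht ho hi; have := hA t o _ ht ho (rin (i, None, (q0, s0, s0)) 10 isT).
  by rewrite /inr_ /holds /= hi eqxx !addn0 ht ho => /(_ isT isT isT) /or3 h h1; apply: h.
have f11 t o (i : I) : t < Hn n -> o < Wn n -> i = 1 :> nat -> A t o (ix fk1) ->
    A t o (ix (fsym i (Some (inl true)))).
  move=> ht ho hi; have := hA t o _ ht ho (rin (i, None, (q0, s0, s0)) 11 isT).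
  by rewrite /inr_ /holds /= hi eqxx !addn0 ht ho => /(_ isT isT isT) /or3 h h1; apply: h.
have f12 t o (i : I) : t < Hn n -> o < Wn n -> i = 1 :> nat -> A t o (ix fk2) ->
    A t o (ix (fsym i None)).
  move=> ht ho hi; have := hA t o _ ht ho (rin (i, None, (q0, s0, s0)) 12 isT).
  by rewrite /inr_ /holds /= hi eqxx !addn0 ht ho => /(_ isT isT isT) /or3 h h1; apply: h.
have f13 t o : t < Hn n -> o.+1 < Wn n -> A t o (ix fk2) -> A t o.+1 (ix fk2).
  move=> ht ho1; have ho := ltnW ho1; have := hA t o _ ht ho (rin (ord0, None, (q0, s0, s0)) 13 isT).
  by rewrite /inr_ /holds /= !addn0 addn1 ht ho ho1 => /(_ isT isT isT) /or3 h h1; apply: h.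
have i3 k : k < 3 -> nat_of_ord (inord k : 'I_3) = k by move=> h; rewrite inordK.
have iz k : k < 6 -> nat_of_ord (inord k : 'I_6) = k by move=> h; rewrite inordK.
have ctrT t : t < Hn n -> A t c (ix fctr).
  by move=> ht; apply: (frcI true) => //; rewrite /frcM /fz /= iz // !eqxx.
have ctrF t o : t < Hn n -> o < Wn n -> o != c -> A t o (ix fctr) = false.
  by move=> ht ho h; apply: (frcI false) => //; rewrite /frcM /fz /= iz.
have kB : A 0 (c + Bn n) (ix fk2).
  by apply: (frcI true); rewrite ?HT // /frcM /fz /= iz // leqnn orbT.
(* The certificate ends at the first end marker; one is forced at distance [Bn]. *)
case: (ex_minnP (ex_intro (fun j => A 0 (c + j) (ix fk2)) _ kB)) => js hjs hmin.
have jsB : js <= Bn n by apply: hmin.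
pose u := mkseq (fun j => A 0 (c + j) (ix fk1)) js.
have su : size u = js by rewrite size_mkseq.
exists u; split; first by rewrite su.
have k2 j : c + (js + j) < Wn n -> A 0 (c + (js + j)) (ix fk2).
  elim: j => [|j ih]; first by rewrite addn0.
  by rewrite !addnS => h; apply: f13 => //; [apply: HT|apply: ih; apply: ltnW].
have base i o : o < Wn n -> A 0 o (ix (fsym i (look ((run u 0).2 i) c o))).
  move=> ho; rewrite look_init; have H0 : 0 < Hn n by apply: HT.
  case/boolP: ((i == 1 :> nat) && (c <= o)) => [/andP[/eqP hi hco]|hn].
    rewrite ltnNge hco hi /=; have eo : o = c + (o - c) by lia.
    have [hj|hj] := ltnP (o - c) js; last first.
      rewrite nth_default; last by rewrite size_map su.
      apply: f12 => //.
      by rewrite eo -(subnKC hj); apply: k2; rewrite subnKC // -eo.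
    have nk2 : A 0 o (ix fk2) = false.
      by apply/negbTE/negP => h; have := hmin (o - c); rewrite -eo h leqNgt hj => /(_ isT).
    have hnn : A 0 o (ix fnn).
      apply: f8 => //; apply: (frcI true) => //.
      by rewrite /frcM /fz /= iz //= hco.
    rewrite (nth_map false) ?su // nth_mkseq // -eo.
    by case hk1: (A 0 o (ix fk1)); [apply: f11|apply: f10 => //; apply: f9].
  apply: (frcI true) => //; rewrite /frcM /fsym /= i3 //=.
  case: i hn => [[|[|k]] hk] /=.
  - case: ltnP => h1 _ //; case: ltnP => h2; last by rewrite nth_default ?size_map //; lia.
    by rewrite (nth_map false) ?eqxx //; lia.
  - by rewrite -ltnNge => ->.
  - by rewrite !nth_nil /= ?nth_nil; case: ifP.
(* The state is known in all columns, the contents only in a window that shrinks by a column on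
   either side per step. *)
have main t : t <= T -> (forall o s, o < Wn n -> A t o (ix (fpre 0 (run u t).1 s))) /\
    (forall i o, t <= o <= 2 * c - t -> A t o (ix (fsym i (look ((run u t).2 i) c o)))).
  elim: t => [|t ih] ht.
    split=> [o s ho|i o ho]; last by apply: base; rewrite /Wn; lia.
    apply: (frcI true); rewrite ?HT // /frcM /fpre /=.
    by rewrite inordK // !eqxx.
  have [ha hb] := ih (ltnW ht); have ht' := HT _ (ltnW ht); have ht1 := HT _ ht.
  set cf := run u t in ha hb; have hS : run u t.+1 = step cf by [].
  (* The scanned symbol is read off in column [c] and spreads along the row in both directions. *)
  have hscan i o : o < Wn n -> A t o (ix (fscan i (heads cf i))).
    have h0 : A t c (ix (fscan i (heads cf i))).
      apply: f0 => //; first exact: ctrT.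
      by have := hb i c; rewrite look_scanned ffunE; apply; lia.
    have hR j : c + j < Wn n -> A t (c + j) (ix (fscan i (heads cf i))).
      elim: j => [|j ihj]; first by rewrite addn0.
      by rewrite addnS => h; apply: f1 => //; apply: ihj; apply: ltnW.
    have hL j : j <= c -> A t (c - j) (ix (fscan i (heads cf i))).
      elim: j => [|j ihj] hj; first by rewrite subn0.
      apply: f2 => //; first by lia.
      by rewrite -subSn // subSS; apply: ihj; apply: ltnW.
    move=> ho; case: (leqP c o) => h; first by rewrite -(subnKC h); apply: hR; rewrite subnKC.
    by rewrite -(subKn (ltnW h)); apply: hL; apply: leq_subr.
  have hpre o j : o < Wn n -> j <= m.+1 -> A t o (ix (fpre j cf.1 (heads cf))).
    move=> ho; elim: j => [|j ihj] hj; first exact: ha.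
    apply: (f3 t o (Ordinal hj)) => //; first by apply: ihj; apply: ltnW.
    exact: hscan.
  set tr := trans' cf.1 (heads cf).
  have hwr i o : t <= o <= 2 * c - t -> A t o (ix (fwrt i (wr (cf.2 i) c (tr.2 i).1 o))).
    move=> ho; have ho' : o < Wn n by rewrite /Wn; lia.
    rewrite /wr; case: (eqVneq o c) => [->|hne].
      by apply: f5 => //; [apply: ctrT|apply: hpre].
    by apply: f6 => //; [apply: ctrF|apply: hb].
  split=> [o s ho|i o ho].
    by rewrite hS step_state; apply: f4 => //; apply: hpre.
  case: o ho => [|o] ho; first by lia.
  rewrite hS step_look -/tr; apply: (f7 t o i _ cf.1 (heads cf)) => //.
  - by rewrite /Wn; lia.
  - by apply: hpre => //; rewrite /Wn; lia.
  rewrite -/tr; have -> : o + dir (tr.2 i).2 = shd (tr.2 i).2 o.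
    by case: (_.2); rewrite /= ?addn0 ?addn1 ?addn2.
  by apply: hwr; case: (_.2); rewrite /=; lia.
have [_ hb] := main T (leqnn T).
have := hb ord0 c; rewrite look_scanned => h.
have {}h : A T c (ix (fsym ord0 (scanned ((run u T).2 ord0)))) by apply: h; lia.
apply/eqP; apply: contraT => hne.
have := frcI false T c (fsym ord0 (scanned ((run u T).2 ord0))).
rewrite h /frcM /fsym /= i3 //= hne !eqxx => hh; by have := hh isT (HT _ (leqnn _)) cW.
Qed.

End Word.
End CookLevin.

(** It lets the clauses test acceptance on the scanned cell of tape 0 alone. *)
Lemma read_bits1 (M : TM) (s : seq (option (bool + aux M))) b :
  @read_bits M s = [:: b] -> b = (head None s == Some (inl true)).
Proof. by case: s => [|[[b'|s']|] s] //= [<- _]; case: b'. Qed.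

Theorem diomega_hard k : 3 <= k -> NP_hard (diomega_ordering k).
Proof.
move=> hk L [R [q [[M [p hM]] hL]]].
apply: (grid_reducible (rules_ok M) (tHE p q) (tWE p q) (@frcFE M p q) hk) => x.
have acc u : size u <= Bn q (size x) ->
    R x u = (scanned ((run M x u (Tn p q (size x))).2 ord0) == Some (inl true)).
  move=> hu; have [] := hM x u; rewrite horner_hrec => hh ho.
  (* The grid height uses the longest admissible certificate; shorter ones halt earlier, by
     monotonicity, and then wait. *)
  rewrite /run (iter_halting hh); last by apply: hrec_mono; rewrite leq_add2l.
  exact: read_bits1 ho.
rewrite hL; split=> [[u [hu hR]]|[A hA]]; last have [u [hu hs]] := sound hA.
  rewrite horner_hrec in hu; apply: (@complete M p q x u) => //.
  by apply/eqP; rewrite -acc.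
by exists u; rewrite horner_hrec acc // hs.
Qed.

(** * Membership in NP *)


Lemma order_rank (V : finType) (r : rel V) : irreflexive r -> transitive r ->
  (forall a b, a != b -> r a b || r b a) ->
  exists g : V -> nat, injective g /\ forall a b, r a b = (g a < g b).
Proof.
move=> hi ht hc; pose g v := #|[set w | r w v]|.
have hlt a b : r a b -> g a < g b.
  move=> hab; apply: proper_card; apply/properP; split.
    by apply/subsetP=> w; rewrite !inE => hw; apply: ht hab.
  by exists a; rewrite !inE ?hi.
have hg : injective g.
  move=> a b hab; apply/eqP; apply: contraT => /hc /orP[] /hlt; by rewrite hab ltnn.
exists g; split=> // a b; apply/idP/idP => [/hlt //|hab].
have /hc/orP[//|/hlt] : a != b by apply: contraTneq hab => ->; rewrite ltnn.
by move=> hba; have := ltn_trans hab hba; rewrite ltnn.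
Qed.

Section Membership.
Variable k : nat.
Notation v := TVar.

Definition posT a b := TAdd (TMul (v a) (v 2)) (v b).
Definition xF a b := FBit false (posT a b).
Definition uF a b := FBit true (posT a b).
Definition FAnds (l : seq fof) := foldr FAnd FT l.

Definition pairF := FAll (v 2) (FAll (v 2) (FAnd
  (FOr (FNot (FEq (v 3) (v 4))) (FAnd (FNot (xF 3 4)) (FNot (uF 3 4))))
  (FOr (FEq (v 3) (v 4)) (FAnd (FOr (FAnd (xF 3 4) (FNot (xF 4 3))) (FAnd (FNot (xF 3 4)) (xF 4 3)))
                               (FOr (uF 3 4) (uF 4 3)))))).
Definition transF := FAll (v 2) (FAll (v 2) (FAll (v 2)
  (FOr (FNot (FAnd (uF 3 4) (uF 4 5))) (uF 3 5)))).
Definition beKF a b := FOr (FAnd (uF a b) (xF b a)) (FAnd (uF b a) (xF a b)).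
Definition cliqueF := FAnds [seq FAnds [seq if a == b then FT else
   FAnd (FNot (FEq (v (3 + a)) (v (3 + b)))) (beKF (3 + a) (3 + b)) | b <- iota 0 k.+1] |
   a <- iota 0 k.+1].
(** The number of vertices is found by search, as [n <= n * n] keeps it within the word length.
    Since [k] is fixed, [k + 1] nested quantifiers can look for a large clique. *)
Definition memF := FEx (TAdd (v 0) (TC 1)) (FAnd (FEq (v 0) (TMul (v 2) (v 2)))
  (FAnd pairF (FAnd transF (FNot (iter k.+1 (FEx (v 2)) cliqueF))))).

Lemma ev_ands x u env l : evF x u env (FAnds l) = all (evF x u env) l.
Proof. by elim: l => //= f l ->. Qed.

Lemma ev_exN x u n m f env : 2 < size env -> nth 0 env 2 = n ->
  evF x u env (iter m (FEx (v 2)) f) <->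
  exists s, [/\ size s = m, all (ltn^~ n) s & evF x u (env ++ s) f].
Proof.
elim: m env => [|m ih] env hs hn.
  split=> [h|[[|a s] [//]]]; last by rewrite cats0.
  by exists [::]; rewrite cats0.
rewrite iterS ev_ex [evT _ _]/= hn; split.
  case/hasP=> w; rewrite mem_iota add0n => /andP[_ hw].
  case/ih; rewrite ?size_rcons ?nth_rcons ?hs //; first by lia.
  by move=> s [h1 h2 h3]; exists (w :: s); rewrite -cat_rcons /= h1 h2 hw.
move=> [[|w s] [//= h1 hall h4]]; case: h1 => h1; case/andP: hall => h2 h3.
apply/hasP; exists w.
  by rewrite mem_iota add0n.
apply/ih; rewrite ?size_rcons ?nth_rcons ?hs //; first by lia.
by exists s; rewrite cat_rcons.
Qed.

Section At.
Variables (x u : seq bool) (n : nat).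
Notation X a b := (nth false x (a * n + b)).
Notation O a b := (nth false u (a * n + b)).
Notation env := [:: size x; size u; n].

Lemma pairFE : evF x u env pairF <-> forall a b, a < n -> b < n ->
  if a == b then ~~ X a b && ~~ O a b else (X a b == ~~ X b a) && (O a b || O b a).
Proof.
have e a b : evF x u [:: size x; size u; n; a; b] (FAnd
  (FOr (FNot (FEq (v 3) (v 4))) (FAnd (FNot (xF 3 4)) (FNot (uF 3 4))))
  (FOr (FEq (v 3) (v 4)) (FAnd (FOr (FAnd (xF 3 4) (FNot (xF 4 3))) (FAnd (FNot (xF 3 4)) (xF 4 3)))
                               (FOr (uF 3 4) (uF 4 3))))) =
  if a == b then ~~ X a b && ~~ O a b else (X a b == ~~ X b a) && (O a b || O b a).
  rewrite ev_and !ev_or !ev_not ev_eq [evT _ _]/= [evT _ _]/= /=.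
  by case: eqP => _ /=; case: (X a b); case: (X b a); case: (O a b); case: (O b a).
rewrite /pairF ev_all; split=> [/allP h a b ha hb|h].
  have := h a; rewrite mem_iota add0n ha ev_all => /(_ isT) /allP /(_ b).
  by rewrite mem_iota add0n hb => /(_ isT); rewrite [rcons _ _]/= e.
apply/allP=> a; rewrite mem_iota add0n => /andP[_ ha]; rewrite ev_all; apply/allP => b.
by rewrite mem_iota add0n => /andP[_ hb]; rewrite [rcons _ _]/= e; apply: h.
Qed.

Lemma transFE : evF x u env transF <-> forall a b c, a < n -> b < n -> c < n ->
  O a b -> O b c -> O a c.
Proof.
rewrite /transF ev_all; split=> [/allP h a b c ha hb hc|h].
  have := h a; rewrite mem_iota add0n ha ev_all => /(_ isT) /allP /(_ b).
  rewrite mem_iota add0n hb ev_all => /(_ isT) /allP /(_ c).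
  rewrite mem_iota add0n hc => /(_ isT); rewrite ev_or ev_not ev_and /=.
  by move=> h' h1 h2; move: h'; rewrite h1 h2.
apply/allP=> a; rewrite mem_iota add0n => /andP[_ ha]; rewrite ev_all; apply/allP => b.
rewrite mem_iota add0n => /andP[_ hb]; rewrite ev_all; apply/allP => c.
rewrite mem_iota add0n => /andP[_ hc]; rewrite ev_or ev_not ev_and /=.
case h1: (O a b) => //; case h2: (O b c) => //=.
exact: h h1 h2.
Qed.

Lemma cliqueFE s : size s = k.+1 -> evF x u (env ++ s) cliqueF <->
  forall a b, a < k.+1 -> b < k.+1 -> a != b ->
    let y := nth 0 s a in let z := nth 0 s b in
    y != z /\ (O y z && X z y || O z y && X y z).
Proof.
rewrite /cliqueF; move: k.+1 => K hs; rewrite ev_ands all_map; split=> [/allP h a b ha hb hab|h].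
  have := h a; rewrite mem_iota add0n ha /= ev_ands all_map => /(_ isT) /allP /(_ b).
  rewrite mem_iota add0n hb /= (negPf hab) ev_and ev_not ev_eq => /(_ isT) /andP[h1 h2].
  by split=> //; move: h2; rewrite /beKF ev_or.
apply/allP=> a; rewrite mem_iota add0n => /andP[_ ha] /=; rewrite ev_ands all_map; apply/allP => b.
rewrite mem_iota add0n => /andP[_ hb] /=; case: eqP => // /eqP hab.
by have [h1 h2] := h a b ha hb hab; rewrite ev_and ev_not ev_eq /beKF ev_or; apply/andP.
Qed.

End At.

Theorem diomega_NP : in_NP (diomega_ordering k).
Proof.
(* The matrix of the order is exactly as long as the input, hence the bound ['X]. *)
exists (fun x u => evF x u [:: size x; size u] memF), 'X%R; split; first exact: fo_verifier.
move=> x; rewrite hornerX; split.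
  move=> [n [T [ex /diclP [g [hg hb]]]]].
  pose e : rel 'I_n := fun i j => g i < g j.
  pose u := matrix_word e.
  have sz (e' : rel 'I_n) : size (matrix_word e') = n * n.
    by rewrite /matrix_word size_allpairs !size_enum_ord.
  have hx (i j : 'I_n) : nth false x (i * n + j) = T i j by rewrite ex (matrix_nth T).
  have hu (i j : 'I_n) : nth false u (i * n + j) = e i j by rewrite (matrix_nth e).
  have sx : size x = n * n by rewrite ex; apply: (sz T).
  exists u; split; first by rewrite sz sx.
  rewrite /memF ev_ex; apply/hasP; exists n.
    by rewrite mem_iota /= sx; nia.
  rewrite [rcons _ _]/= ev_and ev_eq; apply/andP; split; first by rewrite /= sx.
  rewrite ev_and; apply/andP; split.
    apply/pairFE => a b ha hb'; rewrite (hx (Ordinal ha) (Ordinal hb')) (hx (Ordinal hb') (Ordinal ha)).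
    rewrite (hu (Ordinal ha) (Ordinal hb')) (hu (Ordinal hb') (Ordinal ha)).
    case: eqP => [eab|/eqP hne].
      subst b; have -> : Ordinal hb' = Ordinal ha by apply: val_inj.
      by rewrite arc_irrefl /e ltnn.
    have hne' : Ordinal ha != Ordinal hb' by [].
    rewrite (arc_orient T hne') eqxx /= /e -neq_ltn.
    by apply: contra hne' => /eqP /hg ->.
  rewrite ev_and; apply/andP; split.
    apply/transFE => a b c ha hb' hc.
    rewrite (hu (Ordinal ha) (Ordinal hb')) (hu (Ordinal hb') (Ordinal hc)) (hu (Ordinal ha) (Ordinal hc)).
    exact: ltn_trans.
  rewrite ev_not; apply/negP.
  move/(@ev_exN x u n k.+1 cliqueF [:: size x; size u; n] isT erefl) => [s [hs hall]].
  move/(@cliqueFE x u n s hs) => hcl.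
  pose s' : seq 'I_n := pmap insub s.
  have es : map val s' = s.
    rewrite /s' (pmap_filter (@insubK _ _ _)); apply/all_filterP.
    by apply: sub_all hall => y hy; rewrite insubT.
  have ss : size s' = k.+1 by rewrite -hs -es size_map.
  have : cls (be T g) s'.
    apply/clsP; split.
      rewrite -(map_inj_uniq val_inj) es; apply/(uniqP 0) => a b; rewrite !inE hs => ha hb' hab.
      by apply/eqP; apply: contraT => hne; have [] := hcl a b ha hb' hne; rewrite hab eqxx.
    move=> a b /(nthP a) [i hi ea] /(nthP a) [j hj eb] hab.
    rewrite ss in hi hj.
    have hij : i != j by apply: contraNneq hab => hij; rewrite -ea -eb hij.
    have ni : nth 0 s i = a by rewrite -es (nth_map a) ?ss // ea.
    have nj : nth 0 s j = b by rewrite -es (nth_map a) ?ss // eb.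
    have [_] := hcl i j hi hj hij; rewrite ni nj !hx !hu.
    by rewrite /be /e.
  by move/hb; rewrite ss ltnn.
move=> [u [_]]; rewrite /memF ev_ex => /hasP[n _].
rewrite [rcons _ _]/= ev_and ev_eq => /andP[/eqP sx]; rewrite [evT _ _]/= [evT _ _]/= in sx.
rewrite ev_and => /andP[/pairFE hp]; rewrite ev_and => /andP[/transFE ht].
rewrite ev_not => hncl.
pose e : rel 'I_n := fun i j => nth false x (i * n + j).
pose r : rel 'I_n := fun i j => nth false u (i * n + j).
have hpe (i j : 'I_n) : if i == j then ~~ e i j && ~~ r i j else
    (e i j == ~~ e j i) && (r i j || r j i).
  by rewrite -val_eqE; apply: (hp _ _ (ltn_ord i) (ltn_ord j)).
have h1 : irreflexive e by move=> i; have := hpe i i; rewrite eqxx => /andP[/negbTE].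
have h2 i j : i != j -> e i j = ~~ e j i.
  by move=> hij; have := hpe i j; rewrite (negPf hij) => /andP[/eqP].
have [|||g [hg hr]] := @order_rank _ r.
- by move=> i; have := hpe i i; rewrite eqxx => /andP[_ /negbTE].
- by move=> b a c; apply: ht.
- by move=> i j hij; have := hpe i j; rewrite (negPf hij) => /andP[].
exists n, (Tournament h1 h2); split.
  by rewrite -[LHS](mkseq_nth false) sx; apply/esym/(matrix_wordE (T := e)).
apply/diclP; exists g; split=> // s hs; rewrite leqNgt; apply/negP => hk.
case/negP: hncl; apply/(@ev_exN x u n k.+1 cliqueF [:: size x; size u; n] isT erefl).
have st : size (take k.+1 s) = k.+1 by rewrite size_takel.
exists (map val (take k.+1 s)); split; first by rewrite size_map.
  by apply/allP=> _ /mapP[i _ ->]; apply: ltn_ord.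
apply/(@cliqueFE x u n); first by rewrite size_map.
have /clsP[hu hcl] := hs.
move=> a b ha hb hab; have [i0 hi0] : exists i0 : 'I_n, true.
  by case: (s) hk => [//|i0 ? _]; exists i0.
have na c : c < k.+1 -> nth 0 (map val (take k.+1 s)) c = nth i0 s c.
  by move=> hc; rewrite (nth_map i0) ?st // nth_take.
rewrite !na //.
have la := leq_trans ha hk; have lb := leq_trans hb hk.
have hne : nth i0 s a != nth i0 s b by rewrite nth_uniq.
split=> //; have := hcl _ _ (mem_nth i0 la) (mem_nth i0 lb) hne.
by rewrite /be -!hr.
Qed.

End Membership.

Unset Implicit Arguments.

Theorem theorem3p1 (k : nat) (hk : 3 <= k) : NP_complete (diomega_ordering k).
Proof. by split; [exact: diomega_NP|exact: diomega_hard]. Qed.
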